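(* Let $\mathbf n=(n_1,\dots,n_r)$ with $r\ge1$ and $n_i\ge2$ for all $i$. For every integer $k$ with $0\le k\le\sum_{i=1}^r\big\lfloor\frac{n_i-2}{2}\big\rfloor$ we have $\delta_{pr}(k,\mathbf n)=2k+r+1$.
   Context: $\Delta_m$ denotes the $m$-dimensional simplex; for $\mathbf n=(n_1,\dots,n_r)$, $\Delta_{\mathbf n}:=\Delta_{n_1}\times\dots\times\Delta_{n_r}$. The $k$-skeleton of a polytope is the poset of its faces of dimension at most $k$; two $k$-skeleta are combinatorially equivalent if these posets are isomorphic. A convex polytope is $(k,\mathbf n)$-PSN if its $k$-skeleton is combinatorially equivalent to that of $\Delta_{\mathbf n}$, and $(k,\mathbf n)$-PPSN if in addition it is the image under a linear projection of a polytope combinatorially equivalent to $\Delta_{\mathbf n}$. $\delta_{pr}(k,\mathbf n)$ is the smallest dimension of a $(k,\mathbf n)$-PPSN polytope. *)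

(* Defs.v *)
(* real convex polytopes in R^d, with points represented as
   nat -> R (a point of R^d vanishes at all coordinates i >= d). *)
From Stdlib Require Import Reals List Arith.
Import ListNotations.
Open Scope R_scope.

Definition point := nat -> R.
Definition pset := point -> Prop.

Definition in_Rd (d : nat) (x : point) : Prop := forall i, (d <= i)%nat -> x i = 0.

Fixpoint lsum (l : list R) : R :=
  match l with [] => 0 | a :: t => a + lsum t end.

Definition comb (lam : list R) (V : list point) : point :=
  fun i => lsum (map (fun p => fst p * snd p i) (combine lam V)).

Definition conv (V : list point) : pset :=
  fun x => exists lam : list R,
    length lam = length V /\ Forall (fun c => 0 <= c) lam /\ lsum lam = 1 /\
    forall i, x i = comb lam V i.

(* V is a finite list of points of R^d; the polytope is conv V *)
Definition polytope (d : nat) (V : list point) : Prop := Forall (in_Rd d) V.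

Definition dot (d : nat) (a x : point) : R :=
  lsum (map (fun i => a i * x i) (seq 0 d)).

(* F is a face of P (subset of R^d): intersection of P with a supporting
   hyperplane a.x = b of a valid inequality a.x <= b (includes the empty face
   and P itself) *)
Definition is_face (d : nat) (P F : pset) : Prop :=
  exists (a : point) (b : R),
    (forall x, P x -> dot d a x <= b) /\
    forall x, F x <-> (P x /\ dot d a x = b).

Definition aff_indep (pts : list point) : Prop :=
  forall lam : list R, length lam = length pts -> lsum lam = 0 ->
    (forall i, comb lam pts i = 0) -> Forall (fun c => c = 0) lam.

(* affine dimension of F is at most k (k >= 0; the empty set has dim -1) *)
Definition affdim_le (F : pset) (k : nat) : Prop :=
  forall pts : list point, length pts = (k + 2)%nat -> Forall F pts -> ~ aff_indep pts.

Definition affdim_eq (F : pset) (k : nat) : Prop :=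
  (exists pts : list point, length pts = S k /\ Forall F pts /\ aff_indep pts) /\
  affdim_le F k.

Definition subset (F G : pset) : Prop := forall x, F x -> G x.

(* isomorphism of the posets (A, subset) and (B, subset) of sets, where sets
   are identified up to extensional equality *)
Definition poset_iso (A B : pset -> Prop) : Prop :=
  exists f : pset -> pset,
    (forall F, A F -> B (f F)) /\
    (forall F G, A F -> A G -> (subset F G <-> subset (f F) (f G))) /\
    (forall G, B G -> exists F, A F /\ subset (f F) G /\ subset G (f F)).

Definition face_poset (d : nat) (P : pset) : pset -> Prop := is_face d P.
Definition skeleton (d : nat) (P : pset) (k : nat) : pset -> Prop :=
  fun F => is_face d P F /\ affdim_le F k.

(* Delta_{n_1} x ... x Delta_{n_r}, where Delta_m = conv(e_0,...,e_m) in R^{m+1};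
   the product lives in R^{sum (n_i+1)} *)
Fixpoint prod_verts (ns : list nat) : list point :=
  match ns with
  | [] => [fun _ => 0]
  | n :: ns' =>
      flat_map (fun j => map (fun v : point => fun i : nat =>
                   if (i <? S n)%nat then (if (i =? j)%nat then 1 else 0)
                   else v (i - S n)%nat) (prod_verts ns'))
               (seq 0 (S n))
  end.

Definition prod_dim (ns : list nat) : nat := fold_right (fun n acc => (S n + acc)%nat) 0%nat ns.

Definition Delta (ns : list nat) : pset := conv (prod_verts ns).

Definition linmap (e m : nat) (A : nat -> nat -> R) (x : point) : point :=
  fun i => if (i <? e)%nat then lsum (map (fun j => A i j * x j) (seq 0 m)) else 0.

Definition PSN (k : nat) (ns : list nat) (e : nat) (V : list point) : Prop :=
  polytope e V /\
  poset_iso (skeleton e (conv V) k) (skeleton (prod_dim ns) (Delta ns) k).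

Definition PPSN (k : nat) (ns : list nat) (e : nat) (V : list point) : Prop :=
  PSN k ns e V /\
  exists (m : nat) (W : list point) (A : nat -> nat -> R),
    polytope m W /\
    poset_iso (face_poset m (conv W)) (face_poset (prod_dim ns) (Delta ns)) /\
    forall y, conv V y <-> exists x, conv W x /\ forall i, y i = linmap e m A x i.

Definition delta_pr_is (k : nat) (ns : list nat) (D : nat) : Prop :=
  (exists e V, PPSN k ns e V /\ affdim_eq (conv V) D) /\
  (forall e V D', PPSN k ns e V -> affdim_eq (conv V) D' -> (D <= D')%nat).

(* Main.v *)
(* Write N = sum (n_i + 1), so that the faces of Delta_n correspond to the sets
   of coordinates that meet all r blocks, the face of S having dimension |S| - r.

   Upper bound. Send the vertex e_c of the i-th simplex to the point whose i-th
   coordinate is c and whose last 2k+1 coordinates are double sums of the powers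
   c^0, ..., c^(2k).  By Farkas' lemma, a face S with |S| <= k + r is preserved
   unless some lambda, nonnegative outside S, is orthogonal to the constants and
   to c on every block and to the 2k+1 double sums.  The double tail sum of such
   a lambda is negative on at most k intervals of integers, so a polynomial of
   degree at most 2k has its sign pattern; orthogonality then makes it vanish.

   Lower bound. Since the k-skeleton has the right combinatorial type, the
   projection preserves all faces of dimension at most k.  If the image had
   dimension at most 2k + r, split k = sum k_i with 2 k_i + 2 <= n_i and choose
   2 k_i + 3 facets from the i-th block.  The Borsuk-Ulam theorem yields a nonzero
   direction in the kernel of the projection that is parallel to all the other
   facets and along which at most k_i + 1 facet functionals of each block decrease
   (a ham sandwich cut; one block is handled by the sign of the direction, since
   2 k_i + 3 is odd).  Some face of dimension at most k is contained in none of
   these facets; moving from its relative interior in that direction shows that a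
   face of dimension at most k is not preserved. *)

Require Import Defs.
From Stdlib Require Import Reals List Arith.
From mathcomp Require all_boot all_order all_algebra boolp classical_sets zify ring lra.
From mathcomp Require reals topology normedtype sequences Rstruct.

(** * The Borsuk-Ulam theorem and halving by a linear form *)

(** The constant comes from a count. If the image has affine dimension $D'$, keeping a direction in
    the kernel costs $D'+1$ equations, the facets left out cost $N-2k-3r$, and halving all blocks
    but one costs $r-1$; a sphere of dimension $N-r$ allows this many conditions as long as $D'\le
    2k+r$. In the construction, $r$ coordinates serve the linear functions on blocks and $2k+1$ the
    powers; constants on blocks take no coordinate, since each block of coordinates sums to one.
    Orthogonality to the affine functions on each block makes the double tail sum local to blocks,
    so each interval of negativity follows an element of $S$ that is not the last of its block, and
    there are at most $|S|-r\le k$ of these. Three obstacles shape the rest. The number of negative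
    forms is not continuous, so Borsuk-Ulam is needed for closed sets. The isomorphism of skeleta is
    abstract and unrelated to the projection, so preservation of low faces has to be won by
    counting. The projected polytope is only combinatorially a product of simplices, so directions
    are encoded by coefficients at points of it, and it is recovered, inside its affine hull, from
    its facet inequalities. *)

Module BorsukUlamTheorem.
Import all_boot all_order all_algebra boolp classical_sets zify.
Import reals topology normedtype sequences.
Import Order.TTheory GRing.Theory Num.Theory numFieldNormedType.Exports.
Set Implicit Arguments. Unset Strict Implicit. Unset Printing Implicit Defensive.
Local Open Scope ring_scope.

(** * Chains modulo 2 and their coboundaries *)

Section Chains.
Variable T : Type.
Implicit Types (s : seq T) (c : seq (seq T)) (phi : seq T -> bool).

(* Chains modulo 2 are sequences of ordered simplices, only observed through the
   parities [ev phi]; the boundary is augmented, [[::]] being the (-1)-simplex. *)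
Fixpoint bd s : seq (seq T) :=
  if s is b :: s' then s' :: map (cons b) (bd s') else [::].

Definition ev phi c : bool := \big[addb/false]_(s <- c) phi s.

Definition cobd phi s : bool := ev phi (bd s).

Lemma ev_cons phi s c : ev phi (s :: c) = phi s (+) ev phi c.
Proof. by rewrite /ev big_cons. Qed.

Lemma ev_cat phi c1 c2 : ev phi (c1 ++ c2) = ev phi c1 (+) ev phi c2.
Proof. by rewrite /ev big_cat. Qed.

Lemma ev_map phi (f : seq T -> seq T) c : ev phi (map f c) = ev (phi \o f) c.
Proof. by rewrite /ev big_map. Qed.

Lemma ev_add phi psi c :
  ev (fun s => phi s (+) psi s) c = ev phi c (+) ev psi c.
Proof. by rewrite /ev big_split. Qed.

Lemma ev_andl b phi c : ev (fun s => b && phi s) c = b && ev phi c.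
Proof. by rewrite /ev; case: b => //=; rewrite big1_eq. Qed.

Lemma ev_flatten phi (f : seq T -> seq (seq T)) c :
  ev phi (flatten (map f c)) = ev (fun s => ev phi (f s)) c.
Proof.
by elim: c => [|s c IH] /=; [rewrite /ev !big_nil | rewrite ev_cat ev_cons IH].
Qed.

Lemma eq_ev phi psi c : phi =1 psi -> ev phi c = ev psi c.
Proof. by move=> e; apply: eq_bigr => s _. Qed.

Lemma ev0 c : ev (fun=> false) c = false.
Proof. exact: big1_eq. Qed.

Lemma cobd_cons phi b s : cobd phi (b :: s) = phi s (+) cobd (phi \o cons b) s.
Proof. by rewrite /cobd /= ev_cons ev_map. Qed.

(** Dual form of the boundary of a boundary being zero. For [b :: s] the face [s] contributes
    [cobd phi s], and so do the other faces when their apex [b] is deleted; modulo 2 these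
    cancel. *)
Lemma cobdK phi s : cobd (cobd phi) s = false.
Proof.
elim: s phi => [|b s IH] phi; first by rewrite /cobd /ev big_nil.
rewrite cobd_cons [X in _ (+) X](_ : _ =
   cobd (fun s => phi s (+) cobd (phi \o cons b) s) s); last first.
  by apply: eq_ev => t /=; rewrite cobd_cons.
by rewrite [X in _ (+) X]ev_add [ev (cobd _) _]IH addbF addbb.
Qed.

End Chains.

Lemma bd_map (T1 T2 : Type) (f : T1 -> T2) s :
  bd (map f s) = map (map f) (bd s).
Proof.
by elim: s => //= b s ->; congr cons; rewrite -!map_comp.
Qed.

(** * Cup products of sign changes *)

Section Crossing.
Variables (T : Type) (sg : nat -> T -> bool).

(* The cup product of [j] coboundaries of sign functions: the [i]-th
   edge from the end has to change the sign [sg i]. *)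
Fixpoint crossing j (s : seq T) : bool :=
  if s is v0 :: s' then
    if j is j'.+1 then
      if s' is v1 :: _ then (sg j' v0 (+) sg j' v1) && crossing j' s' else false
    else nilp s'
  else false.

Definition halfcrossing j (s : seq T) : bool :=
  if s is v0 :: _ then sg j v0 && crossing j s else false.

(** Leibniz rule for a cup product: the 0-cochain [sg j] has coboundary [sg j v0 (+) sg j v1], and
    the other factor, being a cocycle, contributes nothing. *)
Lemma cobd_halfcrossing j s : (forall t, cobd (crossing j) t = false) ->
  cobd (halfcrossing j) s = crossing j.+1 s.
Proof.
move=> E; case: s => [|v0 [|v1 s]].
- by rewrite /cobd /ev big_nil.
- by rewrite /cobd /= ev_cons /ev big_nil.
rewrite cobd_cons.
have -> : cobd (halfcrossing j \o cons v0) (v1 :: s) =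
    sg j v0 && cobd (crossing j \o cons v0) (v1 :: s) by exact: ev_andl.
have -> : cobd (crossing j \o cons v0) (v1 :: s) = crossing j (v1 :: s).
  have := E [:: v0, v1 & s]; rewrite cobd_cons.
  by case: (crossing j _); case: (cobd _ _).
rewrite /halfcrossing [crossing j.+1 _]/=.
by case: (sg j v0); case: (sg j v1); case: (crossing j _).
Qed.

(** For positive index, [crossing] is the coboundary of [halfcrossing], hence closed by [cobdK];
    [crossing 0] is the indicator of single vertices, and an edge has two of them. *)
Lemma crossing_cocycle j s : cobd (crossing j) s = false.
Proof.
elim: j s => [|j IH] s; last first.
  rewrite -(cobdK (halfcrossing j) s); apply: eq_ev => t.
  by rewrite cobd_halfcrossing.
case: s => [|v0 [|v1 [|v2 s]]]; rewrite /cobd /= ?ev_cons ?ev_map /=.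
- by rewrite /ev big_nil.
- by rewrite /ev big_nil.
- by rewrite /ev big_nil.
- exact: ev0.
Qed.

Definition crossing_step j s := cobd_halfcrossing s (@crossing_cocycle j).

End Crossing.

(** * Iterated barycentric subdivision *)

Section Subdivision.
Variables (R : realType) (V : normedModType R).
Implicit Types (s t : seq V) (c : seq (seq V)) (phi : seq V -> bool).

Definition bary s : V := (size s)%:R^-1 *: \sum_(v <- s) v.

(** The fuel [k] is the number of vertices: the recursion passes to the faces in [bd s], which are
    not subterms of [s]. The empty simplex is its own subdivision. *)
Fixpoint sd_rec k s : seq (seq V) :=
  if k is k'.+1 then map (cons (bary s)) (flatten (map (sd_rec k') (bd s)))
  else [:: [::]].

Definition sd s := sd_rec (size s) s.
Definition sdc c := flatten (map sd c).

Lemma bd_size s : all (fun t => size t == (size s).-1) (bd s).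
Proof.
elim: s => // b s IH; rewrite [bd _]/= /all -/(all _ _) eqxx all_map /=.
apply/allP => t tb; have /allP/(_ _ tb)/eqP /= -> := IH.
by case: s tb {IH}.
Qed.

Lemma sd_bd s : s != [::] -> sd s = map (cons (bary s)) (sdc (bd s)).
Proof.
case: s => // b s _; congr (map _ (flatten _)); apply/eq_in_map => t tb; rewrite /sd.
by have /allP/(_ _ tb)/eqP -> := bd_size (b :: s).
Qed.

(** Subdivision is a chain map, stated through parities. The subdivision of [s] is the cone from its
    barycentre over the subdivided boundary; the boundary of this cone is its base plus a cone over
    the subdivided boundary of the boundary, which is zero. *)
Lemma ev_sd_cobd phi s :
  ev (cobd phi) (sd s) = ev (fun t => ev phi (sd t)) (bd s).
Proof.
move: {2}(size s) (leqnn (size s)) => k.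
elim: k s phi => [|k IH] s phi.
  by rewrite leqn0 size_eq0 => /eqP ->; rewrite /sd /= /ev !big_cons !big_nil /cobd /ev big_nil.
have [->|s0] := eqVneq s [::].
  by rewrite /sd /= /ev !big_cons !big_nil /cobd /ev big_nil.
move=> sk; rewrite (sd_bd s0) ev_map.
rewrite (eq_ev (psi := fun t => phi t (+) cobd (phi \o cons (bary s)) t)); last first.
  by move=> t; rewrite /= cobd_cons.
rewrite ev_add {1}/sdc ev_flatten [X in _ (+) X](_ : _ = false) ?addbF //.
rewrite /sdc ev_flatten.
rewrite [LHS](_ : _ = cobd (fun t => cobd (fun u => ev (phi \o cons (bary s)) (sd u)) t) s).
  exact: cobdK.
apply: eq_big_seq => t tb; apply: IH; rewrite -ltnS; apply: leq_trans sk.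
have /allP/(_ _ tb)/eqP -> := bd_size s.
by case: (s) s0.
Qed.

Definition sdn M c := iter M sdc c.

Lemma ev_sdn_cobd phi M c :
  ev (cobd phi) (sdn M c) = ev phi (sdn M (flatten (map (@bd _) c))).
Proof.
elim: M phi => [|M IH] phi /=; first by rewrite ev_flatten.
rewrite /sdc !ev_flatten -IH; apply: eq_ev => s; exact: ev_sd_cobd.
Qed.

Lemma sdn_cat M c1 c2 : sdn M (c1 ++ c2) = sdn M c1 ++ sdn M c2.
Proof. by elim: M => //= M ->; rewrite /sdc map_cat flatten_cat. Qed.

Lemma ev_sdn M phi c : ev phi (sdn M c) = ev (fun s => ev phi (sdn M [:: s])) c.
Proof.
elim: c => [|s c IH]; last by rewrite ev_cons -IH -ev_cat -sdn_cat.
have -> : sdn M [::] = [::] by elim: M => //= M ->.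
by rewrite /ev !big_nil.
Qed.

Definition neg c := map (map -%R) c.

Lemma bary_opp s : bary (map -%R s) = - bary s.
Proof. by rewrite /bary size_map big_map sumrN scalerN. Qed.

Lemma sd_opp s : sd (map -%R s) = neg (sd s).
Proof.
move: {2}(size s) (leqnn (size s)) => k; elim: k s => [|k IH] s.
  by rewrite leqn0 size_eq0 => /eqP ->.
have [-> //|s0] := eqVneq s [::] => sk.
rewrite !sd_bd //; last by case: (s) s0.
rewrite bary_opp bd_map /neg.
have -> : sdc (map (map -%R) (bd s)) = map (map -%R) (sdc (bd s)).
  rewrite /sdc map_flatten -!map_comp; congr flatten.
  apply/eq_in_map => t tb; apply: IH; rewrite -ltnS.
  apply: leq_trans sk; have /allP/(_ _ tb)/eqP -> := bd_size s.
  by case: (s) s0.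
by rewrite -!map_comp.
Qed.

Lemma sdn_neg M c : sdn M (neg c) = neg (sdn M c).
Proof.
elim: M => //= M ->; rewrite /sdc /neg map_flatten -!map_comp.
by congr flatten; apply: eq_map => s /=; rewrite sd_opp.
Qed.

Definition bary_closed (B : V -> Prop) :=
  forall s, s != [::] -> {in s, forall v, B v} -> B (bary s).

Lemma bd_sub s t : t \in bd s -> {subset t <= s}.
Proof.
elim: s t => //= b s IH t; rewrite inE => /predU1P[-> v vs|].
  by rewrite inE vs orbT.
case/mapP=> u us -> v; rewrite !inE => /predU1P[->|/(IH _ us) ->]; rewrite ?eqxx //.
by rewrite orbT.
Qed.

(** Induction along the cone structure of a subdivision: [Q] is what a simplex passes on to its
    faces, [P] what a subdivided face passes on to the cone over it. *)
Lemma sd_ind (P : seq V -> Prop) (Q : seq V -> Prop) : P [::] ->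
  (forall s t, s != [::] -> Q s -> t \in bd s -> Q t) ->
  (forall s u t, s != [::] -> Q s -> t \in bd s -> u \in sd t -> P u -> P (bary s :: u)) ->
  forall s t, Q s -> t \in sd s -> P t.
Proof.
move=> P0 QQ PP s; move: {2}(size s) (leqnn (size s)) => k.
elim: k s => [|k IH] s.
  by rewrite leqn0 size_eq0 => /eqP -> t _; rewrite inE => /eqP ->.
have [->|s0 sk] := eqVneq s [::].
  by move=> _ t _; rewrite inE => /eqP ->.
move=> t Qs; rewrite sd_bd // => /mapP[u /flatten_mapP[w ws uw] ->].
apply: (PP _ _ w) => //; apply: (IH w) => //; last exact: QQ ws.
rewrite -ltnS; apply: leq_trans sk; have /allP/(_ _ ws)/eqP -> := bd_size s.
by case: (s) s0.
Qed.

Lemma sd_closed B s t : bary_closed B -> {in s, forall v, B v} ->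
  t \in sd s -> {in t, forall v, B v}.
Proof.
move=> cB; apply: (sd_ind (P := fun t => {in t, forall v, B v})
  (Q := fun s => {in s, forall v, B v})) => //.
  by move=> {}s {}t _ h /bd_sub st v /st /h.
by move=> {}s u {}t s0 h _ _ h' v; rewrite inE => /predU1P[->|/h'//]; apply: cB.
Qed.

Lemma sd_size s t : t \in sd s -> size t = size s.
Proof.
move: {2}(size s) (leqnn (size s)) => k; elim: k s t => [|k IH] s t.
  by rewrite leqn0 size_eq0 => /eqP ->; rewrite inE => /eqP ->.
have [->|s0 sk] := eqVneq s [::]; first by move=> _; rewrite inE => /eqP ->.
rewrite sd_bd // => /mapP[u /flatten_mapP[w ws uw] ->] /=.
have /allP/(_ _ ws)/eqP e := bd_size s.
have w1 : (size w).+1 = size s by rewrite e; case: (s) s0.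
by rewrite (IH w) // -ltnS w1.
Qed.

Definition mesh_le D s := {in s &, forall v w, `|v - w| <= D}.

Lemma bary_ball b r : bary_closed (fun v => `|v - b| <= r).
Proof.
move=> s s0 h; have n0 : (size s)%:R != 0 :> R by rewrite pnatr_eq0 size_eq0.
rewrite -[b in _ - b](scalerK n0) /bary scaler_nat -scalerBr.
have -> : \sum_(v <- s) v - b *+ size s = \sum_(v <- s) (v - b).
  by rewrite sumrB; congr (_ - _); rewrite big_const_seq count_predT iter_addr_0.
rewrite normrZ ger0_norm ?invr_ge0 ?ler0n // ler_pdivrMl; last first.
  by rewrite ltr0n lt0n size_eq0.
apply: le_trans (ler_norm_sum _ _ _) _.
rewrite mulrC mulr_natr -iter_addr_0 -(count_predT s) -big_const_seq.
by rewrite big_seq [leRHS]big_seq; apply: ler_sum => v /h.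
Qed.

(** In [v - bary s], the average of [v - w] over [w] in [s], the term [w = v] vanishes; this is the
    gain over [D]. *)
Lemma bary_far D s v : mesh_le D s -> v \in s ->
  `|v - bary s| <= (1 - (size s)%:R^-1) * D.
Proof.
move=> hD vs; have s0 : s != [::] by case: (s) vs.
have n0 : (size s)%:R != 0 :> R by rewrite pnatr_eq0 size_eq0.
have np : 0 < (size s)%:R :> R by rewrite ltr0n lt0n size_eq0.
rewrite -[v in `|v - _|](scalerK n0) /bary scaler_nat -scalerBr.
have -> : v *+ size s - \sum_(w <- s) w = \sum_(w <- s) (v - w).
  by rewrite sumrB; congr (_ - _); rewrite big_const_seq count_predT iter_addr_0.
rewrite normrZ ger0_norm ?invr_ge0 ?ler0n // ler_pdivrMl //.
apply: le_trans (ler_norm_sum _ _ _) _.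
rewrite mulrA mulrBr mulr1 divff // (perm_big _ (perm_to_rem vs)) big_cons /=.
rewrite subrr normr0 add0r -(prednK (_ : 0 < size s)%N) ?lt0n ?size_eq0 //.
rewrite -natr1 addrK mulrC mulr_natr -(size_rem vs) -iter_addr_0.
rewrite -(count_predT (rem v s)) -big_const_seq big_seq [leRHS]big_seq.
by apply: ler_sum => w /mem_rem ws; apply: hD.
Qed.

(** An edge of the subdivision lies in a subdivided proper face or joins the barycentre to a vertex
    of one; such a vertex stays in a ball about the barycentre that contains [s], since balls are
    closed under barycentres. Using [K] instead of the size of [s] gives one factor for all
    faces. *)
Lemma mesh_sd K D s t : 0 <= D -> mesh_le D s -> (size s <= K)%N ->
  t \in sd s -> mesh_le ((1 - K%:R^-1) * D) t.
Proof.
move=> D0 hD sK.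
have [s0|s0] := eqVneq s [::]; first by rewrite s0 inE => /eqP ->.
apply: (sd_ind (P := mesh_le ((1 - K%:R^-1) * D))
  (Q := fun s => mesh_le D s /\ (size s <= K)%N)) => // {s0 t sK hD}s.
  move=> t s0 [hD sK] tb; split=> [v w /(bd_sub tb) vs /(bd_sub tb) ws|].
    exact: hD.
  have /allP/(_ _ tb)/eqP -> := bd_size s.
  by apply: leq_trans sK; apply: leq_pred.
move=> u t s0 [hD sK] tb ut hu.
have far : {in u, forall v, `|v - bary s| <= (1 - K%:R^-1) * D}.
  apply: (sd_closed (@bary_ball (bary s) _) _ ut) => v /(bd_sub tb) vs.
  apply: le_trans (bary_far hD vs) _; rewrite ler_wpM2r // lerD2l lerN2.
  by rewrite lef_pV2 ?ler_nat ?posrE ?ltr0n // ?(leq_trans _ sK) // lt0n size_eq0.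
have K0 : (0 < K)%N by apply: leq_trans sK; rewrite lt0n size_eq0.
have c0 : 0 <= (1 - K%:R^-1) * D.
  by rewrite mulr_ge0 // subr_ge0 invf_le1 ?ler1n ?ltr0n.
move=> v w; rewrite !inE => /predU1P[->|vu] /predU1P[->|wu].
- by rewrite subrr normr0.
- by rewrite distrC far.
- exact: far.
- exact: hu.
Qed.

Lemma sdn_ind (P : seq V -> Prop) M c : {in c, forall s, P s} ->
  (forall s t, P s -> t \in sd s -> P t) -> {in sdn M c, forall s, P s}.
Proof.
move=> Pc Psd; elim: M => //= M IH t /flatten_mapP[s /IH Ps]; exact: Psd.
Qed.

Lemma mesh_sdn K D M c : (0 < K)%N -> 0 <= D ->
  {in c, forall s, mesh_le D s /\ size s = K} ->
  {in sdn M c, forall s, mesh_le ((1 - K%:R^-1) ^+ M * D) s /\ size s = K}.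
Proof.
move=> K0 D0 hc; elim: M => [|M IH] t; first by rewrite expr0 mul1r; apply: hc.
move=> /flatten_mapP[s /IH[hs sK] ts]; split; last by rewrite (sd_size ts).
rewrite exprS -mulrA; apply: mesh_sd ts => //; last by rewrite sK.
by rewrite mulr_ge0 // exprn_ge0 // subr_ge0 invf_le1 ?ler1n ?ltr0n.
Qed.

End Subdivision.

(** * Hemispheres of the octahedral sphere *)

Section Octahedral.
Variables (R : realType) (V : normedModType R) (e : nat -> V).

(** A hemisphere of the octahedral [j]-sphere: the cone from [e j] over the whole sphere one
    dimension lower, which is made of two antipodal hemispheres. *)
Fixpoint oct j : seq (seq V) :=
  if j is j'.+1 then map (cons (e j)) (oct j' ++ neg (oct j')) else [:: [:: e 0]].

Lemma ev_cobd_neg (phi : seq V -> bool) c :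
  ev (cobd phi) (neg c) = ev (cobd (phi \o map -%R)) c.
Proof.
by rewrite /neg ev_map; apply: eq_ev => s /=; rewrite /cobd bd_map ev_map.
Qed.

Lemma negK c : neg (neg c) = c :> seq (seq V).
Proof. by rewrite /neg mapK // => s; rewrite mapK //; apply: opprK. Qed.

(** The boundary of a hemisphere is its equator. The remaining term is a cone over the boundary of
    the equator; it cancels because the boundary of a hemisphere is antipodally symmetric, and [H]
    carries this symmetry through the induction. *)
Lemma ev_cobd_oct (phi : seq V -> bool) j :
  ev (cobd phi) (oct j.+1) = ev phi (oct j) (+) ev phi (neg (oct j)).
Proof.
suff H i psi : ev (cobd psi) (oct i) = ev (cobd (psi \o map -%R)) (oct i).
  rewrite /= ev_map.
  rewrite (eq_ev (psi := fun t => phi t (+) cobd (phi \o cons (e j.+1)) t)).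
    by rewrite ev_add !ev_cat [X in _ (+) X](_ : _ = false) ?addbF // ev_cobd_neg -H addbb.
  by move=> t; rewrite /= cobd_cons.
elim: i psi => [|i IH] psi; first by rewrite /ev !big_seq1 /cobd /ev !big_seq1.
have E chi : ev (cobd chi) (oct i.+1) = ev chi (oct i) (+) ev chi (neg (oct i)).
  rewrite /= ev_map.
  rewrite (eq_ev (psi := fun t => chi t (+) cobd (chi \o cons (e i.+1)) t)).
    by rewrite ev_add !ev_cat [X in _ (+) X](_ : _ = false) ?addbF // ev_cobd_neg -IH addbb.
  by move=> t; rewrite /= cobd_cons.
rewrite !E addbC; congr (_ (+) _); first by rewrite /neg ev_map.
by rewrite -{1}[oct i]negK {1}/neg ev_map.
Qed.

Variable sg : nat -> V -> bool.

Lemma crossing_opp j (s : seq V) :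
  {in s, forall v i, sg i (- v) = ~~ sg i v} ->
  crossing sg j (map -%R s) = crossing sg j s.
Proof.
elim: s j => // v0 [|v1 s] IH [|j] // H.
rewrite -[LHS]/((sg j (- v0) (+) sg j (- v1)) && crossing sg j (map -%R (v1 :: s))).
rewrite IH => [|v vs i]; last by rewrite H // inE vs orbT.
by rewrite !H ?inE ?eqxx ?orbT // addNb addbN negbK.
Qed.

(* Since the [sg k] are odd and [crossing sg j] is even, [cobd_halfcrossing] moves
   the evaluation from dimension [j.+1] down to dimension [j]. *)
Lemma ev_crossing_oct M j :
  (forall i, (i <= j)%N -> {in sdn M (oct i), forall s,
    {in s, forall v k, sg k (- v) = ~~ sg k v}}) ->
  ev (crossing sg j) (sdn M (oct j)) = true.
Proof.
elim: j => [|j IH] odd.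
  have -> : sdn M (oct 0) = oct 0.
    elim: M {odd} => //= M ->; rewrite /sdc /= /sd /= /bary.
    by rewrite invr1 scale1r big_seq1.
  by rewrite /ev big_seq1.
rewrite -(eq_ev _ (crossing_step sg j)) ev_sdn_cobd.
have E phi : ev phi (sdn M (flatten (map (@bd _) (oct j.+1)))) =
    ev phi (sdn M (oct j)) (+) ev phi (sdn M (neg (oct j))).
  by rewrite !(ev_sdn M phi) ev_flatten -ev_cobd_oct.
have {}IH := IH (fun i ij => odd i (leqW ij)).
rewrite E sdn_neg /neg ev_map -ev_add -IH /ev.
apply: eq_big_seq => s hs; have H := odd _ (leqnSn j) _ hs.
case: s hs H => [|v0 s] _ H; first by case: (j).
rewrite /halfcrossing [X in _ (+) X]/= -[- v0 :: _]/(map -%R (v0 :: s)).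
rewrite crossing_opp // H ?inE ?eqxx //.
by case: (sg j v0); case: (crossing _ _ _).
Qed.

(** The factor of index [c] in the cup product is an edge of [s] along which [sg c] changes; its two
    ends are the witnesses. *)
Lemma crossing_sign j (s : seq V) c : crossing sg j s -> (c < j)%N ->
  (exists2 v, v \in s & sg c v) /\ (exists2 v, v \in s & ~~ sg c v).
Proof.
elim: s j => [|v0 s IH] [|j]; rewrite ?ltn0 //.
case: s IH => [|v1 s] // IH /andP[h /IH {}IH].
rewrite ltnS leq_eqVlt => /predU1P[->|/IH[[v vs hv] [w ws hw]]]; last first.
  by split; [exists v | exists w] => //; rewrite inE ?vs ?ws orbT.
case E0 : (sg j v0) h; case E1 : (sg j v1) => //= _; split.
- by exists v0; rewrite ?inE ?eqxx.
- by exists v1; rewrite ?E1 // !inE eqxx orbT.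
- by exists v1; rewrite // !inE eqxx orbT.
- by exists v0; rewrite ?E0 ?inE ?eqxx.
Qed.

End Octahedral.

(** * Borsuk-Ulam for closed sets, by a limit over subdivisions *)

Section BorsukUlam.
Variables (R : realType) (n : nat).
Local Notation V := 'rV[R]_n.+1.
Implicit Types (v x : V).

Lemma coord_le_norm v i : `|v 0 i| <= `|v|.
Proof.
rewrite {2}/Num.norm /= mx_normrE; apply/bigmax_geP; right => /=.
by exists (0, i).
Qed.

Lemma norm_le_coord v (b : R) : 0 <= b -> (forall i, `|v 0 i| <= b) -> `|v| <= b.
Proof.
move=> b0 h; rewrite /Num.norm /= mx_normrE; apply/bigmax_leP; split=> //.
by move=> [i j] _ /=; rewrite (ord1 i).
Qed.

(** A facet of the cross-polytope, [sigma i] being true where the coordinate is nonpositive. It is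
    convex and avoids the origin, which keeps all subdivided simplices away from zero. *)
Definition orthant (sigma : 'I_n.+1 -> bool) (v : V) : Prop :=
  (forall i, 0 <= (-1) ^+ sigma i * v 0 i) /\
  \sum_i (-1) ^+ sigma i * v 0 i = 1.

Lemma orthant_closed sigma : bary_closed (orthant sigma).
Proof.
move=> s s0 h; have E i : bary s 0 i = (size s)%:R^-1 * \sum_(v <- s) v 0 i.
  by rewrite /bary mxE summxE.
have n0 : (size s)%:R != 0 :> R by rewrite pnatr_eq0 size_eq0.
split=> [i|].
  rewrite E mulrCA mulr_ge0 ?invr_ge0 ?ler0n // mulr_sumr big_seq.
  by apply: sumr_ge0 => v /h[].
under eq_bigr do rewrite E mulrCA mulr_sumr.
rewrite -mulr_sumr exchange_big /= (eq_big_seq (fun=> 1)) => [|v /h[]//].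
by rewrite big_const_seq count_predT iter_addr_0 mulVf.
Qed.

(** Row vectors carry the sup norm, whereas the points of an orthant have 1-norm one. *)
Lemma orthant_norm sigma v : orthant sigma v -> n.+1%:R^-1 <= `|v| <= 1.
Proof.
move=> [h0 h1]; have E i : `|v 0 i| = (-1) ^+ sigma i * v 0 i.
  by rewrite -(ger0_norm (h0 i)) normrM normrX normrN1 expr1n mul1r.
apply/andP; split.
  have e : `|v| * n.+1%:R = \sum_(i < n.+1) `|v|.
    by rewrite sumr_const card_ord mulr_natr.
  rewrite -div1r ler_pdivrMr ?ltr0n // e -[leLHS]h1; apply: ler_sum => i _.
  by rewrite -E coord_le_norm.
apply: norm_le_coord => // i; rewrite E -[leRHS]h1 (bigD1 i) //= lerDl.
by apply: sumr_ge0.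
Qed.

Definition e_ (j : nat) : V := delta_mx 0 (inord j).

(** The vanishing of the coordinates beyond [j] feeds the induction: it leaves the sign of
    coordinate [j.+1] free to be set to plus when the apex [e_ j.+1] is added. *)
Lemma oct_orthant j : (j <= n)%N -> {in oct e_ j, forall s,
  size s = j.+1 /\ exists2 sigma, {in s, forall v, orthant sigma v} &
    {in s, forall v (i : 'I_n.+1), (j < i)%N -> v 0 i = 0}}.
Proof.
have E (i : 'I_n.+1) k : (k <= n)%N -> e_ k 0 i = (i == k :> nat)%:R.
  by move=> kn; rewrite mxE eqxx -val_eqE /= inordK.
elim: j => [|j IH] jn s /=.
  rewrite inE => /eqP ->; split=> //; exists (fun=> false) => v; rewrite inE => /eqP ->.
    split=> [i|]; first by rewrite E // expr0 mul1r.
    rewrite (bigD1 ord0) //= E // big1 ?addr0 ?mul1r // => i i0.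
    by rewrite E // mul1r (_ : (i == 0 :> nat) = false) //; apply/negbTE.
  by move=> i i0; rewrite E // gtn_eqF.
case/mapP=> t tc ->.
have [st [sigma so sz]] : size t = j.+1 /\ exists2 sigma, {in t, forall v, orthant sigma v} &
    {in t, forall v (i : 'I_n.+1), (j < i)%N -> v 0 i = 0}.
  move: tc; rewrite mem_cat => /orP[/IH|]; first by apply; apply: ltnW.
  case/mapP=> u /(IH (ltnW jn))[su [sigma so sz]] ->; rewrite size_map; split=> //.
  exists (fun i => ~~ sigma i) => v /mapP[w wu ->]; last first.
    by move=> i ji; rewrite mxE sz // oppr0.
  have [h0 h1] := so _ wu.
  have F i : (-1) ^+ (~~ sigma i) * (- w) 0 i = (-1) ^+ sigma i * w 0 i.
    by rewrite mxE signrN mulNr mulrN opprK.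
  by split=> [i|]; [rewrite F | under eq_bigr do rewrite F].
split=> /=; first by rewrite st.
exists (fun i : 'I_n.+1 => ((i : nat) != j.+1) && sigma i) => v; rewrite inE => /predU1P[->|vt].
- split=> [i|]; first by rewrite E //; case: eqP => _; rewrite ?mul1r ?mulr0.
  rewrite (bigD1 (inord j.+1)) //= E // inordK // eqxx mul1r big1 ?addr0 // => i.
  by rewrite -val_eqE /= inordK // E // => /negbTE ->; rewrite mulr0.
- have [h0 h1] := so _ vt.
  have F (i : 'I_n.+1) : (-1) ^+ (((i : nat) != j.+1) && sigma i) * v 0 i = (-1) ^+ sigma i * v 0 i.
    by case: (eqVneq (i : nat) j.+1) => //= ei; rewrite sz ?ei // !mulr0.
  by split=> [i|]; [rewrite F | under eq_bigr do rewrite F].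
- by move=> i ji; rewrite E // gtn_eqF.
- by move=> i ji; rewrite sz // ltnW.
Qed.

(** Selects one point of each antipodal pair, to break ties where a set contains both [v] and
    [- v]. *)
Definition lexpos v : bool := if [pick i | v 0 i != 0] is Some i then 0 < v 0 i else false.

Lemma lexposN v : v != 0 -> lexpos (- v) = ~~ lexpos v.
Proof.
move=> v0; rewrite /lexpos.
have -> : [pick i | (- v) 0 i != 0] = [pick i | v 0 i != 0].
  by apply: eq_pick => i /=; rewrite mxE oppr_eq0.
case: pickP => [i vi|h]; first by rewrite mxE oppr_gt0 -leNgt le_eqVlt (negbTE vi).
by case/eqP: v0; apply/rowP => i; rewrite mxE; apply/eqP/negbFE/h.
Qed.

(* For odd continuous [f_c] one takes [A c] to be the set where [0 <= f_c]. *)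
Theorem borsuk_ulam (A : nat -> set V) : (forall c, closed (A c)) ->
  (forall c v, A c v \/ A c (- v)) ->
  exists2 u, u != 0 & forall c, (c < n)%N -> A c u /\ A c (- u).
Proof.
move=> clA oddA.
(* An odd sign such that [sg c v] gives [A c v] and its negation gives [A c (- v)]; where both hold,
   [lexpos] decides. *)
pose sg c v := `[< A c v >] && (`[< ~ A c (- v) >] || lexpos v).
have sgN c v : v != 0 -> sg c (- v) = ~~ sg c v.
  move=> v0; rewrite /sg opprK lexposN // !asbool_neg.
  have : `[< A c v >] || `[< A c (- v) >].
    by apply/orP; case: (oddA c v) => h; [left | right]; apply/asboolP.
  by case: `[< A c v >]; case: `[< A c (- v) >]; case: lexpos.
have sdn_norm M j : (j <= n)%N -> {in sdn M (oct e_ j), forall s,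
    {in s, forall v, n.+1%:R^-1 <= `|v| <= 1}}.
  move=> jn s sM; suff [sigma h] : exists sigma, {in s, forall v, orthant sigma v}.
    by move=> v /h hv; apply: orthant_norm hv.
  move: s sM; apply: (sdn_ind (P := fun s => exists sigma, {in s, forall v, orthant sigma v})).
    by move=> s /(oct_orthant jn)[_ [sigma h _]]; exists sigma.
  by move=> s t [sigma h] ts; exists sigma; apply: sd_closed ts => //; apply: orthant_closed.
have ev1 M : ev (crossing sg n) (sdn M (oct e_ n)) = true.
  apply: ev_crossing_oct => i ij s /(sdn_norm _ _ ij) h v /h /andP[h1 _] k.
  apply: sgN; rewrite -normr_gt0; apply: lt_le_trans h1.
  by rewrite invr_gt0 ltr0n.
(* The vertices have norm at most one, so the initial mesh is at most 2. *)
pose D M : R := (1 - n.+1%:R^-1) ^+ M * 2.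
have exs M : exists s : seq V, [/\ {in s, forall v, n.+1%:R^-1 <= `|v| <= 1},
    s != [::], mesh_le (D M) s & crossing sg n s].
  have /hasP[s sM sc] : has (crossing sg n) (sdn M (oct e_ n)).
    rewrite -[has _ _]negbK -all_predC; apply/negP => /allP h.
    by have := ev1 M; rewrite /ev big_seq big1 // => s /h /negbTE.
  have oct_mesh : {in oct e_ n, forall s, mesh_le 2 s /\ size s = n.+1}.
    move=> t ht; have [st [sigma so _]] := oct_orthant (leqnn n) ht.
    split=> // v w /so hv /so hw.
    have /andP[_ v1] := orthant_norm hv; have /andP[_ w1] := orthant_norm hw.
    by apply: le_trans (ler_normB _ _) _; rewrite -[2]/(1 + 1) lerD.
  exists s; have [ms ss] := mesh_sdn (ltn0Sn n) (ler0n _ _) oct_mesh sM.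
  split=> //; first exact: sdn_norm sM.
  by rewrite -size_eq0 ss.
have [s hs] := choice exs.
pose x M : V := head 0 (s M).
have xs M : x M \in s M.
  by have [_ +_ _] := hs M; rewrite /x; case: (s M) => //= *; rewrite mem_head.
pose S := [set v : V | n.+1%:R^-1 <= `|v| <= 1]%classic.
have Sc : compact S.
  apply: bounded_closed_compact.
    exists 1; split=> // y y1 v /andP[_ h]; exact: le_trans (ltW y1).
  rewrite (_ : S = (fun v : V => `|v|) @^-1` `[n.+1%:R^-1, 1]%classic)%classic; last first.
    by apply/seteqP; split => v /=; rewrite in_itv.
  by apply: closed_comp => [v _|]; [apply: norm_continuous | apply: interval_closed].
have [u [uS uc]] : (S `&` cluster (x @ \oo) !=set0)%classic.
  apply: Sc; exists 0%N => // M _ /=.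
  by have [h _ _ _] := hs M; apply: h.
have D0 : (D M @[M --> \oo] --> (0 : R))%classic.
  rewrite -(mul0r (2 : R)); apply: cvgMr_tmp; apply: cvg_expr.
  rewrite ger0_norm ?subr_ge0 ?invf_le1 ?ler1n ?ltr0n //.
  by rewrite ltrBlDr ltrDl invr_gt0 ltr0n.
(* The meshes tend to zero: at a large index where the first vertex [x M] is near the cluster point
   [u], all vertices of [s M] are. *)
have near_u (P : V -> Prop) : (forall M, exists2 v, v \in s M & P v) -> closure P u.
  move=> hP B /nbhs_ballP[e /= e0 eB].
  have F : ((x @ \oo) [set y | exists v, `|v - y| < e / 2 /\ P v])%classic.
    have e2 : 0 < e / 2 by rewrite divr_gt0.
    move/cvgrPdist_lt: D0 => /(_ _ e2)[M0 _ hM0]; exists M0 => // M /hM0 /=.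
    rewrite sub0r normrN => DM; have [v vs Pv] := hP M; exists v; split=> //.
    have [_ _ ms _] := hs M.
    by apply: le_lt_trans DM; apply: le_trans (ms _ _ vs (xs M)) (ler_norm _).
  have [|y [[v [vy Pv]] yu]] := uc _ (ball u (e / 2)) F.
    by apply: nbhsx_ballx; rewrite divr_gt0.
  exists v; split=> //; apply: eB; rewrite -ball_normE /= in yu *.
  by rewrite distrC (splitr e); apply: le_lt_trans (ler_distD y _ _) _; rewrite ltrD // distrC.
exists u.
  by case/andP: uS => h _; rewrite -normr_gt0; apply: lt_le_trans h; rewrite invr_gt0 ltr0n.
move=> c cn; split.
  apply: (clA c); apply: near_u => M; have [_ _ _ h] := hs M.
  by have [[v vs /andP[/asboolP]]] := crossing_sign h cn; exists v.
have : closed ((fun v : V => - v) @^-1` A c)%classic.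
  by apply: closed_comp (clA c) => v _; apply: opp_continuous.
apply; apply: near_u => M; have [_ _ _ h] := hs M.
have [_ [v vs sv]] := crossing_sign h cn; exists v => //=.
have [Av|//] := oddA c v; move: sv; rewrite /sg negb_and negb_or.
by case/orP=> [/asboolP //|/andP[/asboolPn/contrapT]].
Qed.

End BorsukUlam.

(** * Simultaneous halving of families of linear forms *)

Section Halving.
Variables (R : realType) (n : nat).
Local Notation V := 'rV[R]_n.+1.
Implicit Types (v : V) (h : 'I_n.+1 -> R).

Definition form h v : R := \sum_i v 0 i * h i.

Lemma formN h v : form h (- v) = - form h v.
Proof. by rewrite /form -sumrN; apply: eq_bigr => i _; rewrite mxE mulNr. Qed.

Lemma form_continuous h : continuous (form h).
Proof.
have H (s : seq 'I_n.+1) : continuous (fun v : V => \sum_(i <- s) v 0 i * h i).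
  elim: s => [|i s IH] v.
    by under eq_fun do rewrite big_nil; apply: cst_continuous.
  under eq_fun do rewrite big_cons.
  exact: cvgD (cvgMr_tmp (b := h i) (@coord_continuous _ _ _ 0 i v)) (IH v).
exact: H.
Qed.

Lemma closed_form_ge0 h : closed [set v | 0 <= form h v]%classic.
Proof.
rewrite (_ : [set v | 0 <= form h v]%classic = (form h @^-1` [set x | 0 <= x])%classic) //.
by apply: closed_comp (@closed_ge _ _) => v _; apply: form_continuous.
Qed.

(** The complement is open: the finitely many forms that are strictly negative at a point stay so
    nearby. *)
Lemma closed_few_neg (C : finType) (h : C -> 'I_n.+1 -> R) (L : {set C}) a :
  closed [set v | (#|[set c in L | (form (h c) v < 0)%R]| <= a)%N]%classic.
Proof.
rewrite closedE => v H; apply: contrapT => /negP; rewrite -ltnNge => big.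
apply: H; pose B := [set c in L | form (h c) v < 0].
have : \forall w \near v, forall c, c \in B -> form (h c) w < 0.
  apply: (@filter_forall _ C (fun c w => c \in B -> form (h c) w < 0) _ (nbhs_filter v)).
  move=> c; have [cB|cB] := boolP (c \in B); last first.
    by apply: filterS filterT => w _.
  have c0 : form (h c) v < 0 by move: cB; rewrite inE => /andP[].
  have := form_continuous (h := h c) (x := v) => /cvgrPdist_lt/(_ _ _).
  move/(_ (- form (h c) v)); rewrite oppr_gt0 => /(_ c0).
  apply: filterS => w; rewrite distrC => /(le_lt_trans (ler_norm _)).
  by rewrite ltrBlDr addNr.
apply: filterS => w hw /=; apply/negP; rewrite -ltnNge; apply: leq_trans big _.
apply: subset_leq_card; apply/fintype.subsetP => c cB; rewrite inE hw // andbT.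
by move: cB; rewrite inE => /andP[].
Qed.

Variables (C I : finType) (blk : C -> I) (h : C -> 'I_n.+1 -> R).
Variables (d : nat) (beta : 'I_d -> 'I_n.+1 -> R) (kk : I -> nat).

(* All but [2 * kk b + 3] forms of each block [b] are made to vanish.  The rest of
   the block is halved by Borsuk-Ulam, except for one block [b0]: as it has an odd
   number of remaining forms, the sign of [v] can be chosen to suit it. *)
Theorem few_negatives :
  (forall b, (2 * kk b + 3 <= #|[set c | blk c == b]|)%N) -> (0 < #|I|)%N ->
  (d + (#|C| - \sum_b (2 * kk b + 3)) + #|I|.-1 <= n)%N ->
  exists v, [/\ v != 0, forall l, form (beta l) v = 0 &
    forall b, (#|[set c | (blk c == b) && (form (h c) v < 0)%R]| <= (kk b).+1)%N].
Proof.
move=> hL I0 count.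
have [b0 _] : exists b0 : I, b0 \in [set: I] by apply/card_gt0P; rewrite cardsT.
have exL b : exists L : {set C}, L \subset [set c | blk c == b] /\ #|L| = (2 * kk b + 3)%N.
  exists [set c in take (2 * kk b + 3) (enum [set c | blk c == b])]; split.
    by apply/fintype.subsetP => c; rewrite !inE => /mem_take; rewrite mem_enum inE.
  rewrite cardsE (card_uniqP (take_uniq _ (enum_uniq _))) size_takel // -cardE.
  exact: hL.
have [L hLb] := choice exL.
have blkL b c : c \in L b -> blk c = b.
  by have [/fintype.subsetP s _] := hLb b => /s; rewrite inE => /eqP.
pose U := \bigcup_b L b.
have cU : #|U| = (\sum_b (2 * kk b + 3))%N.
  rewrite -sum1_card (partition_big blk predT) //=; apply: eq_bigr => b _.
  rewrite -(hLb b).2 -sum1_card; apply: eq_bigl => c.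
  apply/andP/idP => [[/bigcupP[b' _ cL] /eqP <-]|cL]; first by rewrite (blkL _ _ cL).
  by split; [apply/bigcupP; exists b | apply/eqP/blkL].
pose neg b v := #|[set c in L b | (form (h c) v < 0)%R]|.
(* The forms negative at [v] and those negative at [- v] are disjoint in [L b]; if both had
   [kk b + 2] elements, they would exceed the [2 * kk b + 3] available. *)
have neg_split b v : (neg b v <= (kk b).+1)%N \/ (neg b (- v) <= (kk b).+1)%N.
  have : (neg b v + neg b (- v) <= #|L b|)%N.
    rewrite /neg -cardsUI [X in (_ + #|pred_of_set X|)%N](_ : _ = finset.set0) ?cards0 ?addn0.
      by apply: subset_leq_card; apply/fintype.subsetP => c; rewrite !inE => /orP[]/andP[].
    apply/setP => c; rewrite !inE formN oppr_lt0; apply/negP => /andP[/andP[_ h1] /andP[_ h2]].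
    by have := lt_trans h1 h2; rewrite ltxx.
  by rewrite (hLb b).2; lia.
(* A closed half-space containing both [v] and [- v] makes its form vanish at [v], so equations can
   be fed to Borsuk-Ulam alongside the halving conditions. *)
pose As : seq (set V) :=
  [seq [set v | 0 <= form (beta l) v]%classic | l <- enum 'I_d] ++
  [seq [set v | 0 <= form (h c) v]%classic | c <- enum (~: U)] ++
  [seq [set v | (neg b v <= (kk b).+1)%N]%classic | b <- enum [set~ b0]].
have sAs : (size As <= n)%N.
  rewrite !size_cat !size_map -!cardE -enumT size_enum_ord cardsC1 addnA.
  apply: leq_trans count; rewrite leq_add2r leq_add2l -cU.
  by rewrite -(cardsC U) addKn.
have hAs X : X \in As -> closed X /\ forall v, X v \/ X (- v).
  rewrite !mem_cat => /or3P[] /mapP[z _ ->]; split=> [|v /=].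
  - exact: closed_form_ge0.
  - by rewrite formN oppr_ge0; apply/orP; apply: le_total.
  - exact: closed_form_ge0.
  - by rewrite formN oppr_ge0; apply/orP; apply: le_total.
  - exact: closed_few_neg.
  - exact: neg_split.
(* Indices beyond the list default to the whole space, which is closed and meets every antipodal
   pair. *)
have [||u u0 hu] := @borsuk_ulam R n (nth setT As).
- move=> i; have [iA|iA] := ltnP i (size As); first by have [] := hAs _ (mem_nth setT iA).
  by rewrite nth_default //; apply: closedT.
- move=> i v; have [iA|iA] := ltnP i (size As); first by have [_] := hAs _ (mem_nth setT iA); apply.
  by rewrite nth_default //; left.
have {}hu X : X \in As -> X u /\ X (- u).
  move=> /(nthP setT)[i iA <-]; apply: hu; exact: leq_trans iA sAs.
have [v [v0 hv hvb]] : exists v, [/\ v != 0, forall X, X \in As -> X v /\ X (- v) &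
    (neg b0 v <= (kk b0).+1)%N].
  have [h0|h0] := neg_split b0 u; first by exists u.
  exists (- u); split; [by rewrite oppr_eq0| |exact: h0] => X XA.
  by rewrite opprK; have [] := hu X XA.
have zero hh : [set w | 0 <= form hh w]%classic \in As -> form hh v = 0.
  move=> hA; have [/=] := hv _ hA; rewrite formN oppr_ge0 => h1 h2.
  by apply/eqP; rewrite eq_le h1 h2.
have zeroU c : c \notin U -> form (h c) v = 0.
  move=> cU'; apply: zero; rewrite !mem_cat; apply/or3P/Or32/mapP.
  by exists c; rewrite // mem_enum inE.
exists v; split=> // [l|b].
  apply: zero; rewrite !mem_cat; apply/or3P/Or31/mapP.
  by exists l; rewrite // mem_enum.
have negb : (neg b v <= (kk b).+1)%N.
  have [-> //|bb0] := eqVneq b b0.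
  have [] // := hv [set v | (neg b v <= (kk b).+1)%N]%classic _.
  rewrite !mem_cat; apply/or3P/Or33/mapP.
  by exists b; rewrite // mem_enum !inE.
apply: leq_trans negb; apply: subset_leq_card; apply/fintype.subsetP => c.
rewrite !inE => /andP[/eqP bc gc]; rewrite gc andbT.
have [/bigcupP[b' _ cL]|cU'] := boolP (c \in U); first by rewrite -bc (blkL _ _ cL).
by rewrite zeroU ?ltxx in gc.
Qed.

End Halving.

End BorsukUlamTheorem.

(** * Transversals *)

Module Combinatorics.
Import all_boot boolp zify.
Set Implicit Arguments. Unset Strict Implicit. Unset Printing Implicit Defensive.
Local Open Scope nat_scope.

Section Transversals.
Variables (C I : finType) (blk : C -> I).
Implicit Types (S T U : {set C}).

Definition meets_all S := [forall i, [exists c in S, blk c == i]].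
Definition transversal S := meets_all S && (#|S| == #|I|).

Lemma meets_allP S : reflect (forall i, exists2 c, c \in S & blk c = i) (meets_all S).
Proof.
apply: (iffP forallP) => H i.
  by have /exists_inP[c cS /eqP e] := H i; exists c.
by have [c cS e] := H i; apply/exists_inP; exists c => //; apply/eqP.
Qed.

Lemma meets_all_sub S T : S \subset T -> meets_all S -> meets_all T.
Proof.
move=> /subsetP ST /meets_allP H; apply/meets_allP => i.
by have [c /ST cT e] := H i; exists c.
Qed.

Lemma meets_all_imset S : meets_all S -> blk @: S = [set: I].
Proof.
move=> /meets_allP H; apply/setP => i; rewrite inE.
by have [c cS <-] := H i; rewrite imset_f.
Qed.

Lemma meets_all_card S : meets_all S -> #|I| <= #|S|.
Proof. by move/meets_all_imset => e; rewrite -cardsT -e leq_imset_card. Qed.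

Lemma transversalP S :
  reflect (meets_all S /\ {in S &, injective blk}) (transversal S).
Proof.
apply: (iffP andP) => -[gS h]; split=> //.
  by apply/imset_injP; rewrite meets_all_imset // cardsT eq_sym.
by rewrite -(card_in_imset h) meets_all_imset // cardsT.
Qed.

Lemma transversal_meets S : transversal S -> meets_all S.
Proof. by case/andP. Qed.

Lemma transversal_eq S T : meets_all S -> transversal T -> S \subset T -> S = T.
Proof.
move=> gS /andP[_ /eqP cT] ST; apply/eqP; rewrite eqEcard ST cT.
exact: meets_all_card.
Qed.

Definition swap T c := c |: [set d in T | blk d != blk c].

Lemma swap_transversal T c : transversal T -> transversal (swap T c).
Proof.
case/transversalP=> /meets_allP gT iT; apply/transversalP; split.
  apply/meets_allP => i; have [e|ne] := eqVneq i (blk c).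
    by exists c; rewrite // !inE eqxx.
  have [d dT e] := gT i; exists d => //.
  by rewrite !inE dT e ne orbT.
move=> x y; rewrite !inE => /predU1P[->|/andP[xT nx]] /predU1P[->|/andP[yT ny]] //.
- by move=> e; rewrite e eqxx in ny.
- by move=> e; rewrite e eqxx in nx.
- exact: iT.
Qed.

Lemma swap_sub S T c : T \subset S -> c \in S -> swap T c \subset S.
Proof.
move=> /subsetP TS cS; apply/subsetP => x; rewrite !inE => /predU1P[->//|/andP[/TS]//].
Qed.

Lemma in_swap T c : c \in swap T c.
Proof. by rewrite !inE eqxx. Qed.

Lemma sub_transversal S : meets_all S -> exists2 T : {set C}, T \subset S & transversal T.
Proof.
move=> /meets_allP gS; have [f fS fb] : exists2 f : I -> C, forall i, f i \in S & cancel f blk.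
  have ex i : exists c, c \in S /\ blk c = i by have [c cS e] := gS i; exists c.
  have [f hf] := choice ex.
  by exists f => i; case: (hf i).
exists [set f i | i : I]; first by apply/subsetP => x /imsetP[i _ ->].
apply/transversalP; split; last by move=> x y /imsetP[i _ ->] /imsetP[j _ ->]; rewrite !fb => ->.
by apply/meets_allP => i; exists (f i); rewrite ?fb // imset_f.
Qed.

(** Two elements of one block, each swapped into a transversal inside [S], would give two different
    transversals. *)
Lemma unique_transversal S : meets_all S ->
  (forall T U : {set C}, T \subset S -> U \subset S -> transversal T -> transversal U -> T = U) ->
  transversal S.
Proof.
move=> gS H; have [T TS tT] := sub_transversal gS.
apply/transversalP; split=> // c d cS dS cd.
have := in_swap T c; rewrite (H (swap T c) (swap T d)) ?swap_sub ?swap_transversal //.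
by rewrite !inE cd eqxx andbF orbF => /eqP.
Qed.

Lemma leq_card_bigcup (K : finType) (Q : pred K) (F : K -> {set C}) :
  #|\bigcup_(e | Q e) F e| <= \sum_(e | Q e) #|F e|.
Proof.
elim/big_rec2: _ => [|e n S _ h]; first by rewrite cards0.
by apply: leq_trans (leq_card_setU _ _) _; rewrite leq_add2l.
Qed.

(** Given two elements of [S] in one block, one of [x], [y], [z] differs from both, and deleting it
    keeps the pair. *)
Lemma transversal_of_deletions S (x y z : C) : x \in S -> y \in S -> z \in S ->
  x != y -> x != z -> y != z ->
  transversal (S :\ x) -> transversal (S :\ y) -> transversal (S :\ z) -> transversal S.
Proof.
move=> xS yS zS xy xz yz tx ty tz.
apply/transversalP; split; first by apply: meets_all_sub (transversal_meets tx); rewrite subsetDl.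
case/transversalP: tx => _ ix; case/transversalP: ty => _ iy; case/transversalP: tz => _ iz.
move=> a b aS bS ab.
case: (boolP ((a != x) && (b != x))) => [/andP[ax bx]|].
  by apply: ix; rewrite ?inE ?ax ?bx.
case: (boolP ((a != y) && (b != y))) => [/andP[ay' by']|].
  by move=> _; apply: iy; rewrite ?inE ?ay' ?by'.
case: (boolP ((a != z) && (b != z))) => [/andP[az bz]|].
  by move=> _ _; apply: iz; rewrite ?inE ?az ?bz.
rewrite !negb_and !negbK.
case: (eqVneq a x) xy xz => [->|_] /= xy xz.
  by rewrite (negbTE xy) (negbTE xz) /= => /eqP -> /eqP e; rewrite e eqxx in yz.
case: (eqVneq a y) yz xy => [->|_] /= yz xy.
  by rewrite (negbTE yz) /= => /eqP -> _ /eqP e; rewrite e eqxx in xz.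
by move=> _ /eqP -> /eqP e; rewrite e eqxx in xy.
Qed.

(* [J] relates a face of the product of simplices to its preimage under a
   projection; disjoint faces have disjoint preimages.  Transversals are the
   vertices, and [low] singles out the faces of dimension at most [k].  Counting
   shows that [J] permutes the vertices, hence the edges, hence, by the number of
   edges at a vertex, the faces of each dimension up to [k]. *)
Variables (k : nat) (J : {set C} -> {set C}).
Definition low S := meets_all S && (#|S| <= k + #|I|).

Hypothesis J_meets : forall S, low S -> meets_all (J S).
Hypothesis J_sub : forall S T, low S -> low T -> (J S \subset J T) = (S \subset T).
Hypothesis J_disjoint : forall S T, low S -> low T ->
  meets_all (J S :&: J T) -> meets_all (S :&: T).

Lemma transversal_low T : transversal T -> low T.
Proof. by case/andP=> gT /eqP cT; rewrite /low gT cT leq_addl. Qed.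

Lemma J_inj : {in low &, injective J}.
Proof.
move=> S T lS lT e; apply/eqP.
by rewrite eqEsubset -(J_sub lS lT) -(J_sub lT lS) e subxx.
Qed.

(** Choose a vertex [sg T] of each [J T]. By disjointness [sg] is injective, hence a permutation of
    the finite set of vertices; so every vertex of [J T] is some [sg T'], and disjointness again
    forces [T' = T]. Thus [J T] has a single vertex. *)
Lemma J_transversal : (forall T, transversal T -> transversal (J T)) /\
  (forall U, transversal U -> exists2 T, transversal T & J T = U).
Proof.
have ex T : exists U, transversal T -> U \subset J T /\ transversal U.
  case: (boolP (transversal T)) => [tT|_]; last by exists set0.
  have [U h1 h2] := sub_transversal (J_meets (transversal_low tT)).
  by exists U.
have [sg hsg] := choice ex.
have same T T' U : transversal T -> transversal T' -> meets_all U ->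
    U \subset J T -> U \subset J T' -> T = T'.
  move=> tT tT' gU UT UT'.
  have g : meets_all (T :&: T').
    apply: J_disjoint; try exact: transversal_low.
    by apply: meets_all_sub gU; rewrite subsetI UT.
  by rewrite -(transversal_eq g tT) ?subsetIl // (transversal_eq g tT') ?subsetIr.
have sg_inj : {in [set T | transversal T] &, injective sg}.
  move=> T T'; rewrite !inE => tT tT' e.
  have [s1 t1] := hsg _ tT; have [s2 t2] := hsg _ tT'.
  apply: (same _ _ (sg T)) => //; first exact: transversal_meets.
  by rewrite e.
have sg_onto : sg @: [set T | transversal T] = [set T | transversal T].
  apply/eqP; rewrite eqEcard card_in_imset // leqnn andbT.
  by apply/subsetP => _ /imsetP[T +->]; rewrite !inE => tT; have [] := hsg _ tT.
have onto U : transversal U -> exists2 T, transversal T & sg T = U.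
  move=> tU; have : U \in sg @: [set T | transversal T] by rewrite sg_onto inE.
  by case/imsetP=> T; rewrite inE => tT ->; exists T.
have JT T : transversal T -> transversal (J T).
  move=> tT; apply: unique_transversal; first exact/J_meets/transversal_low.
  suff H U : U \subset J T -> transversal U -> U = sg T.
    by move=> U U' sU sU' tU tU'; rewrite (H U) // (H U').
  move=> sU tU; have [T' tT' e] := onto _ tU.
  rewrite -e; congr sg; apply/esym/(same _ _ U) => //; first exact: transversal_meets.
  by rewrite -e; have [] := hsg _ tT'.
split=> // U tU; have [T tT e] := onto _ tU; exists T => //.
have [s t] := hsg _ tT; apply/esym; rewrite -e.
by apply: transversal_eq; [apply: transversal_meets | apply: JT |].
Qed.

(** If [J S] were a vertex, all vertices of [S] would have the same image. If it were larger than an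
    edge, it would contain the vertex [T1] and two swaps of it; these come from three vertices of
    [S], obtained by deleting three different elements, and [transversal_of_deletions] would make
    [S] a vertex. *)
Lemma J_edge S : 0 < k -> meets_all S -> #|S| = #|I|.+1 -> #|J S| = #|I|.+1.
Proof.
move=> k0 gS cS; have lS : low S by rewrite /low gS cS; lia.
have [JT onto] := J_transversal.
have nS : ~~ transversal S by rewrite /transversal gS cS /= neq_ltn ltnSn orbT.
apply/eqP; rewrite eqn_leq; apply/andP; split; last first.
  rewrite ltn_neqAle meets_all_card ?J_meets // andbT; apply: contra nS => cJ.
  apply: unique_transversal => // T U sT sU tT tU.
  have tJ : transversal (J S) by rewrite /transversal J_meets // eq_sym cJ.
  apply: J_inj; try exact: transversal_low.
  have sub (X : {set C}) : X \subset S -> transversal X -> J X = J S.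
    move=> sX tX; apply: transversal_eq (transversal_meets (JT _ tX)) tJ _.
    by rewrite J_sub // transversal_low.
  by rewrite !sub.
rewrite leqNgt; apply/negP => big.
have [T1 s1 t1] := sub_transversal (J_meets lS).
have : 1 < #|J S :\: T1|.
  by rewrite cardsD (setIidPr s1); case/andP: t1 => _ /eqP ->; rewrite ltn_subRL addn1.
case/card_gt1P=> c [d []]; rewrite !inE => /andP[cT cJ] /andP[dT dJ] cd.
have H U : U \subset J S -> transversal U ->
    exists x, [/\ x \in S, transversal (S :\ x) & J (S :\ x) = U].
  move=> sU tU; have [T tT e] := onto _ tU.
  have TS : T \subset S by rewrite -(J_sub (transversal_low tT) lS) e.
  have : 0 < #|S :\: T|.
    by rewrite cardsD (setIidPr TS) cS; case/andP: tT => _ /eqP ->; rewrite subSnn.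
  case/card_gt0P=> x; rewrite inE => /andP[xT xS]; exists x.
  suff -> : S :\ x = T by [].
  have := cS; rewrite (cardsD1 x) xS add1n => -[cx].
  apply/eqP; rewrite eq_sym eqEcard subsetD1 TS xT cx.
  by case/andP: tT => _ /eqP ->; rewrite leqnn.
have [x [xS tx ex]] := H _ s1 t1.
have [y [yS ty ey]] := H _ (swap_sub s1 cJ) (swap_transversal c t1).
have [z [zS tz ez]] := H _ (swap_sub s1 dJ) (swap_transversal d t1).
case/negP: nS; apply: (transversal_of_deletions xS yS zS) => //.
- by apply: contraNneq cT => e; rewrite -ex e ey in_swap.
- by apply: contraNneq dT => e; rewrite -ex e ez in_swap.
- apply/negP => /eqP e; have := in_swap T1 c; rewrite -ey e ez !inE (negbTE cd).
  by rewrite (negbTE cT).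
Qed.

(** The dimension of a face is the number of its edges at any of its vertices. Every edge of [J S]
    at [J T] is the image of an edge of [S] at [T]. *)
Lemma J_card S : low S -> #|J S| <= #|S|.
Proof.
move=> lS; have /andP[gS cS] := lS; have [JT onto] := J_transversal.
have [tS|nS] := boolP (transversal S).
  by have /andP[_ /eqP ->] := JT _ tS; case/andP: tS => _ /eqP ->.
have rS : #|I| < #|S|.
  by rewrite ltn_neqAle meets_all_card // andbT eq_sym; move: nS; rewrite /transversal gS.
have k0 : 0 < k by lia.
pose E := [set X | meets_all X && (#|X| == #|I|.+1)].
have lowE X : X \in E -> low X.
  by rewrite inE => /andP[gX /eqP cX]; rewrite /low gX cX; lia.
have JE : J @: E = E.
  apply/eqP; rewrite eqEcard card_in_imset ?leqnn ?andbT; last first.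
    by move=> X Y XE YE; apply: J_inj; apply: lowE.
  apply/subsetP => _ /imsetP[X XE ->]; have lX := lowE _ XE.
  move: XE; rewrite !inE => /andP[gX /eqP cX].
  by rewrite J_meets // (J_edge k0 gX cX) eqxx.
have [T TS tT] := sub_transversal gS; have tJ := JT _ tT.
have lT := transversal_low tT.
have TJ : J T \subset J S by rewrite J_sub.
have cT : #|T| = #|I| by case/andP: tT => _ /eqP.
have cJ : #|J T| = #|I| by case/andP: tJ => _ /eqP.
have cov : J S :\: J T \subset \bigcup_(e in S :\: T) (J (e |: T) :\: J T).
  apply/subsetP => c; rewrite inE => /andP[cT' cS'].
  have : c |: J T \in E.
    rewrite inE cardsU1 cT' cJ eqxx andbT.
    by apply: meets_all_sub (transversal_meets tJ); apply: subsetU1.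
  rewrite -JE => /imsetP[X XE eX]; have lX := lowE _ XE.
  have TX : T \subset X by rewrite -J_sub // -eX subsetU1.
  have XS : X \subset S.
    by rewrite -J_sub // -eX subUset sub1set cS'.
  have cX : #|X :\: T| = 1.
    by rewrite cardsD (setIidPr TX) cT; move: XE; rewrite inE => /andP[_ /eqP ->]; rewrite subSnn.
  have /eqP/cards1P[e eE] := cX.
  have : e \in X :\: T by rewrite eE inE.
  rewrite inE => /andP[eT eX']; apply/bigcupP; exists e.
    by rewrite inE eT (subsetP XS).
  have -> : e |: T = X by rewrite -eE setUC setDE setUIr setUCr setIT (setUidPr TX).
  by rewrite inE cT' -eX !inE eqxx.
have /subset_leq_card := cov.
move/leq_trans/(_ (leq_card_bigcup _ _)) => h.
have : #|J S :\: J T| <= #|S :\: T|.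
  apply: leq_trans h _; rewrite -sum1_card; apply: leq_sum => e; rewrite inE => /andP[eT eS].
  have ge : meets_all (e |: T) by apply: meets_all_sub (transversal_meets tT); apply: subsetU1.
  have ce : #|e |: T| = #|I|.+1 by rewrite cardsU1 eT cT.
  have le : low (e |: T) by rewrite /low ge ce; lia.
  have sT : J T \subset J (e |: T) by rewrite (J_sub lT le) subsetU1.
  by rewrite cardsD (setIidPr sT) (J_edge k0 ge ce) cJ subSnn.
rewrite !cardsD (setIidPr TJ) (setIidPr TS) cJ cT.
by rewrite leq_subLR subnKC // ltnW.
Qed.

(** By [J_card], the injection [J] maps the finite set of low faces into itself. *)
Theorem J_onto S : low S -> exists2 T, low T & J T = S.
Proof.
have : J @: [set X | low X] = [set X | low X].
  apply/eqP; rewrite eqEcard card_in_imset ?leqnn ?andbT; last first.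
    by move=> X Y; rewrite !inE => lX lY; apply: J_inj.
  apply/subsetP => _ /imsetP[X + ->]; rewrite !inE => lX.
  by rewrite /low J_meets // (leq_trans (J_card lX)) //; case/andP: lX.
move=> e lS; have : S \in J @: [set X | low X] by rewrite e inE.
by case/imsetP=> T; rewrite inE => lT ->; exists T.
Qed.

End Transversals.

End Combinatorics.

(** * Farkas' lemma and the moment functionals *)

Module MomentFunctionals.
Import all_boot all_order all_algebra boolp zify ring lra.
Import Order.TTheory GRing.Theory Num.Theory.
Set Implicit Arguments. Unset Strict Implicit. Unset Printing Implicit Defensive.
Import Combinatorics.
Local Open Scope ring_scope.

Lemma entryD (R : nmodType) m n (A B : 'M[R]_(m, n)) i j :
  (A + B) i j = A i j + B i j.
Proof. exact: mxE. Qed.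

Lemma entryZ (R : pzSemiRingType) m n a (A : 'M[R]_(m, n)) i j :
  (a *: A) i j = a * A i j.
Proof. exact: mxE. Qed.

Section Farkas.
Variables (R : realFieldType) (M : nat) (J : finType).
Implicit Types (v : J -> 'rV[R]_M) (u : 'rV[R]_M) (x : 'cV[R]_M).

(** Induction on the number of generators. If [v n] cannot be dropped, some [x1] satisfies the other
    constraints and violates [u]; it is scaled to have value -1 under [v n]. Then
    [x + (v n *m x) *: x1] is the projection of [x] along [x1] to the hyperplane of [v n], and [sh]
    is its transpose, so the induction hypothesis applies to the sheared constraints. *)
Lemma farkas_seq (s : seq J) v u : uniq s ->
  (forall x, (forall j, j \in s -> 0 <= (v j *m x) 0 0) -> 0 <= (u *m x) 0 0) ->
  exists lam : J -> R,
    (forall j, 0 <= lam j) /\ u = \sum_(j <- s) lam j *: v j.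
Proof.
elim: s v u => [|n s IH] v u /= => [_ H|/andP[ns us] H].
  exists (fun=> 0); split=> //; rewrite big_nil; apply/rowP => i; rewrite mxE.
  have := H (delta_mx i 0) (fun _ => ltac:(by [])).
  have := H (- delta_mx i 0) (fun _ => ltac:(by [])).
  rewrite mulmxN -colE !mxE oppr_ge0 => h1 h2.
  by apply/eqP; rewrite eq_le h1 h2.
have [H'|] := pselect (forall x,
    (forall j, j \in s -> 0 <= (v j *m x) 0 0) -> 0 <= (u *m x) 0 0).
  have [lam [l0 ->]] := IH v u us H'.
  exists (fun j => if j == n then 0 else lam j); split=> [j|]; first by case: ifP.
  rewrite big_cons eqxx scale0r add0r; apply: eq_big_seq => j js.
  by case: eqP => // jn; rewrite -jn js in ns.
move=> /existsNP[x0 /not_implyP[hx0 /negP]]; rewrite -ltNge => ux0.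
have vx0 : (v n *m x0) 0 0 < 0.
  rewrite ltNge; apply: contraL ux0 => vn0; rewrite -leNgt; apply: H => j.
  by rewrite inE => /predU1P[->|/hx0].
pose x1 := (- (v n *m x0) 0 0)^-1 *: x0.
have c0 : 0 < (- (v n *m x0) 0 0)^-1 by rewrite invr_gt0 oppr_gt0.
have nx1 : (v n *m x1) 0 0 = -1.
  by rewrite /x1 -scalemxAr mxE invrN mulNr mulVf // lt_eqF.
have ux1 : (u *m x1) 0 0 < 0 by rewrite /x1 -scalemxAr mxE pmulr_rlt0.
have hx1 j : j \in s -> 0 <= (v j *m x1) 0 0.
  by move=> /hx0 h; rewrite /x1 -scalemxAr mxE mulr_ge0 // ltW.
clearbody x1.
pose sh w := w + (w *m x1) 0 0 *: v n.
have shE w x : (sh w *m x) 0 0 = (w *m (x + (v n *m x) 0 0 *: x1)) 0 0.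
  by rewrite /sh mulmxDl mulmxDr -scalemxAl -scalemxAr !entryD !entryZ mulrC.
have [|lam [l0 e]] := IH (fun j => sh (v j)) (sh u) us.
  move=> x hx; rewrite shE; apply: H => j; rewrite inE => /predU1P[->|js].
    by rewrite mulmxDr -scalemxAr entryD entryZ nx1 mulrN1 subrr.
  by rewrite -shE hx.
(* The coefficient of [v n] forced by undoing the shear; it is nonnegative because [x1] satisfies
   the other constraints and violates [u]. *)
pose c := \sum_(j <- s) lam j * (v j *m x1) 0 0 - (u *m x1) 0 0.
exists (fun j => if j == n then c else lam j); split=> [j|].
  case: ifP => // _; rewrite subr_ge0; apply: le_trans (ltW ux1) _.
  by rewrite big_seq; apply: sumr_ge0 => i /hx1 h; rewrite mulr_ge0.
rewrite big_cons eqxx.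
have -> : \sum_(j <- s) (if j == n then c else lam j) *: v j
    = \sum_(j <- s) lam j *: v j.
  by apply: eq_big_seq => j js; case: eqP => // jn; rewrite -jn js in ns.
move: e; rewrite /sh; under eq_bigr do rewrite scalerDr scalerA.
rewrite big_split /= -scaler_suml => /(canRL (addrK _)) ->.
by rewrite /c scalerBl [RHS]addrC addrA.
Qed.

Lemma farkas v u :
  (exists lam : J -> R, (forall j, 0 <= lam j) /\ u = \sum_j lam j *: v j) \/
  (exists x, (forall j, 0 <= (v j *m x) 0 0) /\ (u *m x) 0 0 < 0).
Proof.
have [[x hx]|H] := pselect (exists x, (forall j, 0 <= (v j *m x) 0 0) /\ (u *m x) 0 0 < 0).
  by right; exists x.
left; apply: farkas_seq; first exact: index_enum_uniq.
move=> x hx; rewrite leNgt; apply/negP => ux; apply: H; exists x; split=> // j.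
by apply: hx; rewrite mem_index_enum.
Qed.

End Farkas.

Section Coordinates.
Variables (R : realFieldType) (J D : finType) (v : J -> D -> R).

Lemma farkas_fun (u : D -> R) :
  (exists lam : J -> R, (forall j, 0 <= lam j) /\
    forall d, u d = \sum_j lam j * v j d) \/
  (exists x : D -> R, (forall j, 0 <= \sum_d x d * v j d) /\
    \sum_d x d * u d < 0).
Proof.
pose rw (f : D -> R) : 'rV[R]_#|D| := \row_i f (enum_val i).
have E f x : (rw f *m x) 0 0 = \sum_d x (enum_rank d) 0 * f d.
  rewrite mxE (reindex (@enum_rank D)) /=; last first.
    by exists enum_val => i _; rewrite ?enum_rankK ?enum_valK.
  by apply: eq_bigr => d _; rewrite mxE enum_rankK mulrC.
have [[lam [l0 e]]|[x [x0 xu]]] := farkas (fun j => rw (v j)) (rw u).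
  left; exists lam; split=> // d.
  have /rowP/(_ (enum_rank d)) := e; rewrite mxE summxE enum_rankK => ->.
  by apply: eq_bigr => j _; rewrite !mxE enum_rankK.
right; exists (fun d => x (enum_rank d) 0); split; last by rewrite -E.
by move=> j; rewrite -E.
Qed.

End Coordinates.

Section Stiemke.
Variables (R : realFieldType) (J D : finType) (v : J -> D -> R) (K : {set J}).
Let app x j := \sum_d x d * v j d.

(** If for each [j0] some solution is strict at [j0], the sum of these is strict everywhere outside
    [K]. Otherwise Farkas' lemma for [- v j0] yields the weights, [j0] receiving an extra one. *)
Lemma stiemke :
  (exists x : D -> R, (forall j, j \in K -> app x j = 0) /\
     (forall j, j \notin K -> 0 < app x j)) \/
  (exists lam : J -> R, [/\ forall d, \sum_j lam j * v j d = 0,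
     forall j, j \notin K -> 0 <= lam j & exists2 j, j \notin K & 0 < lam j]).
Proof.
have [H|H] := pselect (forall j0, exists x, (forall j, j \in K -> app x j = 0) /\
    ((forall j, j \notin K -> 0 <= app x j) /\ (j0 \notin K -> 0 < app x j0))).
  left; have [x hx] := choice H.
  exists (fun d => \sum_j x j d).
  have E j : app (fun d => \sum_i x i d) j = \sum_i app (x i) j.
    by rewrite /app exchange_big /=; apply: eq_bigr => d _; rewrite mulr_suml.
  split=> j jK; rewrite E.
    by apply: big1 => i _; have [h _] := hx i; apply: h.
  rewrite (bigD1 j) //=; apply: ltr_wpDr.
    by apply: sumr_ge0 => i _; have [_ [h _]] := hx i; apply: h.
  by have [_ [_ h]] := hx j; apply: h.
right; move/existsNP: H => [j0 H].
have j0K : j0 \notin K.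
  apply/negP => jK; apply: H; exists (fun=> 0); have Z j : app (fun=> 0) j = 0.
    by rewrite /app big1 // => d _; rewrite mul0r.
  by split=> [j _|]; [rewrite Z | split=> [j _|]; rewrite ?Z // jK].
(* Equations on [K] become pairs of opposite inequalities; outside [K] the second copy is zero. *)
pose w (s : J + J) d := match s with inl j => v j d
  | inr j => if j \in K then - v j d else 0 end.
have [[lam [l0 e]]|[x [x0 xu]]] := farkas_fun w (fun d => - v j0 d).
  exists (fun j => lam (inl j) - (if j \in K then lam (inr j) else 0) + (j == j0)%:R).
  split=> [d|j /negbTE jK|].
  - have hd := e d; rewrite big_sumType /= in hd.
    under eq_bigr do rewrite mulrDl mulrBl.
    rewrite big_split sumrB /=.
    have -> : \sum_i (i == j0)%:R * v i d = v j0 d.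
      by rewrite (bigD1 j0) //= eqxx mul1r big1 ?addr0 // => i /negbTE ->; rewrite mul0r.
    have hK : \sum_i lam (inr i) * (if i \in K then - v i d else 0) =
        - \sum_i (if i \in K then lam (inr i) else 0) * v i d.
      rewrite -sumrN; apply: eq_bigr => i _.
      by case: ifP; rewrite ?mulrN ?mulr0 ?mul0r ?oppr0.
    by rewrite -[v j0 d]opprK hd hK subrr.
  - by rewrite jK subr0 addr_ge0 // ler0n.
  - exists j0 => //; rewrite (negbTE j0K) eqxx subr0.
    by apply: ltr_wpDl.
case: H; exists x.
have h1 j : 0 <= app x j by apply: (x0 (inl j)).
split=> [j jK|]; last split=> [j _|_]; last first.
- move: xu; under eq_bigr do rewrite mulrN.
  by rewrite sumrN oppr_lt0.
- exact: h1.
apply/eqP; rewrite eq_le h1 andbT; have := x0 (inr j); rewrite /= jK.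
under eq_bigr do rewrite mulrN.
by rewrite sumrN oppr_ge0.
Qed.

End Stiemke.

(** * Double tail sums and functionals positive off a face *)

Section MomentForm.
Variables (R : realFieldType) (N : nat) (I : finType) (blk : 'I_N -> I).
Hypothesis blk_convex : forall c d e : 'I_N, (c <= d <= e)%N ->
  blk c = blk e -> blk d = blk c.

(* Truncated subtraction makes [tail lam j] the double tail sum of [lam]. *)
Definition tail (lam : 'I_N -> R) (j : nat) : R := \sum_c lam c * (c - j)%:R.

(** As a function of [j], the truncated [c - j] is piecewise linear with a single kink, at [c]. At
    [m = 0] the predecessor would not be a smaller index. *)
Lemma tail_diff2 lam (m : 'I_N) : (0 < m)%N ->
  tail lam m.-1 - 2 * tail lam m + tail lam m.+1 = lam m.
Proof.
move=> m0; rewrite /tail mulr_sumr -sumrB -big_split /= (bigD1 m) //= big1.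
  have -> : (m - m.-1 = 1)%N by lia.
  have -> : (m - m.+1 = 0)%N by lia.
  by rewrite subnn !mulr0 subr0 mulr1 !addr0.
move=> c; rewrite -val_eqE /= neq_ltn => /orP[cm|mc].
  have -> : (c - m.-1 = 0)%N by lia.
  have -> : (c - m = 0)%N by lia.
  have -> : (c - m.+1 = 0)%N by lia.
  by rewrite !mulr0 subr0 addr0.
have -> : (c - m.-1 = (c - m.+1).+2)%N by lia.
have -> : (c - m = (c - m.+1).+1)%N by lia.
by rewrite -!natr1; ring.
Qed.

Section Dual.
Variables (lam : 'I_N -> R) (K : {set 'I_N}).
Hypothesis lam0 : forall i, \sum_(c | blk c == i) lam c = 0.
Hypothesis lam1 : forall i, \sum_(c | blk c == i) lam c * c%:R = 0.
Hypothesis lam_ge0 : forall c, c \notin K -> 0 <= lam c.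

(** Blocks are intervals. Those left of [j] are cut off by truncation; on those to the right
    truncation has no effect, and the sum vanishes by orthogonality to affine functions. *)
Lemma tail_block (j : 'I_N) :
  tail lam j = \sum_(c | blk c == blk j) lam c * (c - j)%:R.
Proof.
rewrite /tail (bigID (fun c => blk c == blk j)) /= [X in _ + X](_ : _ = 0) ?addr0 //.
rewrite (bigID (fun c : 'I_N => (j < c)%N)) /= [X in _ + X]big1 ?addr0; last first.
  by move=> c /andP[_ h]; rewrite (_ : c - j = 0)%N ?mulr0 //; lia.
rewrite (eq_bigr (fun c => lam c * c%:R - lam c * j%:R)); last first.
  by move=> c /andP[_ h]; rewrite natrB ?mulrBr // ltnW.
rewrite (partition_big blk predT) //= big1 // => i _.
have [[c0 /andP[/andP[nc0 jc0] /eqP bi]]|H] :=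
    pselect (exists c : 'I_N, (blk c != blk j) && (j < c)%N && (blk c == i)).
  have E c : (blk c != blk j) && (j < c)%N && (blk c == i) = (blk c == i).
    apply/idP/idP => [/andP[]//|/eqP bc]; rewrite bc -bi nc0 eqxx andbT /=.
    rewrite ltnNge; apply/negP => cj; case/negP: nc0.
    have e : blk c = blk c0 by rewrite bc bi.
    have e2 : blk j = blk c by apply: blk_convex e; rewrite cj ltnW.
    by rewrite e2 e.
  rewrite (eq_bigl _ _ E) sumrB -mulr_suml lam0 lam1; ring.
by rewrite big1 // => c hc; case: H; exists c.
Qed.

(** The truncated differences [c - j] and [j - c] differ by an affine function of [c], to which
    [lam] is orthogonal on the block. *)
Lemma tail_block_left (j : 'I_N) :
  tail lam j = \sum_(c | blk c == blk j) lam c * (j - c)%:R.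
Proof.
rewrite tail_block; apply/eqP; rewrite -subr_eq0 -sumrB.
rewrite (eq_bigr (fun c => lam c * c%:R - lam c * j%:R)).
  by rewrite sumrB -mulr_suml lam0 lam1 mul0r subrr.
move=> c _; case: (leqP c j) => h.
  rewrite (_ : c - j = 0)%N; last lia.
  by rewrite natrB // mulr0 mulrBr; ring.
rewrite (_ : j - c = 0)%N; last lia.
by rewrite natrB ?mulr0 ?mulrBr ?subr0 // ltnW.
Qed.

(** Negative weights occur only in [K]. Together with [tail_lt0_left], an index of negative tail
    lies strictly between two elements of [K] in its own block. *)
Lemma tail_lt0_right (j : 'I_N) : tail lam j < 0 ->
  exists2 c, c \in K & (blk c == blk j) && (j < c)%N.
Proof.
move=> h; apply: contrapT => H; suff : 0 <= tail lam j by rewrite leNgt h.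
rewrite tail_block; apply: sumr_ge0 => c bc.
have [cj|cj] := leqP c j; first by rewrite (_ : c - j = 0)%N ?mulr0 //; lia.
rewrite mulr_ge0 ?ler0n // lam_ge0 //; apply/negP => cK; apply: H.
by exists c; rewrite // bc.
Qed.

Lemma tail_lt0_left (j : 'I_N) : tail lam j < 0 ->
  exists2 c, c \in K & (blk c == blk j) && (c < j)%N.
Proof.
move=> h; apply: contrapT => H; suff : 0 <= tail lam j by rewrite leNgt h.
rewrite tail_block_left; apply: sumr_ge0 => c bc.
have [cj|cj] := leqP j c; first by rewrite (_ : j - c = 0)%N ?mulr0 //; lia.
rewrite mulr_ge0 ?ler0n // lam_ge0 //; apply/negP => cK; apply: H.
by exists c; rewrite // bc.
Qed.

(** Off [K] the second differences of the tail are nonnegative, so it is convex from [p] to [q].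
    Were it nonnegative at [j], it would have risen since [p] and could not become negative again by
    [q]. *)
Lemma tail_convex (p q : nat) j : (p <= j <= q)%N -> (q < N)%N ->
  (forall c : 'I_N, (p < c < q)%N -> c \notin K) ->
  tail lam p < 0 -> tail lam q < 0 -> tail lam j < 0.
Proof.
move=> /andP[pj jq] qN noK tp tq; rewrite ltNge; apply/negP => tj.
have pj' : (p < j)%N.
  by rewrite ltn_neqAle pj andbT; apply: contraL tp => /eqP ->; rewrite -leNgt.
suff H i : (j + i <= q)%N -> tail lam (j + i).-1 <= tail lam (j + i) /\ 0 <= tail lam (j + i).
  have [|_] := H (q - j)%N; first by lia.
  by rewrite subnKC // leNgt tq.
have D m : (p < m < q)%N -> tail lam m - tail lam m.-1 <= tail lam m.+1 - tail lam m.
  move=> /andP[pm mq]; have mN : (m < N)%N by lia.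
  have m0 : (0 < m)%N by lia.
  have := @tail_diff2 lam (Ordinal mN) m0; rewrite /=.
  have := lam_ge0 (noK (Ordinal mN) _); rewrite /= pm mq => /(_ isT).
  by move=> h1 h2; rewrite -subr_ge0; move: h1; rewrite -h2; lra.
elim: i => [|i IH] ij; rewrite ?addn0 ?addnS.
  split=> //; rewrite leNgt; apply/negP => tj1.
  have : forall m, (m <= j)%N -> (p < m)%N -> tail lam m < tail lam m.-1 ->
      0 <= tail lam m -> False.
    elim=> // m IHm mj pm t1 t2; rewrite /= in t1.
    have [e|ne] := eqVneq m p; first by rewrite e in t1 t2; lra.
    apply: (IHm); try lia; last by rewrite /= in t1 *; lra.
    have := D m; rewrite /=; have h : (p < m < q)%N by lia.
    by move/(_ h); lra.
  by move/(_ j (leqnn j) pj' tj1 tj).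
rewrite /=; have [|h1 h2] := IH; first by lia.
have := D (j + i)%N; have h : (p < j + i < q)%N by lia.
by move/(_ h); lra.
Qed.

Lemma interval_poly (S : {set 'I_N}) : S != set0 ->
  (forall p j q : 'I_N, p \in S -> q \in S -> (p <= j <= q)%N -> j \in S) ->
  exists P : {poly R}, (size P <= 3)%N /\
    forall j : 'I_N, if j \in S then P.[j%:R] < 0 else 0 < P.[j%:R].
Proof.
case/set0Pn=> j0 j0S cvx.
case: (arg_minnP (fun i : 'I_N => i : nat) j0S) => p pS pmin.
case: (arg_maxnP (fun i : 'I_N => i : nat) j0S) => q qS qmax.
(* The roots lie half a unit outside the interval, so the quadratic vanishes at no integer. *)
exists (('X - (p%:R - 2^-1)%:P) * ('X - (q%:R + 2^-1)%:P)); split=> [|j].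
  by rewrite size_Mmonic ?monicXsubC ?polyXsubC_eq0 // !size_XsubC.
have half : 0 < 2^-1 :> R by rewrite invr_gt0.
rewrite hornerM !hornerXsubC; case: ifPn => jS.
  have pj : p%:R <= j%:R :> R by rewrite ler_nat; apply: pmin.
  have jq : j%:R <= q%:R :> R by rewrite ler_nat; apply: qmax.
  by rewrite pmulr_rlt0; lra.
have [jp|pj] := ltnP j p.
  have jp' : j%:R + 1 <= p%:R :> R by rewrite natr1 ler_nat.
  have pq : p%:R <= q%:R :> R by rewrite ler_nat; apply: pmin.
  by rewrite nmulr_rgt0; lra.
have [jq|qj] := leqP j q; first by rewrite (cvx p j q) ?pj in jS.
have qj' : q%:R + 1 <= j%:R :> R by rewrite natr1 ler_nat.
have pq : p%:R <= q%:R :> R by rewrite ler_nat; apply: pmin.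
by rewrite pmulr_rgt0; lra.
Qed.

(** For [a] in [K]: the indices of negative tail for which [a] is the last element of [K] not beyond
    them. *)
Definition neg_run (a : 'I_N) : {set 'I_N} :=
  [set j : 'I_N | [&& (a <= j)%N, tail lam j < 0 &
    [forall c in K, ~~ (a < c <= j)%N]]].

Lemma neg_runP (a j : 'I_N) : reflect [/\ (a <= j)%N, tail lam j < 0 &
  forall c, c \in K -> (a < c)%N -> (j < c)%N] (j \in neg_run a).
Proof.
rewrite inE; apply: (iffP and3P) => -[aj tj H]; split=> //.
  move=> c cK ac; have /forall_inP/(_ c cK) := H.
  by rewrite ac /= -ltnNge.
by apply/forall_inP => c cK; apply/negP => /andP[ac]; rewrite leqNgt H.
Qed.

Lemma neg_run_convex a (p j q : 'I_N) : p \in neg_run a -> q \in neg_run a ->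
  (p <= j <= q)%N -> j \in neg_run a.
Proof.
move=> /neg_runP[ap tp Hp] /neg_runP[aq tq Hq] /andP[pj jq].
apply/neg_runP; split; first exact: leq_trans pj.
  apply: (tail_convex (p := p) (q := q)); rewrite ?pj // => c /andP[pc cq].
  apply/negP => cK; have := Hq c cK (leq_ltn_trans ap pc).
  by rewrite ltnNge ltnW.
by move=> c cK ac; apply: leq_ltn_trans jq (Hq _ cK ac).
Qed.

Lemma neg_run_ex (j : 'I_N) : tail lam j < 0 -> exists2 a, a \in K & j \in neg_run a.
Proof.
move=> tj; have [c cK /andP[_ cj]] := tail_lt0_left tj.
have h : (c \in K) && (c <= j)%N by rewrite cK ltnW.
case: (arg_maxnP (P := fun c : 'I_N => (c \in K) && (c <= j)%N) (fun i : 'I_N => i : nat) h).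
move=> a /andP[aK aj] amax; exists a => //; apply/neg_runP; split=> // d dK ad.
rewrite ltnNge; apply/negP => dj; have : (d <= a)%N by apply: amax; rewrite dK dj.
by rewrite leqNgt ad.
Qed.

Lemma neg_run_uniq (j a b : 'I_N) : a \in K -> b \in K ->
  j \in neg_run a -> j \in neg_run b -> a = b.
Proof.
move=> aK bK /neg_runP[aj _ Ha] /neg_runP[bj _ Hb]; apply: val_inj => /=.
case: (ltngtP a b) => // h.
  by have := Ha _ bK h; rewrite ltnNge bj.
by have := Hb _ aK h; rewrite ltnNge aj.
Qed.

Definition run_starts := [set a in K | neg_run a != set0].

(** The last element of [K] in a block starts no run, because an index of negative tail has a later
    element of [K] in its own block. So [K] without the starts still meets all blocks. *)
Lemma run_starts_card : meets_all blk K -> (#|run_starts| + #|I| <= #|K|)%N.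
Proof.
move=> /meets_allP gK; have sub : run_starts \subset K.
  by apply/subsetP => a; rewrite inE => /andP[].
rewrite -(cardsID run_starts K) (setIidPr sub) leq_add2l.
apply: (@meets_all_card _ _ blk); apply/meets_allP => i.
have [c cK bc] := gK i.
have h : (c \in K) && (blk c == i) by rewrite cK bc eqxx.
case: (arg_maxnP (P := fun c : 'I_N => (c \in K) && (blk c == i)) (fun i : 'I_N => i : nat) h).
move=> a /andP[aK /eqP ba] amax; exists a => //; rewrite !inE aK andbT /= negbK.
apply/eqP/setP => j; rewrite [RHS]inE; apply/negbTE/negP => /neg_runP[aj tj Ha].
have [d dK /andP[/eqP bd dj]] := tail_lt0_left tj.
have [e eK /andP[/eqP be je]] := tail_lt0_right tj.
have da : (d <= a)%N.
  by rewrite leqNgt; apply/negP => ad; have := Ha _ dK ad; rewrite ltnNge ltnW.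
have baj : blk a = blk d by apply: blk_convex bd; rewrite da.
have : (e <= a)%N by apply: amax; rewrite eK be -bd -baj ba eqxx.
by rewrite leqNgt (leq_ltn_trans aj je).
Qed.

(** The product of the quadratics of the runs. Runs are disjoint intervals, so exactly one factor is
    negative at an index of negative tail, and none elsewhere. *)
Lemma separating_poly : exists P : {poly R}, (size P <= (2 * #|run_starts|).+1)%N /\
  forall j : 'I_N, P.[j%:R] != 0 /\ 0 <= P.[j%:R] * tail lam j.
Proof.
have ex a : exists P : {poly R}, (size P <= 3)%N /\
    (neg_run a != set0 -> forall j : 'I_N, if j \in neg_run a then P.[j%:R] < 0 else 0 < P.[j%:R]).
  have [/eqP e|ne] := boolP (neg_run a == set0); first by exists 0; rewrite size_poly0.
  have [P [sP hP]] := interval_poly ne (@neg_run_convex a).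
  by exists P.
have [F hF] := choice ex.
exists (\prod_(a in run_starts) F a); split=> [|j].
  apply: leq_trans (size_poly_prod_leq _ _) _.
  have : (\sum_(a in run_starts) size (F a) <= \sum_(a in run_starts) 3)%N.
    by apply: leq_sum => a _; have [] := hF a.
  rewrite sum_nat_const; move: (\sum_(a in _) _)%N #|_| => x y; lia.
have sgn a : a \in run_starts -> j \notin neg_run a -> 0 < (F a).[j%:R].
  by rewrite inE => /andP[_ ne] ja; have [_ /(_ ne j)] := hF a; rewrite (negbTE ja).
rewrite horner_prod; have [tj|tj] := leP 0 (tail lam j).
  have pos : 0 < \prod_(a in run_starts) (F a).[j%:R].
    apply: prodr_gt0 => a aS; apply: sgn => //; apply/negP => /neg_runP[_].
    by rewrite ltNge tj.
  by rewrite gt_eqF // mulr_ge0 // ltW.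
have [a aK ja] := neg_run_ex tj.
have ne : neg_run a != set0 by apply/set0Pn; exists j.
have aS : a \in run_starts by rewrite inE aK.
have neg : \prod_(a in run_starts) (F a).[j%:R] < 0.
  rewrite (bigD1 a) //= pmulr_llt0; first by have [_ /(_ ne j)] := hF a; rewrite ja.
  apply: prodr_gt0 => b /andP[bS ba]; apply: sgn => //; apply: contraNN ba => jb.
  apply/eqP/(neg_run_uniq (j := j)) => //.
  by move: bS; rewrite inE => /andP[].
by rewrite lt_eqF // mulr_le0 // ltW.
Qed.

Variable k : nat.
Hypotheses (gK : meets_all blk K) (cK : (#|K| <= k + #|I|)%N).
Hypothesis lam_mom : forall s, (s < (2 * k).+1)%N ->
  \sum_(c < N) lam c * (\sum_(j < N) (c - j)%:R * j%:R ^+ s) = 0.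

(** Exchanging sums turns [lam_mom] into vanishing power moments of the tail. Paired with the
    separating polynomial, the tail gives nonnegative terms with sum zero, so it vanishes, and [lam]
    is its second difference. *)
Lemma dual_zero c : lam c = 0.
Proof.
have E s : \sum_(c < N) lam c * (\sum_(j < N) (c - j)%:R * j%:R ^+ s) =
    \sum_(j < N) j%:R ^+ s * tail lam j.
  under eq_bigr do rewrite mulr_sumr.
  rewrite exchange_big /=; apply: eq_bigr => j _; rewrite mulr_sumr.
  by apply: eq_bigr => i _; rewrite mulrA mulrC.
have [P [sP hP]] := separating_poly.
have sum0 : \sum_(j < N) P.[j%:R] * tail lam j = 0.
  have sP' : (size P <= (2 * k).+1)%N.
    by apply: leq_trans sP _; have := run_starts_card gK; lia.
  under eq_bigr do rewrite (horner_coef_wide _ sP') mulr_suml.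
  rewrite exchange_big /= big1 // => s _.
  transitivity (P`_s * \sum_(j < N) j%:R ^+ s * tail lam j).
    by rewrite mulr_sumr; apply: eq_bigr => j _; rewrite mulrA.
  by rewrite -E lam_mom ?mulr0.
have t0 (j : nat) : tail lam j = 0.
  have [jN|Nj] := ltnP j N; last first.
    rewrite /tail big1 // => d _; rewrite (_ : d - j = 0)%N ?mulr0 //.
    by apply/eqP; rewrite subn_eq0 ltnW // (leq_trans (ltn_ord d)).
  have [nz _] := hP (Ordinal jN).
  have := psumr_eq0P (fun i _ => (hP i).2) sum0 (i := Ordinal jN) isT.
  by move/eqP; rewrite mulf_eq0 (negbTE nz) => /eqP.
have pos (d : 'I_N) : (0 < d)%N -> lam d = 0.
  by move=> d0; rewrite -(tail_diff2 lam d0) !t0 mulr0 subr0 addr0.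
(* Index 0 has no second difference; its weight follows from the zero sum of its block. *)
have [c0|] := posnP c; last exact: pos.
have := lam0 (blk c); rewrite (bigD1 c) //= big1 ?addr0 // => d /andP[_ dc].
by apply: pos; rewrite lt0n -c0.
Qed.

End Dual.

Definition moment s (c : nat) : R := \sum_(j < N) (c - j)%:R * j%:R ^+ s.

Theorem moment_form (K : {set 'I_N}) k : meets_all blk K -> (#|K| <= k + #|I|)%N ->
  exists (al be : I -> R) (ga : 'I_(2 * k).+1 -> R),
    let phi (c : 'I_N) :=
      al (blk c) + be (blk c) * c%:R + \sum_s ga s * moment s c in
    (forall c, c \in K -> phi c = 0) /\ (forall c, c \notin K -> 0 < phi c).
Proof.
move=> gK cK.
pose v (c : 'I_N) (d : I + I + 'I_(2 * k).+1) : R := match d with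
  | inl (inl i) => (blk c == i)%:R
  | inl (inr i) => (blk c == i)%:R * c%:R
  | inr s => moment s c end.
have [[x hx]|[lam [lam_orth lam_ge0 [j jK lj]]]] := stiemke v K.
  exists (fun i => x (inl (inl i))), (fun i => x (inl (inr i))), (fun s => x (inr s)).
  have E c : x (inl (inl (blk c))) + x (inl (inr (blk c))) * c%:R +
      \sum_s x (inr s) * moment s c = \sum_d x d * v c d.
    rewrite !big_sumType /=; congr (_ + _ + _).
      rewrite (bigD1 (blk c)) //= eqxx mulr1 big1 ?addr0 // => i /negbTE h.
      by rewrite eq_sym h mulr0.
    rewrite (bigD1 (blk c)) //= eqxx mul1r big1 ?addr0 // => i /negbTE h.
    by rewrite eq_sym h mul0r mulr0.
  by case: hx => h1 h2; split=> c cK'; rewrite /= E; [apply: h1 | apply: h2].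
suff : lam j = 0 by move=> e; rewrite e ltxx in lj.
apply: (dual_zero _ _ lam_ge0 gK cK) => [i|i|s sk].
- have := lam_orth (inl (inl i)) => /= h; rewrite -[RHS]h big_mkcond.
  by apply: eq_bigr => c _; case: eqP; rewrite ?mulr1 ?mulr0.
- have := lam_orth (inl (inr i)) => /= h; rewrite -[RHS]h big_mkcond.
  by apply: eq_bigr => c _; case: eqP; rewrite ?mul1r ?mul0r ?mulr0.
- exact: (lam_orth (inr (Ordinal sk))).
Qed.

End MomentForm.

End MomentFunctionals.

Module Polytopes.
Import all_boot all_order all_algebra boolp zify ring lra.
Import Order.TTheory GRing.Theory Num.Theory.
Set Implicit Arguments. Unset Strict Implicit. Unset Printing Implicit Defensive.
Import reals Rstruct BorsukUlamTheorem Combinatorics MomentFunctionals.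
Local Open Scope ring_scope.
Local Notation R := Rdefinitions.R.
Local Notation point := Defs.point.
Local Notation Delta := Defs.Delta.

(** * Convex hulls, faces and affine functionals *)

Lemma lsumE (l : seq R) : lsum l = \sum_(x <- l) x.
Proof. by elim: l => [|a l IH] /=; rewrite ?big_nil ?big_cons ?IH. Qed.

Lemma ForallP (T : Type) (P : T -> Prop) (x0 : T) (s : seq T) :
  List.Forall P s <-> forall j, (j < size s)%N -> P (nth x0 s j).
Proof.
split=> [|H]; first by elim=> {s} [//|x s Px _ IH] [|j] //= /IH.
elim: s H => [|x s IH] H; constructor; first exact: (H 0%N).
by apply: IH => j js; apply: (H j.+1).
Qed.

Definition pt0 : point := fun=> 0.

Definition cmb (J : finType) (lam : J -> R) (p : J -> point) : point :=
  fun i => \sum_j lam j * p j i.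

Definition pts (V : seq point) (j : 'I_(size V)) : point := nth pt0 V j.

Lemma combE (lam : seq R) V i : size lam = size V ->
  comb lam V i = cmb (fun j : 'I_(size V) => lam`_j) (@pts V) i.
Proof.
rewrite /comb /cmb lsumE; elim: lam V => [|a lam IH] [|v V] //=.
  by rewrite big_nil big_ord0.
by move=> [/IH h]; rewrite big_cons h big_ord_recl.
Qed.

Lemma convE V x : conv V x <-> exists lam : 'I_(size V) -> R,
  [/\ forall j, 0 <= lam j, \sum_j lam j = 1 & forall i, x i = cmb lam (@pts V) i].
Proof.
split=> [[lam [sz [/(ForallP _ 0) h0 [h1 h]]]]|[lam [h0 h1 h]]].
  exists (fun j => lam`_j); split=> [j||i].
  - by apply/RleP/h0; rewrite -[length _]/(size lam) in sz *; rewrite sz.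
  - transitivity (lsum lam); last exact: h1.
    by rewrite lsumE (big_nth 0) big_mkord -[length _]/(size lam) in sz *; rewrite sz.
  - by rewrite h combE.
pose l := codom lam; have sl : size l = size V by rewrite size_codom card_ord.
have lE (j : 'I_(size V)) : l`_j = lam j.
  by rewrite (nth_map j) ?size_enum_ord // nth_ord_enum.
exists l; split; first exact: sl.
split; first apply/(ForallP _ 0) => j jl.
  by rewrite sl in jl; rewrite (lE (Ordinal jl)); apply/RleP.
split; first by rewrite lsumE big_map big_enum.
by move=> i; rewrite h combE //; apply: eq_bigr => j _; rewrite lE.
Qed.

Lemma dotE d a x : dot d a x = \sum_(i < d) a i * x i.
Proof.
rewrite -(big_mkord predT (fun i => a i * x i)) /dot -[in RHS](add0n d).
elim: d 0%N => [|d IH] m; first by rewrite addn0 big_geq.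
by rewrite [LHS]/= IH addnS [RHS]big_ltn ?addSn // ltnS leq_addr.
Qed.

(* Affine functionals of R^d: the index [None] carries the constant term. *)
Definition functional d := option 'I_d -> R.
Definition hat d (x : point) (o : option 'I_d) : R := if o is Some i then x i else 1.
Arguments hat : clear implicits.
Definition ap d (xi : functional d) (x : point) : R := \sum_o xi o * hat d x o.
Definition lin d (xi : functional d) (u : point) : R := \sum_(i < d) xi (Some i) * u i.

Lemma big_option (d : finType) (F : option d -> R) : \sum_o F o = F None + \sum_i F (Some i).
Proof.
rewrite (bigD1 None) //=; congr (_ + _).
rewrite (reindex_omap Some id) //=; last by case.
by apply: eq_bigl => i; rewrite eqxx.
Qed.

Lemma apE d (xi : functional d) x : ap xi x = xi None + lin xi x.
Proof. by rewrite /ap big_option /= mulr1. Qed.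

Lemma lin_cmb d (xi : functional d) (J : finType) (lam : J -> R) p :
  lin xi (cmb lam p) = \sum_j lam j * lin xi (p j).
Proof.
rewrite /lin /cmb; under eq_bigr do rewrite mulr_sumr.
rewrite exchange_big /=; apply: eq_bigr => j _; rewrite mulr_sumr.
by apply: eq_bigr => i _; rewrite mulrCA.
Qed.

Lemma ap_cmb d (xi : functional d) (J : finType) (lam : J -> R) p :
  ap xi (cmb lam p) = xi None * (1 - \sum_j lam j) + \sum_j lam j * ap xi (p j).
Proof.
rewrite apE lin_cmb.
have -> : \sum_j lam j * ap xi (p j) = (\sum_j lam j) * xi None + \sum_j lam j * lin xi (p j).
  by rewrite mulr_suml -big_split; apply: eq_bigr => j _; rewrite apE mulrDr.
ring.
Qed.

Lemma ap_affine d (xi : functional d) (J : finType) (lam : J -> R) p :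
  \sum_j lam j = 1 -> ap xi (cmb lam p) = \sum_j lam j * ap xi (p j).
Proof. by move=> h; rewrite ap_cmb h subrr mulr0 add0r. Qed.

Lemma ap_ext d (xi : functional d) x y : (forall i, (i < d)%N -> x i = y i) -> ap xi x = ap xi y.
Proof.
by move=> h; rewrite !apE /lin; congr (_ + _); apply: eq_bigr => i _; rewrite h.
Qed.

Lemma faceE d (P F : pset) : is_face d P F <-> exists xi : functional d,
  (forall x, P x -> 0 <= ap xi x) /\ forall x, F x <-> P x /\ ap xi x = 0.
Proof.
split=> [[a [b [h hF]]]|[xi [h hF]]].
  pose xi : functional d := fun o => if o is Some i then - a i else b.
  have E x : ap xi x = b - dot d a x.
    by rewrite apE dotE /lin -sumrN; congr (_ + _); apply: eq_bigr => i _; rewrite mulNr.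
  exists xi; split=> x => [Px|]; first by rewrite E subr_ge0; apply/RleP/h.
  rewrite hF E; split=> -[Px e]; split=> //; first by rewrite e subrr.
  by apply/eqP; rewrite eq_sym -subr_eq0 e.
pose a : point := fun i => if insub i is Some i' then - xi (Some i') else 0.
have E x : ap xi x = xi None - dot d a x.
  rewrite apE dotE /lin -sumrN; congr (_ + _); apply: eq_bigr => i _.
  by rewrite /a valK mulNr opprK.
exists a, (xi None); split=> x => [Px|].
  by apply/RleP; rewrite -subr_ge0 -E h.
rewrite hF E; split=> -[Px e]; split=> //; last by rewrite e subrr.
by apply/eqP; rewrite eq_sym -subr_eq0 e.
Qed.

Lemma aff_indepE (s : seq point) : aff_indep s <->
  forall lam : 'I_(size s) -> R, \sum_j lam j = 0 ->
    (forall i, cmb lam (@pts s) i = 0) -> forall j, lam j = 0.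
Proof.
split=> [H lam h1 h j|H lam sz h1 h].
  pose l := codom lam; have sl : size l = size s by rewrite size_codom card_ord.
  have lE (i : 'I_(size s)) : l`_i = lam i.
    by rewrite (nth_map i) ?size_enum_ord // nth_ord_enum.
  have h1' : lsum l = 0 by rewrite lsumE big_map big_enum.
  have h' i : comb l s i = 0.
    by rewrite combE // -[RHS](h i); apply: eq_bigr => i' _; rewrite lE.
  have := (ForallP _ 0 l).1 (H l sl h1' h') j; rewrite lE sl; exact.
apply/(ForallP _ 0) => j js; rewrite -[length _]/(size lam) in sz; rewrite sz in js.
apply: (H (fun j => lam`_j) _ _ (Ordinal js)).
  transitivity (lsum lam); last exact: h1.
  by rewrite lsumE (big_nth 0) big_mkord sz.
by move=> i; rewrite -combE.
Qed.

Lemma polytope_pts d V (j : 'I_(size V)) i : polytope d V -> (d <= i)%N -> pts j i = 0.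
Proof.
by move=> /(ForallP _ pt0)/(_ j (ltn_ord j)) H di; apply: H; apply/ssrnat.leP.
Qed.

Lemma conv_in_Rd d V x i : polytope d V -> conv V x -> (d <= i)%N -> x i = 0.
Proof.
move=> pV /convE[lam [_ _ ->]] di; apply: big1 => j _.
by rewrite (polytope_pts _ pV) ?mulr0.
Qed.

Lemma conv_pts V (j : 'I_(size V)) : conv V (pts j).
Proof.
apply/convE; exists (fun i => (i == j)%:R); split=> [i||i]; first exact: ler0n.
  by rewrite (bigD1 j) //= eqxx big1 ?addr0 // => i /negbTE ->.
by rewrite /cmb (bigD1 j) //= eqxx mul1r big1 ?addr0 // => k /negbTE ->; rewrite mul0r.
Qed.

Lemma conv_cmb V (J : finType) (lam : J -> R) p x : (forall j, 0 <= lam j) ->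
  \sum_j lam j = 1 -> (forall j, conv V (p j)) -> (forall i, x i = cmb lam p i) -> conv V x.
Proof.
move=> l0 l1 hp hx; have [mu hmu] := choice (fun j => (convE V (p j)).1 (hp j)).
apply/convE; exists (fun k => \sum_j lam j * mu j k); split=> [k||i].
- by apply: sumr_ge0 => j _; rewrite mulr_ge0 //; have [] := hmu j.
- rewrite exchange_big /= -l1; apply: eq_bigr => j _; rewrite -mulr_sumr.
  by have [_ -> _] := hmu j; rewrite mulr1.
- rewrite hx /cmb; under [RHS]eq_bigr do rewrite mulr_suml.
  rewrite exchange_big /=; apply: eq_bigr => j _; have [_ _ ->] := hmu j.
  by rewrite /cmb mulr_sumr; apply: eq_bigr => k _; rewrite mulrA.
Qed.

Lemma linmapE e m (A : nat -> nat -> R) x i :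
  linmap e m A x i = if (i < e)%N then \sum_(j < m) A i j * x j else 0.
Proof.
rewrite /linmap; have -> : PeanoNat.Nat.ltb i e = (i < e)%N.
  have [h1 h2] := PeanoNat.Nat.ltb_lt i e.
  by apply/idP/ssrnat.ltP; [apply: h1 | apply: h2].
case: ifP => // _; rewrite -(dotE m (A i) x) /dot; congr lsum.
Qed.

Lemma linmap_cmb e m A (J : finType) (lam : J -> R) p i :
  linmap e m A (cmb lam p) i = cmb lam (fun j => linmap e m A (p j)) i.
Proof.
rewrite /cmb; under [RHS]eq_bigr do rewrite linmapE.
rewrite linmapE; case: ifP => _; last by rewrite big1 // => j _; rewrite mulr0.
under eq_bigr do rewrite mulr_sumr.
rewrite exchange_big /=; apply: eq_bigr => j _; rewrite mulr_sumr.
by apply: eq_bigr => k _; rewrite mulrCA.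
Qed.

Definition pullback e m (A : nat -> nat -> R) (xi : functional e) : functional m :=
  fun o => if o is Some j then \sum_(i < e) xi (Some i) * A i j else xi None.

Lemma ap_pullback e m A (xi : functional e) x :
  ap (pullback A xi : functional m) x = ap xi (linmap e m A x).
Proof.
rewrite !apE /lin; congr (_ + _).
under [RHS]eq_bigr => i _ do rewrite linmapE ltn_ord mulr_sumr.
rewrite exchange_big /=; apply: eq_bigr => j _; rewrite mulr_suml.
by apply: eq_bigr => i _; rewrite mulrA.
Qed.

Section Faces.
Variables (d : nat) (P : pset).

Lemma face_empty : is_face d P (fun=> False).
Proof.
apply/faceE; exists (fun o => if o is Some _ then 0 else 1); split=> x.
  by rewrite apE /lin big1 ?addr0 // => i _; rewrite mul0r.
rewrite apE /lin big1 ?addr0 => [|i _]; last by rewrite mul0r.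
by split=> // -[_ /eqP]; rewrite oner_eq0.
Qed.

Lemma face_sub F x : is_face d P F -> F x -> P x.
Proof. by move=> [a [b [_ h]]] /h[]. Qed.

Lemma face_inter F G : is_face d P F -> is_face d P G -> is_face d P (fun x => F x /\ G x).
Proof.
move=> /faceE[xi [x0 hF]] /faceE[ze [z0 hG]]; apply/faceE.
exists (fun o => xi o + ze o); have E x : ap (fun o => xi o + ze o) x = ap xi x + ap ze x.
  by rewrite /ap -big_split /=; apply: eq_bigr => o _; rewrite mulrDl.
split=> x => [Px|]; first by rewrite E addr_ge0 ?x0 ?z0.
rewrite hF hG E; split=> [[[Px ->] [_ ->]]|[Px /eqP]]; first by rewrite addr0.
by rewrite paddr_eq0 ?x0 ?z0 // => /andP[/eqP -> /eqP ->].
Qed.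

End Faces.

Lemma face_preimage e m A (P Q G : pset) :
  (forall x, P x -> Q (linmap e m A x)) -> is_face e Q G ->
  is_face m P (fun x => P x /\ G (linmap e m A x)).
Proof.
move=> PQ /faceE[xi [x0 hG]]; apply/faceE; exists (pullback A xi).
split=> x; rewrite ap_pullback; first by move=> Px; apply/x0/PQ.
split=> [[Px /hG[_ e0]]|[Px e0]]; split=> //.
by apply/hG; split=> //; apply: PQ.
Qed.

Lemma face_cmb d P F (J : finType) (lam : J -> R) p : is_face d P F ->
  (forall j, F (p j)) -> \sum_j lam j = 1 -> P (cmb lam p) -> F (cmb lam p).
Proof.
move=> /faceE[xi [x0 hF]] hp l1 Pc; apply/hF; split=> //.
by rewrite ap_affine // big1 // => j _; have [_ ->] := (hF _).1 (hp j); rewrite mulr0.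
Qed.

(** * The faces of a product of simplices *)

Lemma linear_dependence (F : fieldType) (J E : finType) (a : E -> J -> F) :
  (#|E| < #|J|)%N ->
  exists lam : J -> F, (exists j, lam j != 0) /\ forall e, \sum_j lam j * a e j = 0.
Proof.
move=> EJ; pose A : 'M[F]_(#|J|, #|E|) := \matrix_(i, j) a (enum_val j) (enum_val i).
have : kermx A != 0.
  rewrite -mxrank_eq0 mxrank_ker -lt0n subn_gt0.
  by apply: leq_ltn_trans EJ; apply: rank_leq_col.
case/rowV0Pn=> v /sub_kermxP vA v0.
exists (fun j => v 0 (enum_rank j)); split.
  apply: contrapT => H; case/eqP: v0; apply/rowP => i; rewrite mxE; apply/eqP.
  by apply: contrapT => vi; apply: H; exists (enum_val i); rewrite enum_valK; apply/negP.
move=> e; have /rowP/(_ (enum_rank e)) := vA; rewrite !mxE => {2}<-.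
rewrite (reindex (@enum_rank J)) /=; last first.
  by exists enum_val => i _; rewrite ?enum_rankK ?enum_valK.
by apply: eq_bigr => j _; rewrite mxE !enum_rankK.
Qed.

Lemma pos_lower_bound (J : finType) (P : pred J) (f : J -> R) :
  (forall j, P j -> 0 < f j) -> exists2 t, 0 < t & forall j, P j -> t <= f j.
Proof.
move=> H; exists (\big[Num.min/1]_(j | P j) f j).
  by elim/big_ind: _ => // x y x0 y0; rewrite lt_min x0.
by move=> j Pj; rewrite (bigD1 j) //= ge_min lexx.
Qed.

Lemma lengthE (T : Type) (l : seq T) : length l = size l. Proof. by []. Qed.

Lemma Forall_cons_map (C : eqType) (P : pset) (cs : seq C) p0 (p : C -> point) :
  P p0 -> {in cs, forall c, P (p c)} -> List.Forall P (p0 :: map p cs).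
Proof.
move=> P0 Pc; constructor=> //; elim: cs Pc => [|c cs IH] Pc /=; constructor.
  by apply: Pc; rewrite mem_head.
by apply: IH => d dc; apply: Pc; rewrite inE dc orbT.
Qed.

(** Applied to an affine dependence, [xi c] annihilates every point of the list except [p c] and so
    isolates its coefficient; that of [p0] then follows from the zero sum. *)
Lemma diag_aff_indep d (C : eqType) (cs : seq C) p0 (p : C -> point)
    (xi : C -> functional d) : uniq cs ->
  {in cs, forall c, ap (xi c) p0 = 0} ->
  {in cs &, forall c c', c != c' -> ap (xi c) (p c') = 0} ->
  {in cs, forall c, ap (xi c) (p c) != 0} -> aff_indep (p0 :: map p cs).
Proof.
move=> ucs h0 h1 h2; apply/aff_indepE; set l := p0 :: _ => lam l1 h.
have sl : size l = (size cs).+1 by rewrite /= size_map.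
have ptsS (j : 'I_(size l)) c0 : (0 < j)%N -> pts j = p (nth c0 cs j.-1).
  case: j => -[|j] jl // _; rewrite /pts /= (nth_map c0) //.
  by move: jl; rewrite sl.
have jc (j : 'I_(size l)) : (0 < j)%N -> (j.-1 < size cs)%N.
  by move=> j0; rewrite -ltnS prednK // -sl; apply: ltn_ord.
have nz (j : 'I_(size l)) : (0 < j)%N -> lam j = 0.
  move=> j0; have c0 : C by case: (cs) (jc j j0) => [|c cs'] // _; exact: c.
  set c := nth c0 cs j.-1; have cc : c \in cs by apply/mem_nth/jc.
  have : lin (xi c) (cmb lam (@pts l)) = 0.
    by rewrite /lin big1 // => i _; rewrite h mulr0.
  rewrite lin_cmb => e0.
  have : \sum_j lam j * ap (xi c) (pts j) = 0.
    under eq_bigr do rewrite apE mulrDr.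
    by rewrite big_split /= -mulr_suml l1 e0 mul0r addr0.
  rewrite (bigD1 j) //= big1 ?addr0 => [|j' jj'].
    rewrite (ptsS _ c0) // -/c => /eqP; rewrite mulf_eq0 => /orP[/eqP //|].
    by rewrite (negbTE (h2 _ cc)).
  have [e|j0'] := posnP j'; first by rewrite /pts e /= h0 ?mulr0.
  rewrite (ptsS _ c0) // h1 ?mulr0 ?mem_nth ?jc //.
  rewrite /c nth_uniq ?jc //; apply: contra jj' => /eqP e.
  by apply/eqP/val_inj; rewrite /= -(prednK j0) e prednK.
move=> j; have [j0|] := posnP j; last exact: nz.
move: l1; rewrite (bigD1 j) //= big1 ?addr0 // => j' jj'; apply: nz.
by rewrite lt0n; apply: contra jj' => /eqP e; apply/eqP/val_inj; rewrite /= e j0.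
Qed.

Lemma affdim_le_ambient d (F : pset) : (forall x, F x -> in_Rd d x) -> affdim_le F d.
Proof.
move=> H l; rewrite -[length l]/(size l) -[Nat.add _ _]/(d + 2)%N => sl.
move=> /(ForallP _ pt0) hl /aff_indepE indep.
pose a (e : option 'I_d) (j : 'I_(size l)) : R := hat d (pts j) e.
have [|lam [[j lj] hlam]] := @linear_dependence _ _ _ a.
  by rewrite card_option !card_ord sl addn2.
case/eqP: lj; apply: indep => [|i].
  by rewrite -[RHS](hlam None); apply: eq_bigr => i _; rewrite /= mulr1.
have [id|di] := ltnP i d; first exact: (hlam (Some (Ordinal id))).
rewrite /cmb big1 // => i' _; have -> : pts i' i = 0; last by rewrite mulr0.
by apply: (H _ (hl _ (ltn_ord i'))); apply/ssrnat.leP.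
Qed.

Lemma affdim_le_sub (F G : pset) k : Defs.subset F G -> affdim_le G k -> affdim_le F k.
Proof.
by move=> FG H l sl hl; apply: H sl _; apply: List.Forall_impl hl.
Qed.

Lemma affdim_exists d (F : pset) : (exists x, F x) -> (forall x, F x -> in_Rd d x) ->
  exists2 D, (D <= d)%N & affdim_eq F D.
Proof.
move=> [x Fx] H; have ex : exists D, `[< affdim_le F D >].
  by exists d; apply/asboolP/affdim_le_ambient.
case: (ex_minnP ex) => D /asboolP hD Dmin; exists D.
  by apply: Dmin; apply/asboolP/affdim_le_ambient.
split=> //; case: D hD Dmin => [|D] hD Dmin.
  exists [:: x]; split=> //; split; first by constructor.
  apply/aff_indepE => lam l1 _ j; rewrite -[RHS]l1 big_ord_recl big_ord0 addr0.
  by congr lam; apply/val_inj; case: j => -[|[]].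
have nD : ~ affdim_le F D by move=> /asboolP /Dmin; rewrite ltnn.
apply: contrapT => no; apply: nD => l sl hl ind; apply: no; exists l; split=> //.
by rewrite sl -[Nat.add _ _]/(D + 2)%N addn2.
Qed.

(* The block (simplex factor) to which a coordinate of the ambient space of
   [Delta ns] belongs. *)
Fixpoint blkn (ns : seq nat) (c : nat) : nat :=
  if ns is n :: ns' then if (c < n.+1)%N then 0%N else (blkn ns' (c - n.+1)).+1 else 0%N.

Lemma blkn_lt ns c : (c < prod_dim ns)%N -> (blkn ns c < size ns)%N.
Proof.
elim: ns c => [|n ns IH] c //=; case: ifP => // nc cN; rewrite ltnS IH //.
by rewrite ltn_subLR // leqNgt nc.
Qed.

Lemma blkn_mono ns c d : (c <= d)%N -> (d < prod_dim ns)%N -> (blkn ns c <= blkn ns d)%N.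
Proof.
elim: ns c d => [|n ns IH] c d //= cd dN.
case: ifP => // nc; have nd : (d < n.+1)%N = false by apply/negbTE; rewrite -leqNgt; lia.
by rewrite nd ltnS IH ?leq_sub2r // ltn_subLR // leqNgt nd.
Qed.

Section Product.
Variable ns : seq nat.
Local Notation N := (prod_dim ns).
Local Notation I := 'I_(size ns).

Definition blk (c : 'I_N) : I := Ordinal (blkn_lt (ltn_ord c)).

Lemma blk_convex (c d e : 'I_N) : (c <= d <= e)%N -> blk c = blk e -> blk d = blk c.
Proof.
move=> /andP[cd de] /(congr1 val) /= ce; apply: val_inj => /=; apply/eqP.
by rewrite eqn_leq {1}ce !blkn_mono.
Qed.

End Product.

Definition in_Delta (ns : seq nat) (x : point) : Prop :=
  [/\ forall i, 0 <= x i, forall i, (prod_dim ns <= i)%N -> x i = 0 &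
   forall b, (b < size ns)%N -> \sum_(c < prod_dim ns | blkn ns c == b) x c = 1].

Lemma block_sum_cons n ns (x : point) b :
  \sum_(c < prod_dim (n :: ns) | blkn (n :: ns) c == b) x c =
  if b is b'.+1 then \sum_(c < prod_dim ns | blkn ns c == b') x (n.+1 + c)%N
  else \sum_(c < n.+1) x c.
Proof.
rewrite -[prod_dim (n :: ns)]/(n.+1 + prod_dim ns)%N big_split_ord /=.
have E (c : 'I_n.+1) : ((c < n.+1)%N = true) by rewrite ltn_ord.
have E' (c : 'I_(prod_dim ns)) : ((n.+1 + c < n.+1)%N = false) by rewrite ltnNge leq_addr.
case: b => [|b].
  rewrite [X in _ + X]big1 ?addr0; first by apply: eq_bigl => c; rewrite E.
  by move=> c; rewrite E'.
rewrite big1 ?add0r; last by move=> c; rewrite E.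
by apply: eq_bigl => c; rewrite E' addKn.
Qed.

Lemma in_Delta_cons n ns x : in_Delta (n :: ns) x <->
  [/\ forall i, (i < n.+1)%N -> 0 <= x i, \sum_(c < n.+1) x c = 1 &
    in_Delta ns (fun i => x (n.+1 + i)%N)].
Proof.
split=> [[x0 xz xs]|[x0 x1 [y0 yz ys]]].
  split=> [i _||]; first exact: x0.
    by have := xs 0%N isT; rewrite block_sum_cons.
  split=> [i|i Ni|b bs]; first exact: x0.
    by apply: xz; rewrite -[prod_dim (n :: ns)]/(n.+1 + prod_dim ns)%N leq_add2l.
  by have := xs b.+1 bs; rewrite block_sum_cons.
split=> [i|i|b].
- by have [/x0//|ni] := ltnP i n.+1; rewrite -(subnKC ni).
- rewrite -[prod_dim (n :: ns)]/(n.+1 + prod_dim ns)%N => Ni.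
  have ni : (n.+1 <= i)%N by apply: leq_trans Ni; apply: leq_addr.
  by rewrite -(subnKC ni); apply: yz; rewrite leq_subRL.
- by rewrite block_sum_cons; case: b => [|b] // /ys.
Qed.

Lemma in_Delta_cmb ns (J : finType) (lam : J -> R) p : (forall j, 0 <= lam j) ->
  \sum_j lam j = 1 -> (forall j, in_Delta ns (p j)) -> in_Delta ns (cmb lam p).
Proof.
move=> l0 l1 H; split=> [i|i Ni|b bs].
- by apply: sumr_ge0 => j _; rewrite mulr_ge0 //; have [h _ _] := H j.
- by rewrite /cmb big1 // => j _; have [_ h _] := H j; rewrite h ?mulr0.
- rewrite /cmb exchange_big -l1; apply: eq_bigr => j _; rewrite -mulr_sumr.
  by have [_ _ ->] := H j; rewrite ?mulr1.
Qed.

(* Convertible to the anonymous function in [prod_verts]. *)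
Definition glue n (j : nat) (v : point) : point := fun i =>
  if PeanoNat.Nat.ltb i (S n) then (if PeanoNat.Nat.eqb i j then 1 else 0) else v (i - S n)%N.

Lemma glueE n j v i : glue n j v i =
  if (i < n.+1)%N then (i == j)%:R else v (i - n.+1)%N.
Proof.
rewrite /glue; have -> : PeanoNat.Nat.ltb i n.+1 = (i < n.+1)%N.
  have [h1 h2] := PeanoNat.Nat.ltb_lt i n.+1.
  by apply/idP/ssrnat.ltP; [apply: h1 | apply: h2].
case: ifP => // _; have -> : PeanoNat.Nat.eqb i j = (i == j).
  by apply/idP/eqP => [/PeanoNat.Nat.eqb_eq|->] //; rewrite PeanoNat.Nat.eqb_refl.
by case: eqP.
Qed.

Lemma pts_nth V (j : 'I_(size V)) : pts j = List.nth j V pt0.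
Proof.
by rewrite /pts; move: (val j) => i; elim: V i {j} => [|v V IH] [|i] //=.
Qed.

Lemma pts_In V (j : 'I_(size V)) : List.In (pts j) V.
Proof. by rewrite pts_nth; apply: List.nth_In; apply/ssrnat.ltP. Qed.

Lemma conv_In V v : List.In v V -> conv V v.
Proof.
case/(List.In_nth _ _ pt0) => j [/ssrnat.ltP jV <-].
rewrite -[j]/(val (Ordinal jV)) -pts_nth; exact: conv_pts.
Qed.

Lemma conv_ext V x y : (forall i, x i = y i) -> conv V x -> conv V y.
Proof. by move=> e /convE[lam [l0 l1 h]]; apply/convE; exists lam; split=> // i; rewrite -e. Qed.

Lemma prod_verts_cons n ns : prod_verts (n :: ns) =
  List.flat_map (fun j => List.map (glue n j) (prod_verts ns)) (List.seq 0 (S n)).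
Proof. by []. Qed.

(** The inequality description of the product. For the converse, the first factor is peeled off: [x]
    is the combination of the points [glue n j] of its remaining coordinates, with its own first
    [n.+1] coordinates as weights. *)
Lemma DeltaE ns x : Delta ns x <-> in_Delta ns x.
Proof.
rewrite /Delta; elim: ns x => [|n ns IH] x.
  split=> [/convE[lam [_ _ h]]|[_ h _]].
    have x0 i : x i = 0 by rewrite h /cmb big_ord_recl big_ord0 /= mulr0 addr0.
    by split=> // i; rewrite x0.
  by apply: (@conv_ext _ pt0) => [i|]; [rewrite h | apply: conv_In; left].
rewrite prod_verts_cons; split=> [|/in_Delta_cons[x0 x1 Dx]].
  case/convE=> lam [l0 l1 h].
  suff : in_Delta (n :: ns) (cmb lam (@pts _)).
    by move=> [a b c]; split=> [i|i Ni|d dl]; rewrite ?h ?a ?b //;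
       under eq_bigr do rewrite h; rewrite c.
  apply: in_Delta_cmb => // j.
  have := pts_In j; case/List.in_flat_map=> i [/List.in_seq [_ /ssrnat.ltP iN]] /List.in_map_iff[v [<- vV]].
  have Dv : in_Delta ns v by apply/IH/conv_In.
  apply/in_Delta_cons; split=> [d dn||].
  - by rewrite glueE dn ler0n.
  - rewrite (bigD1 (Ordinal iN)) //= glueE iN eqxx big1 ?addr0 // => d.
    by rewrite -val_eqE /= glueE ltn_ord => /negbTE ->.
  - by case: Dv => a b c; split=> [d|d dN|b' bs];
       rewrite ?glueE ?ltnNge ?leq_addr ?addKn //= ?a ?b //;
       under eq_bigr do rewrite glueE ltnNge leq_addr addKn; rewrite c.
apply: (@conv_cmb _ _ (fun j : 'I_n.+1 => x j) (fun j => glue n j (fun i => x (n.+1 + i)%N))) => //.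
- by move=> j; apply: x0.
- move=> j; have /convE[mu [m0 m1 hm]] := (IH _).2 Dx.
  apply: (@conv_cmb _ _ mu (fun l => glue n j (pts l))) => // [l|i].
    apply: conv_In; apply/List.in_flat_map; exists (val j); split.
      by apply/List.in_seq; split; [apply/ssrnat.leP | apply/ssrnat.ltP; exact: ltn_ord].
    apply/List.in_map_iff; exists (pts l); split=> //.
    exact: pts_In.
  rewrite /cmb glueE; under eq_bigr do rewrite glueE.
  by case: ifP => ni; [rewrite -mulr_suml m1 mul1r | rewrite hm].
- move=> i; rewrite /cmb; have [ni|ni] := ltnP i n.+1.
    rewrite (bigD1 (Ordinal ni)) //= glueE ni eqxx mulr1 big1 ?addr0 // => j.
    by rewrite -val_eqE /= eq_sym glueE ni => /negbTE ->; rewrite mulr0.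
  under eq_bigr do rewrite glueE ltnNge ni /= subnKC //.
  by rewrite -mulr_suml x1 mul1r.
Qed.

(** A cardinality is the block sum of the constant point 1, so [block_sum_cons] computes it over the
    reals. *)
Lemma block_card ns (b : 'I_(size ns)) : #|[set c | blk c == b]| = (nth 0%N ns b).+1.
Proof.
have E m (l : seq nat) : (m < size l)%N ->
    \sum_(c < prod_dim l | blkn l c == m) (1 : R) = (nth 0%N l m).+1%:R.
  elim: l m => [|n l IH] [|m] // ml; rewrite (block_sum_cons n l (fun=> 1)) /=.
    by rewrite sumr_const card_ord.
  by rewrite IH.
have := E b ns (ltn_ord b); rewrite sumr_const => /eqP; rewrite eqr_nat => /eqP <-.
by apply: eq_card => c; rewrite !inE.
Qed.

Section DeltaFaces.
Variable ns : seq nat.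
Local Notation N := (prod_dim ns).
Local Notation I := 'I_(size ns).
Local Notation blk := (@blk ns).
Implicit Types (S T : {set 'I_N}).

Definition dface S : pset := fun x => Delta ns x /\ forall c : 'I_N, c \notin S -> x c = 0.

Lemma Delta_block x (b : I) : Delta ns x -> \sum_(c | blk c == b) x c = 1.
Proof.
move=> /DeltaE[_ _ /(_ _ (ltn_ord b)) <-]; apply: eq_bigl => c.
by rewrite -val_eqE.
Qed.

Lemma Delta_le1 x (c : 'I_N) : Delta ns x -> x c <= 1.
Proof.
move=> Dx; rewrite -(Delta_block (blk c) Dx) (bigD1 c) //= lerDl.
by apply: sumr_ge0 => d _; have /DeltaE[h _ _] := Dx; apply: h.
Qed.

(** Uniform on [S] within each block. If [S] meets all blocks, this is a relative interior point of
    [dface S]. *)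
Definition centroid S : point := fun i =>
  if insub i is Some c then (c \in S)%:R / #|[set d in S | blk d == blk c]|%:R else 0.

Lemma centroidE S (c : 'I_N) : centroid S c = (c \in S)%:R / #|[set d in S | blk d == blk c]|%:R.
Proof. by rewrite /centroid valK. Qed.

Lemma centroid_notin S (c : 'I_N) : c \notin S -> centroid S c = 0.
Proof. by rewrite centroidE => /negbTE ->; rewrite mul0r. Qed.

Lemma centroid_gt0 S (c : 'I_N) : c \in S -> 0 < centroid S c.
Proof.
move=> cS; rewrite centroidE cS divr_gt0 ?ltr0n // card_gt0.
by apply/set0Pn; exists c; rewrite inE cS eqxx.
Qed.

Lemma centroid_dface S : meets_all blk S -> dface S (centroid S).
Proof.
move=> gS; split; last by move=> c; apply: centroid_notin.
apply/DeltaE; split=> [i|i Ni|b bs].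
- by rewrite /centroid; case: insub => [c|]; rewrite ?divr_ge0 ?ler0n.
- by rewrite /centroid insubF // ltnNge Ni.
- pose b' := Ordinal bs; rewrite (eq_bigl (fun c => blk c == b')); last first.
    by move=> c; rewrite -val_eqE.
  rewrite (eq_bigr (fun c => if c \in S then (#|[set d in S | blk d == b']|%:R)^-1 else 0)).
    rewrite -big_mkcondr /= sumr_const -[X in X *+ _ = _]mulr1 -mulrnAr.
    have -> : #|[pred c | blk c == b' & c \in S]| = #|[set d in S | blk d == b']|.
      by apply: eq_card => c; rewrite !inE andbC.
    rewrite mulVf // pnatr_eq0 cards_eq0; have /meets_allP/(_ b')[c cS e] := gS.
    by apply/set0Pn; exists c; rewrite inE cS e eqxx.
  by move=> c /eqP bc; rewrite centroidE bc; case: ifP => _; rewrite ?mul1r ?mul0r.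
Qed.

Lemma dface_meets S x : dface S x -> meets_all blk S.
Proof.
move=> [Dx xS]; apply/meets_allP => b; apply: contrapT => H.
have := Delta_block b Dx; rewrite big1 => [/esym/eqP|c /eqP bc]; first by rewrite oner_eq0.
by apply: xS; apply/negP => cS; apply: H; exists c.
Qed.

Lemma dface_sub S T : meets_all blk S -> Defs.subset (dface S) (dface T) <-> S \subset T.
Proof.
move=> gS; split=> [H|/subsetP ST x [Dx xS]].
  have [_ h] := H _ (centroid_dface gS); apply/subsetP => c cS; apply/negPn/negP => /h e.
  by have := centroid_gt0 cS; rewrite e ltxx.
by split=> // c cT; apply: xS; apply: contra cT; apply: ST.
Qed.

Lemma dface_face S : is_face N (Delta ns) (dface S).
Proof.
pose xi : functional N := fun o => if o is Some c then (c \notin S)%:R else 0.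
have E x : ap xi x = \sum_(c | c \notin S) x c.
  rewrite apE /lin add0r [RHS]big_mkcond; apply: eq_bigr => c _ /=.
  by case: (c \notin S); rewrite ?mul1r ?mul0r.
apply/faceE; exists xi; split=> x; rewrite E.
  by move=> /DeltaE[x0 _ _]; apply: sumr_ge0.
split=> [[Dx h]|[Dx /eqP]]; first by split=> //; rewrite big1.
rewrite psumr_eq0 => [/allP h|c _]; last by have /DeltaE[x0 _ _] := Dx; apply: x0.
by split=> // c cS; have := h c (mem_index_enum c); rewrite cS => /eqP.
Qed.

(** Take for [S] the union of the supports of the points of [F]. Averaging gives [y] in [F] positive
    on all of [S]. For [x] supported in [S], the point [(1 + t) y - t x] beyond [y] is still in the
    product for small [t]; the functional exposing [F] vanishes at [y], so nonnegativity beyond [y]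
    forces it to vanish at [x]. *)
Lemma Delta_faces F : is_face N (Delta ns) F ->
  (forall x, ~ F x) \/ exists2 S, meets_all blk S & forall x, F x <-> dface S x.
Proof.
move=> fF; have [[x0 Fx0]|H] := pselect (exists x, F x); last first.
  by left=> x Fx; apply: H; exists x.
right; pose S := [set c : 'I_N | `[< exists x, F x /\ 0 < x c >]].
have FS x : F x -> dface S x.
  move=> Fx; have Dx := face_sub fF Fx; split=> // c; rewrite inE => /asboolPn h.
  have /DeltaE[/(_ c) x0' _ _] := Dx; apply/eqP; rewrite eq_le x0' andbT leNgt.
  by apply/negP => xc; apply: h; exists x.
have gS := dface_meets (FS _ Fx0); exists S => // x; split; first exact: FS.
have wit (c : 'I_N) : exists y, F y /\ (c \in S -> 0 < y c).
  have [|cS] := boolP (c \in S); last by exists x0.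
  by rewrite inE => /asboolP[y [Fy yc]]; exists y.
have [w hw] := choice wit; move=> [Dx xS].
pose p (o : option 'I_N) := if o is Some c then w c else x0.
have Fp o : F (p o) by case: o => [c|] //=; have [] := hw c.
pose m : R := (#|{: option 'I_N}|%:R)^-1.
have m0 : 0 < m by rewrite invr_gt0 ltr0n card_option.
have m1 : \sum_(o : option 'I_N) m = 1.
  by rewrite sumr_const -mulr_natr mulVf // pnatr_eq0 card_option.
pose y := cmb (fun=> m) p.
have Fy : F y.
  apply: (face_cmb fF) => //; apply: (conv_cmb (lam := fun=> m) (p := p)) => // o; first exact: ltW.
  exact: face_sub fF (Fp o).
have yS (c : 'I_N) : c \in S -> 0 < y c.
  move=> cS; rewrite /y /cmb big_option /=; apply: ltr_wpDl.
    by rewrite mulr_ge0 ?(ltW m0) //; have /DeltaE[h _ _] := face_sub fF Fx0; apply: h.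
  rewrite (bigD1 c) //=; apply: ltr_wpDr; last by rewrite mulr_gt0 //; apply: (hw c).2.
  apply: sumr_ge0 => d _; rewrite mulr_ge0 ?(ltW m0) //.
  by have /DeltaE[h _ _] := face_sub fF (hw d).1; apply: h.
have [t t0 ht] := pos_lower_bound yS.
have [Dy yS0] := FS _ Fy.
pose lam (b : bool) := if b then 1 + t else - t.
pose q (b : bool) := if b then y else x.
have zE i : cmb lam q i = (1 + t) * y i - t * x i by rewrite /cmb big_bool /= mulNr.
have l1 : \sum_b lam b = 1 by rewrite big_bool /= addrK.
have /DeltaE[y0' yz ys] := Dy; have /DeltaE[x0' xz xs] := Dx.
have Dz : Delta ns (cmb lam q).
  apply/DeltaE; split=> [i|i Ni|b bs].
  - rewrite zE; have [iN|Ni] := ltnP i N; last by rewrite yz // xz // !mulr0 subr0.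
    have [iS|iS] := boolP (Ordinal iN \in S); last first.
      by have /= -> := yS0 _ iS; have /= -> := xS _ iS; rewrite !mulr0 subr0.
    have /= h1 := ht _ iS; have /= h2 := Delta_le1 (Ordinal iN) Dx; have h3 := y0' i.
    rewrite subr_ge0 mulrDl mul1r; apply: le_trans (_ : _ <= y i) _.
      by apply: le_trans h1; rewrite ler_piMr // ltW.
    by rewrite lerDl mulr_ge0 // ltW.
  - by rewrite zE yz // xz // !mulr0 subr0.
  - by under eq_bigr do rewrite zE; rewrite sumrB -!mulr_sumr ys // xs //; ring.
have /faceE[xi [xi0 hF]] := fF; apply/hF; split=> //.
apply/eqP; rewrite eq_le xi0 // andbT.
have := xi0 _ Dz; rewrite ap_affine // big_bool /= ((hF y).1 Fy).2 mulr0 add0r mulNr oppr_ge0.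
by rewrite pmulr_rle0.
Qed.

Lemma transversal_extension S k : meets_all blk S -> (k + #|I| < #|S|)%N ->
  exists T (cs : seq 'I_N), [/\ transversal blk T, T \subset S, uniq cs, size cs = k.+1 &
    {in cs, forall c, c \notin T /\ c \in S}].
Proof.
move=> gS big; have [T TS tT] := sub_transversal gS.
have cT : #|T| = #|I| by case/andP: tT => _ /eqP.
exists T, (take k.+1 (enum (S :\: T))); split=> //.
- by rewrite take_uniq // enum_uniq.
- by rewrite size_takel // -cardE cardsD (setIidPr TS) cT ltn_subRL addnC.
- by move=> c /mem_take; rewrite mem_enum inE => /andP[].
Qed.

Lemma dface_dim_gt S k : meets_all blk S -> (k + #|I| < #|S|)%N ->
  ~ affdim_le (dface S) k.
Proof.
move=> gS big H; have [T [cs [tT TS ucs scs hcs]]] := transversal_extension gS big.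
have gT := transversal_meets tT.
have sub U : meets_all blk U -> U \subset S -> dface S (centroid U).
  by move=> gU US; apply: (dface_sub _ gU).2 (centroid_dface gU).
have gc c : meets_all blk (c |: T) by apply: meets_all_sub gT; apply: subsetU1.
apply: (H (centroid T :: [seq centroid (c |: T) | c <- cs])).
- by rewrite lengthE /= size_map scs -[Nat.add _ _]/(k + 2)%N addn2.
- apply: Forall_cons_map; first exact: sub.
  by move=> c /hcs[_ cS]; apply: sub => //; rewrite subUset sub1set cS.
pose xi (c : 'I_N) : functional N := fun o => (o == Some c)%:R.
have xiE c x : ap (xi c) x = x c.
  rewrite /ap (bigD1 (Some c)) //= big1 ?addr0 /xi ?eqxx ?mul1r // => o /negbTE ->.
  by rewrite mul0r.
apply: (diag_aff_indep (xi := xi)) => // [c cc|c c' cc cc' ne|c cc]; rewrite xiE.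
- by apply: centroid_notin; have [] := hcs _ cc.
- by apply: centroid_notin; rewrite !inE negb_or ne; have [] := hcs _ cc.
- by rewrite gt_eqF // centroid_gt0 // !inE eqxx.
Qed.

(** With one element [T] per block set aside, the coordinates in [S :\: T] and the total weight
    suffice to detect an affine dependence: the coordinate in [T] is recovered from the block
    sum. *)
Lemma dface_dim_le S k : meets_all blk S -> (#|S| <= k + #|I|)%N -> (0 < size ns)%N ->
  affdim_le (dface S) k.
Proof.
move=> gS small r0 l; rewrite -[length l]/(size l) -[Nat.add _ _]/(k + 2)%N => sl.
move=> /(ForallP _ pt0) hl /aff_indepE indep.
have {}hl (j : 'I_(size l)) : dface S (pts j) by apply: hl.
have [T TS tT] := sub_transversal gS.
have cT : #|T| = #|I| by case/andP: tT => _ /eqP.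
pose E := option 'I_#|S :\: T|.
pose a (e : E) (j : 'I_(size l)) : R := if e is Some i then pts j (enum_val i) else 1.
have [|lam [[j lj] hlam]] := @linear_dependence _ _ _ a.
  by rewrite card_option !card_ord sl cardsD (setIidPr TS) cT; lia.
case/eqP: lj; apply: indep.
  by rewrite -[RHS](hlam None); apply: eq_bigr => i _; rewrite /= mulr1.
have l0 : \sum_j lam j = 0.
  by rewrite -[RHS](hlam None); apply: eq_bigr => i _; rewrite /= mulr1.
have notS (c : 'I_N) : c \notin S -> cmb lam (@pts l) c = 0.
  by move=> cS; rewrite /cmb big1 // => i _; have [_ ->] := hl i; rewrite ?mulr0.
have inST (c : 'I_N) : c \in S -> c \notin T -> cmb lam (@pts l) c = 0.
  move=> cS cT'; have cD : c \in S :\: T by rewrite inE cT' cS.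
  rewrite -[RHS](hlam (Some (enum_rank_in cD c))); apply: eq_bigr => i _ /=.
  by rewrite enum_rankK_in.
move=> i; have [iN|Ni] := ltnP i N; last first.
  by rewrite /cmb big1 // => i' _; have [/DeltaE[_ h _] _] := hl i'; rewrite h ?mulr0.
pose c := Ordinal iN; rewrite -[i]/(val c).
have [cS|] := boolP (c \in S); last exact: notS.
have [cT'|] := boolP (c \in T); last exact: inST.
transitivity (\sum_(d | blk d == blk c) cmb lam (@pts l) d).
  rewrite (bigD1 c) //= big1 ?addr0 // => d /andP[/eqP bd dc].
  have [dS|] := boolP (d \in S); last exact: notS.
  apply: inST => //; apply: contra dc => dT; apply/eqP.
  by have /transversalP[_ inj] := tT; apply: inj.
rewrite /cmb exchange_big /= -[RHS]l0; apply: eq_bigr => i' _.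
by rewrite -mulr_sumr Delta_block ?mulr1 //; have [] := hl i'.
Qed.

End DeltaFaces.

(** * A projection in dimension 2k + r + 1 *)

Lemma linmap_in_Rd e m A x : in_Rd e (linmap e m A x).
Proof. by move=> i /ssrnat.leP ei; rewrite linmapE ltnNge ei. Qed.

Lemma conv_map e m A W y : conv (List.map (linmap e m A) W) y <->
  exists x, conv W x /\ forall i, y i = linmap e m A x i.
Proof.
have sW : size (List.map (linmap e m A) W) = size W by elim: W => //= w W ->.
have E j i : (j < size W)%N ->
    nth pt0 (List.map (linmap e m A) W) j i = linmap e m A (nth pt0 W j) i.
  by elim: W j {sW} => [|w W IH] [|j] //= /IH.
split=> [|[x [/convE[lam [l0 l1 h]] hy]]].
  case/convE; rewrite /pts sW => lam [l0 l1 h]; exists (cmb lam (@pts W)); split.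
    by apply/convE; exists lam.
  move=> i; rewrite h linmap_cmb; apply: eq_bigr => j _; rewrite E //.
apply/convE; rewrite /pts sW; exists lam; split=> // i.
have -> : y i = linmap e m A (cmb lam (@pts W)) i.
  by rewrite hy !linmapE; case: ifP => // _; apply: eq_bigr => j _; rewrite h.
by rewrite linmap_cmb; apply: eq_bigr => j _; rewrite E.
Qed.

Section Construction.
Variables (ns : seq nat) (k : nat).
Hypothesis ns0 : (0 < size ns)%N.
Local Notation N := (prod_dim ns).
Local Notation r := (size ns).
Local Notation I := 'I_r.
Local Notation D := (2 * k + r + 1)%N.
Local Notation blk := (@blk ns).

Definition curve (i c : nat) : R :=
  if (i < r)%N then (blkn ns c == i)%:R * c%:R else @moment R N (i - r) c.

Definition proj := linmap D N curve.
Definition proj_verts := List.map proj (prod_verts ns).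

Lemma curve_sum (be : 'I_r -> R) (ga : 'I_(2 * k).+1 -> R) :
  exists g : nat -> R, forall c : 'I_N, \sum_(i < D) g i * curve i c =
    be (blk c) * c%:R + \sum_s ga s * @moment R N s c.
Proof.
exists (fun i => if insub i is Some b then be b else
  if insub (i - r)%N is Some s then ga s else 0) => c.
rewrite -(big_mkord predT (fun i => (if insub i is Some b then be b else
  if insub (i - r)%N is Some s then ga s else 0) * curve i c)).
rewrite (_ : D = r + (2 * k).+1)%N; last by rewrite addn1 addnC addnS.
rewrite big_mkord big_split_ord /=; congr (_ + _).
  rewrite (bigD1 (blk c)) //= big1 ?addr0 => [|i ic].
    have -> : insub (blkn ns c) = Some (blk c) :> option 'I_r.
      by rewrite -[blkn ns c]/(val (blk c)) valK.
    by rewrite /curve (blkn_lt (ltn_ord c)) eqxx mul1r.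
  rewrite /curve ltn_ord; move: ic; rewrite -val_eqE /= eq_sym => /negbTE ->.
  by rewrite mul0r mulr0.
apply: eq_bigr => s _; rewrite insubF ?ltnNge ?leq_addr //.
by rewrite addKn valK /curve ltnNge leq_addr /= addKn.
Qed.

Lemma face_functional (K : {set 'I_N}) : meets_all blk K -> (#|K| <= k + r)%N ->
  exists xi : functional D, forall x, Delta ns x ->
    0 <= ap xi (proj x) /\ (ap xi (proj x) = 0 <-> dface K x).
Proof.
move=> gK cK; have [|al [be [ga [hK hnK]]]] := moment_form R (@blk_convex ns) (k := k) gK.
  by rewrite card_ord.
have [g hg] := curve_sum be ga.
(* On the product each block of coordinates sums to one, so the block constants [al] merge into a
   single constant term. *)
pose xi : functional D := fun o => if o is Some i then g i else \sum_b al b.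
pose phi (c : 'I_N) := al (blk c) + be (blk c) * c%:R + \sum_s ga s * @moment R N s c.
exists xi => x Dx; have E : ap xi (proj x) = \sum_(c < N) phi c * x c.
  rewrite apE /lin /=.
  have -> : \sum_(i < D) g i * proj x i = \sum_(c < N) (\sum_(i < D) g i * curve i c) * x c.
    under eq_bigr => i _ do rewrite /proj linmapE ltn_ord mulr_sumr.
    rewrite exchange_big /=; apply: eq_bigr => c _; rewrite mulr_suml.
    by apply: eq_bigr => i _; rewrite mulrA.
  have -> : \sum_b al b = \sum_(c < N) al (blk c) * x c.
    rewrite [RHS](partition_big blk predT) //=; apply: eq_bigr => b _.
    rewrite -[LHS]mulr1 -(Delta_block b Dx) mulr_sumr.
    by apply: eq_bigr => c /eqP ->.
  rewrite -big_split /=; apply: eq_bigr => c _.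
  by rewrite hg -mulrDl addrA.
have /DeltaE[x0 _ _] := Dx.
have phi0 c : 0 <= phi c.
  by have [/hK h|/hnK/ltW //] := boolP (c \in K); rewrite /phi h.
have t0 (c : 'I_N) : 0 <= phi c * x c by rewrite mulr_ge0.
rewrite E; split; first exact: sumr_ge0.
split=> [/eqP|[_ h]].
  rewrite psumr_eq0 // => /allP h; split=> // c cK'.
  have := h c (mem_index_enum c); rewrite /= mulf_eq0 (gt_eqF (hnK _ cK')).
  by move/eqP.
apply: big1 => c _; have [/hK e|/h ->] := boolP (c \in K); last by rewrite mulr0.
by rewrite [phi c]e mul0r.
Qed.

Lemma proj_convE y : conv proj_verts y <-> exists x, Delta ns x /\ forall i, y i = proj x i.
Proof. exact: conv_map. Qed.

Lemma conv_proj x : Delta ns x -> conv proj_verts (proj x).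
Proof. by move=> Dx; apply/proj_convE; exists x. Qed.

Lemma face_pointwise e (P F : pset) x y : is_face e P F ->
  (forall i, x i = y i) -> P y -> F x -> F y.
Proof.
move=> /faceE[xi [_ hF]] xy Py /hF[_ h]; apply/hF; split=> //.
by rewrite -h; apply: ap_ext.
Qed.

(** The dimension bound holds because points of [F] lift to [dface K], and independent images have
    independent lifts. *)
Lemma proj_face (K : {set 'I_N}) : meets_all blk K -> (#|K| <= k + r)%N ->
  exists F, [/\ is_face D (conv proj_verts) F, affdim_le F k &
     forall x, Delta ns x -> (F (proj x) <-> dface K x)].
Proof.
move=> gK cK; have [xi hxi] := face_functional gK cK.
pose F : pset := fun y => conv proj_verts y /\ ap xi y = 0.
have hF x : Delta ns x -> (F (proj x) <-> dface K x).
  move=> Dx; have [_ h] := hxi x Dx; rewrite -h; split=> [[]//|e].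
  by split=> //; apply: conv_proj.
exists F; split=> //.
  apply/faceE; exists xi; split=> // y /proj_convE[x [Dx e]].
  by rewrite (ap_ext xi (y := proj x)) //; have [] := hxi x Dx.
move=> l sl hl /aff_indepE ind.
have ex (j : 'I_(size l)) : exists x, dface K x /\ forall i, pts j i = proj x i.
  have : F (pts j) by apply: ((ForallP _ pt0 _).1 hl).
  case=> /proj_convE[x [Dx e]] h; exists x; split=> //; apply/hF => //.
  by split; [apply: conv_proj | rewrite -h; apply: ap_ext].
have [w hw] := choice ex.
have dK : affdim_le (dface K) k by apply: dface_dim_le => //; rewrite card_ord.
have sw : size (codom w) = size l by rewrite size_codom card_ord.
have wE (j : 'I_(size l)) : pts (cast_ord (esym sw) j) = w j.
  by rewrite /pts /= (nth_map j) ?size_enum_ord // nth_ord_enum.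
apply: (dK (codom w)).
- by rewrite lengthE size_codom card_ord.
- apply/(ForallP _ pt0) => j; rewrite sw => jl.
  by have := wE (Ordinal jl); rewrite /pts /= => ->; apply: (hw _).1.
apply/aff_indepE => lam l1 h.
pose mu (j : 'I_(size l)) := lam (cast_ord (esym sw) j).
have mu0 : forall j, mu j = 0.
  apply: ind => [|i].
    rewrite -[RHS]l1 (reindex (cast_ord (esym sw))) //.
    by exists (cast_ord sw) => j _; rewrite ?cast_ordK ?cast_ordKV.
  transitivity (linmap D N curve (cmb mu w) i).
    by rewrite linmap_cmb; apply: eq_bigr => j _; rewrite (hw j).2.
  have -> : linmap D N curve (cmb mu w) i = linmap D N curve pt0 i.
    rewrite !linmapE; case: ifP => // _; apply: eq_bigr => c _; congr (_ * _).
    rewrite -[RHS](h c) /cmb (reindex (cast_ord (esym sw))) /=; last first.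
      by exists (cast_ord sw) => j _; rewrite ?cast_ordK ?cast_ordKV.
    by apply: eq_bigr => j _; rewrite wE.
  by rewrite linmapE; case: ifP => // _; rewrite big1 // => c _; rewrite mulr0.
by move=> j; rewrite -(cast_ordKV (esym sw) j); apply: mu0.
Qed.

(** If the preimage were too large, it would contain a vertex [T] and [k + 1] edges at it. Their
    images stay affinely independent: for each edge [c], the set [Kc c] of all the others just fits
    the bound [k + r], and its exposing functional isolates [c]. *)
Lemma affdim_le_preimage F : is_face D (conv proj_verts) F -> affdim_le F k ->
  affdim_le (fun x => Delta ns x /\ F (proj x)) k.
Proof.
move=> fF dF; have := face_preimage conv_proj fF => /Delta_faces[H|[S gS hS]].
  move=> l; case: l => [|x l]; first by rewrite -[Nat.add _ _]/(k + 2)%N addn2.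
  by move=> _ hl; case: (H x); inversion hl.
apply: (@affdim_le_sub _ (dface S)); first by move=> x /hS.
have [cS|cS] := leqP #|S| (k + r); first by apply: dface_dim_le => //; rewrite card_ord.
have [|T [cs [tT TS ucs scs hcs]]] := transversal_extension (k := k) gS; first by rewrite card_ord.
have gT := transversal_meets tT; have cT : #|T| = r by case/andP: tT => _ /eqP ->; rewrite card_ord.
have gc c : meets_all blk (c |: T) by apply: meets_all_sub gT; apply: subsetU1.
have inF U : meets_all blk U -> U \subset S -> F (proj (centroid U)).
  move=> gU US; have /hS[] // : dface S (centroid U).
  exact: (dface_sub _ gU).2 (centroid_dface gU).
exfalso; apply: (dF (proj (centroid T) :: [seq proj (centroid (c |: T)) | c <- cs])).
- by rewrite lengthE /= size_map scs -[Nat.add _ _]/(k + 2)%N addn2.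
- apply: Forall_cons_map; first exact: inF.
  by move=> c /hcs[_ cS']; apply: inF => //; rewrite subUset sub1set cS'.
pose Kc (c : 'I_N) := [set d in cs | d != c] :|: T.
have gK c : meets_all blk (Kc c) by apply: meets_all_sub gT; apply: subsetUr.
have cK c : c \in cs -> (#|Kc c| <= k + r)%N.
  move=> cc; apply: leq_trans (leq_card_setU _ _) _; rewrite cT leq_add2r.
  have -> : [set d in cs | d != c] = [set d in cs] :\ c.
    by apply/setP => d; rewrite !inE andbC.
  have := cardsD1 c [set d in cs]; rewrite inE cc cardsE (card_uniqP ucs) scs.
  by rewrite add1n => -[<-].
have ex c : exists xi : functional D, c \in cs -> forall x, Delta ns x ->
    (ap xi (proj x) = 0 <-> dface (Kc c) x).
  have [cc|] := boolP (c \in cs); last by exists (fun=> 0).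
  by have [xi hxi] := face_functional (gK c) (cK c cc); exists xi => _ x /hxi[].
have [xi hxi] := choice ex.
have in_D U : meets_all blk U -> Delta ns (centroid U) by move=> /centroid_dface[].
apply: (diag_aff_indep (xi := xi)) => // [c cc|c c' cc cc' ne|c cc].
- apply/hxi => //; first exact: in_D.
  by apply: (dface_sub _ gT).2 (centroid_dface gT); apply: subsetUr.
- apply/hxi => //; first exact: in_D.
  apply: (dface_sub _ (gc c')).2 (centroid_dface (gc c')).
  by rewrite subUset sub1set !inE cc' eq_sym ne subsetUr.
- apply/eqP => /hxi => /(_ cc (in_D _ (gc c))) [_ /(_ c)].
  have [cT' _] := hcs _ cc; rewrite !inE eqxx andbF (negbTE cT') => /(_ isT) e.
  by have := @centroid_gt0 _ (c |: T) c; rewrite e ltxx !inE eqxx => /(_ isT).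
Qed.

Theorem construction_PPSN : PPSN k ns D proj_verts.
Proof.
have pV : polytope D proj_verts.
  rewrite /polytope /proj_verts; elim: (prod_verts ns) => [|v V IH] /=; constructor => //.
  exact: linmap_in_Rd.
split; last first.
  exists N, (prod_verts ns), curve; split; last split; last exact: proj_convE.
    apply/(ForallP _ pt0) => j jV i /ssrnat.leP Ni.
    have := @conv_pts _ (Ordinal jV) => /DeltaE[_ h _]; exact: h.
  exists (fun F => F); split; [by []|split; [by []|]] => G hG.
  by exists G; split=> //; split.
split=> //.
exists (fun F x => Delta ns x /\ F (proj x)); split; last split.
- move=> F [fF dF]; split; first exact: face_preimage conv_proj fF.
  exact: affdim_le_preimage.
- move=> F G [fF _] [fG _]; split=> [FG x [Dx Fx]|H y Fy]; first by split=> //; apply: FG.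
  have /proj_convE[x [Dx e]] := face_sub fF Fy.
  have Fx : F (proj x) by apply: face_pointwise fF e _ Fy; apply: conv_proj.
  have [_ Gx] := H x (conj Dx Fx).
  by apply: face_pointwise fG _ _ Gx => //; apply: face_sub fF Fy.
- move=> G [fG dG]; have [H|[S gS hS]] := Delta_faces fG.
    exists (fun=> False); split; last by split=> x; [case | move=> Gx; case: (H x)].
    split; first exact: face_empty.
    move=> l; case: l => [|x l]; first by rewrite -[Nat.add _ _]/(k + 2)%N addn2.
    by move=> _ hl; inversion hl.
  have cS : (#|S| <= k + r)%N.
    rewrite leqNgt; apply/negP => cS; apply: (@dface_dim_gt ns S k gS).
      by rewrite card_ord.
    by apply: affdim_le_sub dG => x /hS.
  have [F [fF dF hF]] := proj_face gS cS.
  exists F; split=> //; split=> x; first by move=> [Dx Fx]; apply/hS/hF.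
  by move=> /hS Sx; have [Dx _] := Sx; split=> //; apply/hF.
Qed.

End Construction.

(** * The lower bound *)

Section Transfer.
Variable ns : seq nat.
Local Notation N := (prod_dim ns).
Local Notation blk := (@blk ns).
Variables (pr : {set 'I_N} -> Prop) (A B : pset -> Prop).
Hypotheses (pr_meets : forall S, pr S -> meets_all blk S).
Hypotheses (A_empty : A (fun=> False)) (B_empty : B (fun=> False)).
Hypotheses (B_dface : forall S, pr S -> B (dface S)).
Hypothesis B_inv : forall G, B G ->
  (forall x, ~ G x) \/ exists2 S, pr S & forall x, G x <-> dface S x.

(** The empty face is least in both posets, so empty faces correspond and the nonempty ones inherit
    the indexing. Used for the full face poset, with [pr] being [meets_all], and for the
    [k]-skeleton, with [pr] being [low]. *)
Lemma poset_transfer : poset_iso A B -> exists Fs : {set 'I_N} -> pset,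
  [/\ forall S, pr S -> A (Fs S) /\ exists x, Fs S x,
      forall S T, pr S -> pr T -> (Defs.subset (Fs S) (Fs T) <-> S \subset T) &
      forall G, A G -> (exists x, G x) -> exists2 S, pr S & forall x, G x <-> Fs S x].
Proof.
move=> [f [fB [f_sub f_onto]]].
have ex S : exists F, pr S -> A F /\ forall x, f F x <-> dface S x.
  have [pS|] := pselect (pr S); last by exists (fun=> False).
  have [F [AF [h1 h2]]] := f_onto _ (B_dface pS); exists F => _; split=> // x.
  by split; [apply: h1 | apply: h2].
have [Fs hFs] := choice ex.
have [E [AE [E1 _]]] := f_onto _ B_empty.
have empty G : A G -> (forall x, ~ f G x) -> forall x, ~ G x.
  move=> AG G0 x Gx; apply: (f_sub G (fun=> False) AG A_empty).2 Gx => y fy.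
  by case: (G0 y).
have f_empty x : ~ f (fun=> False) x.
  by move=> fx; apply: (E1 x); apply: (f_sub (fun=> False) E A_empty AE).1 fx.
exists Fs; split=> [S pS|S T pS pT|G AG [x Gx]].
- have [AF hF] := hFs _ pS; split=> //; apply: contrapT => H.
  have cS := centroid_dface (pr_meets pS); apply: (f_empty (centroid S)).
  apply: (f_sub _ _ AF A_empty).1; last exact/hF.
  by move=> x Fx; case: H; exists x.
- have [AS hS] := hFs _ pS; have [AT hT] := hFs _ pT.
  rewrite f_sub // -dface_sub; last exact: pr_meets.
  by split=> H x; move: (H x); rewrite hS hT.
- have [H|[S pS hS]] := B_inv (fB _ AG); first by case: (empty _ AG H x).
  have [AS hF] := hFs _ pS; exists S => // y; split.
    by apply: (f_sub _ _ AG AS).2 y => z /hS/hF.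
  by apply: (f_sub _ _ AS AG).2 y => z /hF/hS.
Qed.

End Transfer.

(* [Fs S] is the face of [conv W] that corresponds to the face [dface S] of the
   product of simplices; its facets are the [Fs [set~ c]]. *)
Section HRepresentation.
Variables (m : nat) (W : seq point) (ns : seq nat) (Fs : {set 'I_(prod_dim ns)} -> pset).
Local Notation N := (prod_dim ns).
Local Notation blk := (@blk ns).
Local Notation P := (conv W).
Hypotheses (pW : polytope m W) (ns_pos : (0 < size ns)%N).
Hypothesis ns_ge1 : forall b : 'I_(size ns), (0 < nth 0%N ns b)%N.
Hypothesis Fs_face : forall S, meets_all blk S -> is_face m P (Fs S) /\ exists x, Fs S x.
Hypothesis Fs_sub : forall S T, meets_all blk S -> meets_all blk T ->
  (Defs.subset (Fs S) (Fs T) <-> S \subset T).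
Hypothesis Fs_inv : forall G, is_face m P G -> (exists x, G x) ->
  exists2 S, meets_all blk S & forall x, G x <-> Fs S x.

Lemma meets_all_co1 (c : 'I_N) : meets_all blk [set~ c].
Proof.
apply/meets_allP => b; apply: contrapT => H.
have := block_card b; have := ns_ge1 b.
have /subset_leq_card : [set d | blk d == b] \subset [set c].
  apply/subsetP => d; rewrite !inE => /eqP bd; apply/negPn/negP => dc.
  by apply: H; exists d; rewrite // !inE.
by rewrite cards1 => h1 h2 h3; rewrite h3 ltnS leqNgt h2 in h1.
Qed.

Lemma facet_exists : exists xi : 'I_N -> functional m,
  forall c, (forall x, P x -> 0 <= ap (xi c) x) /\
    forall x, Fs [set~ c] x <-> P x /\ ap (xi c) x = 0.
Proof.
have ex c := (faceE _ _ _).1 (Fs_face (meets_all_co1 c)).1.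
by have [xi hxi] := choice ex; exists xi.
Qed.

Implicit Types (S T U : {set 'I_N}).
Variable xi : 'I_N -> functional m.
Hypothesis xi_ge0 : forall c x, P x -> 0 <= ap (xi c) x.
Hypothesis xi_facet : forall c x, Fs [set~ c] x <-> P x /\ ap (xi c) x = 0.

Lemma meets_all_setT : meets_all blk [set: 'I_N].
Proof.
apply/meets_allP => b; have : (0 < #|[set c | blk c == b]|)%N by rewrite block_card.
by case/card_gt0P=> c; rewrite inE => /eqP; exists c.
Qed.

Lemma Fs_P S x : meets_all blk S -> Fs S x -> P x.
Proof. by move=> gS; have [h _] := Fs_face gS; apply: face_sub h. Qed.

Lemma Fs_zero S c x : meets_all blk S -> c \notin S -> Fs S x -> ap (xi c) x = 0.
Proof.
move=> gS cS Fx; have /xi_facet[] // : Fs [set~ c] x.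
apply: (Fs_sub gS (meets_all_co1 c)).2 Fx; apply/subsetP => d dS; rewrite !inE.
by apply: contraNneq cS => <-.
Qed.

(** The sum of the [xi c] over [c] outside [S] exposes a face [Fs U] through [x]. It lies in each of
    these facets, so [U] avoids every such [c]. *)
Lemma zero_Fs S x : P x -> (forall c, c \notin S -> ap (xi c) x = 0) ->
  meets_all blk S /\ Fs S x.
Proof.
move=> Px h; pose ze : functional m := fun o => \sum_(c | c \notin S) xi c o.
have zE y : ap ze y = \sum_(c | c \notin S) ap (xi c) y.
  by rewrite /ap exchange_big; apply: eq_bigr => o _; rewrite mulr_suml.
pose G : pset := fun y => P y /\ ap ze y = 0.
have fG : is_face m P G.
  apply/faceE; exists ze; split=> // y Py; rewrite zE.
  by apply: sumr_ge0 => c _; apply: xi_ge0.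
have Gx : G x by split=> //; rewrite zE big1.
have [U gU hU] := Fs_inv fG (ex_intro _ x Gx).
have US : U \subset S.
  apply/subsetP => c cU; apply/negPn/negP => cS.
  have : U \subset [set~ c].
    apply/(Fs_sub gU (meets_all_co1 c)) => y /hU[Py /eqP].
    rewrite zE psumr_eq0 => [/allP z|d _]; last exact: xi_ge0.
    apply/xi_facet; split=> //; have := z c (mem_index_enum c).
    by rewrite cS => /eqP.
  by move/subsetP/(_ c cU); rewrite !inE eqxx.
have gS := meets_all_sub US gU; split=> //.
by apply: (Fs_sub gU gS).2 US _ _; apply/hU.
Qed.

(** For each [c] in [S] some point of [Fs S] is off the facet of [c]; the average of these witnesses
    is off all of them. *)
Lemma relint S : meets_all blk S -> exists x, Fs S x /\
  forall c, c \in S -> 0 < ap (xi c) x.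
Proof.
move=> gS; have [fS [x0 Fx0]] := Fs_face gS.
have wit (c : 'I_N) : exists y, Fs S y /\ (c \in S -> 0 < ap (xi c) y).
  have [cS|] := boolP (c \in S); last by exists x0.
  apply: contrapT => H; suff : S \subset [set~ c].
    by move/subsetP/(_ c cS); rewrite !inE eqxx.
  apply/(Fs_sub gS (meets_all_co1 c)) => y Fy; have Py := Fs_P gS Fy.
  apply/xi_facet; split=> //; apply/eqP; rewrite eq_le xi_ge0 // andbT leNgt.
  by apply/negP => y0; apply: H; exists y.
have [w hw] := choice wit.
pose p (o : option 'I_N) := if o is Some c then w c else x0.
have Fp o : Fs S (p o) by case: o => [c|] //=; have [] := hw c.
pose a : R := (#|{: option 'I_N}|%:R)^-1.
have a0 : 0 < a by rewrite invr_gt0 ltr0n card_option.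
have a1 : \sum_(o : option 'I_N) a = 1.
  by rewrite sumr_const -mulr_natr mulVf // pnatr_eq0 card_option.
exists (cmb (fun=> a) p); split.
  apply: (face_cmb fS) => //; apply: (conv_cmb (lam := fun=> a) (p := p)) => // o; first exact: ltW.
  exact: Fs_P gS (Fp o).
move=> c cS; rewrite ap_affine // (bigD1 (Some c)) //=; apply: ltr_wpDr.
  by apply: sumr_ge0 => o _; apply: mulr_ge0; [apply: ltW | apply/xi_ge0/(Fs_P gS)].
by rewrite mulr_gt0 //; apply: (hw c).2.
Qed.

(** The constant entry of [hat] forces the nonnegative weights of Farkas' lemma to sum to one. *)
Lemma Farkas_conv (y : point) : (forall i, (m <= i)%N -> y i = 0) ->
  (forall a : functional m, (forall j, 0 <= ap a (@pts W j)) -> 0 <= ap a y) -> P y.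
Proof.
move=> ym H; have [[lam [l0 e]]|[a [a0 ay]]] := farkas_fun (fun j => hat m (@pts W j)) (hat m y).
  apply/convE; exists lam; split=> // [|i].
    transitivity (\sum_j lam j * hat m (@pts W j) None); last exact/esym/(e None).
    by apply: eq_bigr => j _; rewrite mulr1.
  have [im|mi] := ltnP i m; first exact: (e (Some (Ordinal im))).
  by rewrite ym // /cmb big1 // => j _; rewrite (polytope_pts _ pW) ?mulr0.
by have := H a a0; rewrite leNgt ay.
Qed.

Lemma ap_conv0 (a : functional m) : (forall j, ap a (@pts W j) = 0) ->
  forall x, P x -> ap a x = 0.
Proof.
move=> h x /convE[lam [_ l1 hx]].
rewrite (ap_ext a (y := cmb lam (@pts W))) // ap_affine // big1 // => j _.
by rewrite h mulr0.
Qed.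

Lemma ap_conv_ge0 (a : functional m) : (forall j, 0 <= ap a (@pts W j)) ->
  forall x, P x -> 0 <= ap a x.
Proof.
move=> h x /convE[lam [l0 l1 hx]].
rewrite (ap_ext a (y := cmb lam (@pts W))) // ap_affine //.
by apply: sumr_ge0 => j _; rewrite mulr_ge0.
Qed.

(* A functional that is nonnegative on [P] is decreased along a facet containing
   its zero face until it vanishes at one more vertex. *)
Lemma hrep (K : finType) (lam : K -> R) (p : K -> point) :
  (forall i, P (p i)) -> \sum_i lam i = 1 ->
  (forall c, 0 <= ap (xi c) (cmb lam p)) -> P (cmb lam p).
Proof.
move=> Pp l1 hc; apply: Farkas_conv => [i mi|a].
  by rewrite /cmb big1 // => j _; rewrite (conv_in_Rd pW (Pp j) mi) mulr0.
have [n] := ubnP #|[set j | ap a (@pts W j) != 0]|.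
elim: n a => // n IH a; rewrite ltnS => an a0.
have [x0 [Fx0 x0pos]] := relint meets_all_setT.
have Px := ap_conv_ge0 a0.
(* If [a] vanishes at a point of [W], its zero face is all of [P] or lies in a facet; if at none,
   any facet qualifies. *)
have [H|[c hac]] : (forall x, P x -> ap a x = 0) \/
    exists c, forall j, ap a (@pts W j) = 0 -> ap (xi c) (@pts W j) = 0.
- have [[j aj]|no] := pselect (exists j, ap a (@pts W j) = 0); last first.
    have : (0 < #|[set: 'I_N]|)%N.
      apply: leq_trans (meets_all_card meets_all_setT).
      by rewrite card_ord.
    by case/card_gt0P=> c _; right; exists c => j aj; case: no; exists j.
  pose G : pset := fun x => P x /\ ap a x = 0.
  have fG : is_face m P G by apply/faceE; exists a; split.
  have [S gS hS] := Fs_inv fG (ex_intro _ _ (conj (conv_pts j) aj)).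
  have [eS|] := eqVneq S setT.
    left=> x Px'; have [_] : G x; last by [].
    by apply/hS; rewrite eS; have [] := @zero_Fs setT x Px' (fun c => ltac:(by rewrite inE)).
  rewrite -subTset => /subsetPn[c _ cS]; right; exists c => i ai.
  by apply: (Fs_zero gS cS); apply/hS; split=> //; apply: conv_pts.
- by rewrite ap_affine // big1 // => i _; rewrite H ?mulr0.
have [j0 hj0] : exists j, 0 < ap (xi c) (@pts W j).
  apply: contrapT => no; suff e : ap (xi c) x0 = 0.
    by have := x0pos c; rewrite inE e ltxx => /(_ isT).
  have PT : P x0.

    exact: Fs_P meets_all_setT Fx0.
  apply: ap_conv0 PT => j; apply/eqP; rewrite eq_le xi_ge0 ?andbT; last exact: conv_pts.
  by rewrite leNgt; apply/negP => h; apply: no; exists j.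
(* The minimal ratio is the largest multiple of [xi c] that can be subtracted from [a] while it
   stays nonnegative on [P]. *)
pose ratio j := ap a (@pts W j) / ap (xi c) (@pts W j).
have [j1 hj1 jmin] := arg_minP (P := fun j => 0 < ap (xi c) (@pts W j)) ratio hj0.
pose a' : functional m := fun o => a o - ratio j1 * xi c o.
have a'E x : ap a' x = ap a x - ratio j1 * ap (xi c) x.
  rewrite /ap mulr_sumr -sumrB; apply: eq_bigr => o _.
  by rewrite mulrBl mulrA.
have xi0 j : 0 <= ap (xi c) (@pts W j) by apply/xi_ge0/conv_pts.
have a'0 j : 0 <= ap a' (@pts W j).
  rewrite a'E subr_ge0; have := xi0 j; rewrite le_eqVlt => /predU1P[<-|hj].
    by rewrite mulr0.
  by rewrite -ler_pdivlMr //; apply: jmin.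
have lt : (#|[set j | ap a' (@pts W j) != (0 : R)%R]| < n)%N.
  apply: leq_trans an; apply: proper_card; apply/properP; split.
    apply/subsetP => j; rewrite !inE; apply: contraNneq => aj.
    by rewrite a'E aj hac // mulr0 subrr.
  exists j1; rewrite inE; first by apply/eqP => /hac e; rewrite e ltxx in hj1.
  by rewrite negbK a'E /ratio divfK ?subrr // gt_eqF.
have := IH _ lt a'0; rewrite a'E subr_ge0; apply: le_trans.
by rewrite mulr_ge0 // divr_ge0.
Qed.

Variables (e k : nat) (A : nat -> nat -> R).
Hypothesis preserved : forall S, meets_all blk S -> (#|S| <= k + size ns)%N ->
  exists G : pset, forall x, Fs S x <-> P x /\ G (linmap e m A x).

(* Walking from a relative interior point of the face [Fs S] in a direction of
   the kernel of the projection, one reaches a point of [Fs S] that lies on a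
   further facet but has the same image as the starting point. *)
Lemma no_short_direction n (v : 'I_n -> R) (q : 'I_n -> point) S :
  (forall i, P (q i)) -> \sum_i v i = 0 ->
  (forall d, cmb v (fun i => linmap e m A (q i)) d = 0) ->
  meets_all blk S -> (#|S| <= k + size ns)%N ->
  (forall c, \sum_i v i * ap (xi c) (q i) < 0 -> c \in S) ->
  (exists c, \sum_i v i * ap (xi c) (q i) != 0) -> False.
Proof.
set g := fun c => \sum_i v i * ap (xi c) (q i).
move=> Pq v1 vA gS cS negS [c0 gc0].
have [x [Fx xpos]] := relint gS; have Px := Fs_P gS Fx.
pose lam t (o : option 'I_n) := if o is Some i then t * v i else 1.
pose p (o : option 'I_n) := if o is Some i then q i else x.
have Pp o : P (p o) by case: o.
have l1 t : \sum_o lam t o = 1 by rewrite big_option /= -mulr_sumr v1 mulr0 addr0.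
have apE' t c : ap (xi c) (cmb (lam t) p) = ap (xi c) x + t * g c.
  rewrite ap_affine // big_option /= mul1r mulr_sumr; congr (_ + _).
  by apply: eq_bigr => i _; rewrite mulrA.
have AE t : linmap e m A (cmb (lam t) p) = linmap e m A x.
  apply: funext => d; rewrite linmap_cmb /cmb big_option /= mul1r.
  under eq_bigr do rewrite -mulrA.
  by rewrite -mulr_sumr [\sum_i _]vA mulr0 addr0.
have inP t : (forall c, 0 <= ap (xi c) x + t * g c) -> P (cmb (lam t) p).
  by move=> h; apply: hrep => // c; rewrite apE'.
(* Otherwise no facet functional decreases, and the whole ray stays in [P] although [xi c0] is
   unbounded on it. *)
have [c1 gc1] : exists c, g c < 0.
  apply: contrapT => no; have g0 c : 0 <= g c.
    by rewrite leNgt; apply/negP => h; apply: no; exists c.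
  pose B := \sum_j ap (xi c0) (@pts W j).
  have gpos : 0 < g c0 by rewrite lt_neqAle eq_sym gc0 g0.
  have B0 : 0 <= B by apply: sumr_ge0 => j _; apply/xi_ge0/conv_pts.
  have bound z : P z -> ap (xi c0) z <= B.
    case/convE=> mu [m0 m1 hz]; rewrite (ap_ext _ (y := cmb mu (@pts W))) // ap_affine //.
    apply: ler_sum => j _; rewrite ler_piMl //; first exact/xi_ge0/conv_pts.
    by rewrite -m1 (bigD1 j) //= lerDl sumr_ge0.
  have t0 : 0 <= (B + 1) / g c0 by rewrite divr_ge0 // addr_ge0.
  have Pt : P (cmb (lam ((B + 1) / g c0)) p).
    by apply: inP => c; apply: addr_ge0; [apply: xi_ge0 | apply: mulr_ge0].
  have := bound _ Pt; rewrite apE' divfK // => h.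
  by have := xi_ge0 c0 Px; lra.
(* The time at which the facet of [c] is reached; the minimum is the moment of leaving [P]. *)
pose ratio c := ap (xi c) x / - g c.
have [c2 gc2 cmin] := arg_minP (P := fun c => g c < 0) ratio gc1.
have c2S := negS _ gc2; set t := ratio c2.
have t0 : 0 <= t by rewrite divr_ge0 ?xi_ge0 // oppr_ge0 ltW.
have Py : P (cmb (lam t) p).
  apply: inP => c; have [gc|gc] := leP 0 (g c).
    by apply: addr_ge0; [apply: xi_ge0 | apply: mulr_ge0].
  rewrite -[g c]opprK mulrN subr_ge0 -ler_pdivlMr ?oppr_gt0 //.
  exact: cmin.
have y2 : ap (xi c2) (cmb (lam t) p) = 0.
  by rewrite apE' /t /ratio invrN mulrN mulNr divfK ?subrr // lt_eqF.
have [G hG] := preserved gS cS.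
have Fy : Fs S (cmb (lam t) p) by apply/hG; split=> //; rewrite AE; have [] := (hG x).1 Fx.
have [c|gS' Fy'] := @zero_Fs (S :\ c2) _ Py.
  rewrite !inE negb_and negbK => /orP[/eqP ->//|cnS].
  exact: Fs_zero gS cnS Fy.
have cS' : (#|S :\ c2| <= k + size ns)%N.
  by apply: leq_trans cS; apply: subset_leq_card; apply: subsetDl.
have [G' hG'] := preserved gS' cS'.
(* The end point lies in [Fs (S :\ c2)] and has the image of [x]; as this face is preserved too, [x]
   would lie on the facet of [c2]. *)
have Fx' : Fs (S :\ c2) x by apply/hG'; split=> //; rewrite -(AE t); have [] := (hG' _).1 Fy'.
have := xpos c2 c2S; rewrite (Fs_zero gS' _ Fx') ?ltxx //.
by rewrite !inE eqxx.
Qed.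

End HRepresentation.

(** The list [x :: s] is too long to be independent, and the independence of [s] makes the
    coefficient of [x] in a dependence nonzero. *)
Lemma affine_span (F : pset) k (s : seq point) x : affdim_le F k -> size s = k.+1 ->
  List.Forall F s -> aff_indep s -> F x ->
  exists beta : 'I_(size s) -> R, \sum_l beta l = 1 /\ forall i, x i = cmb beta (@pts s) i.
Proof.
move=> dF ss Fs /aff_indepE ind Fx; apply: contrapT => no.
apply: (dF (x :: s)); first by rewrite lengthE /= ss -[Nat.add _ _]/(k + 2)%N addn2.
  by constructor.
apply/aff_indepE; rewrite [size _]/= => lam l1 h.
have E i : lam ord0 * x i + cmb (fun j => lam (lift ord0 j)) (@pts s) i = 0.
  by rewrite -[RHS](h i) /cmb big_ord_recl.
have l1' : lam ord0 + \sum_j lam (lift ord0 j) = 0 by rewrite -[RHS]l1 big_ord_recl.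
have [l0|l0] := eqVneq (lam ord0) 0; last first.
  case: no; exists (fun j => - lam (lift ord0 j) / lam ord0); split=> [|i].
    rewrite -mulr_suml sumrN; apply: (mulIf l0); rewrite mulfVK // mul1r.
    by apply/eqP; rewrite eq_sym -subr_eq0 opprK l1'.
  apply: (mulfI l0); rewrite /cmb mulr_sumr.
  apply/eqP; rewrite -subr_eq0 -[X in _ == X](E i); apply/eqP; congr (_ + _).
  rewrite -sumrN; apply: eq_bigr => j _.
  by rewrite !mulNr mulrN opprK mulrA [lam ord0 * _]mulrC divfK.
have tl : forall j, lam (lift ord0 j) = 0.
  apply: ind => [|i]; first by rewrite -[RHS]l1' l0 add0r.
  by rewrite -[RHS](E i) l0 mul0r add0r.
by move=> j; case: (unliftP ord0 j) => [j'|] ->; rewrite ?tl.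
Qed.

Lemma bounded_decomposition (I : finType) (cap : I -> nat) k : (k <= \sum_b cap b)%N ->
  exists kk : I -> nat, (forall b, kk b <= cap b)%N /\ (\sum_b kk b = k)%N.
Proof.
elim: k => [|k IH] hk; first by exists (fun=> 0%N); split=> //; rewrite big1.
have [kk [hkk sk]] := IH (ltnW hk).
have [b hb] : exists b, (kk b < cap b)%N.
  apply: contrapT => no; have : (\sum_b cap b <= \sum_b kk b)%N.
    by apply: leq_sum => b _; rewrite leqNgt; apply/negP => h; apply: no; exists b.
  by rewrite sk leqNgt hk.
exists (fun b' => kk b' + (b' == b))%N; split=> [b'|].
  by have [->|_] := eqVneq b' b; rewrite ?addn1 ?addn0.
by rewrite big_split /= sk (bigD1 b) //= eqxx big1 ?addn0 ?addn1 // => b' /negbTE ->.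
Qed.

Section LowerBound.
Variables (ns : seq nat) (k e : nat) (V : seq point) (D' : nat).
Local Notation N := (prod_dim ns).
Local Notation r := (size ns).
Local Notation blk := (@blk ns).
Hypotheses (ns_pos : (0 < r)%N) (ns2 : forall b : 'I_r, (2 <= nth 0%N ns b)%N).
Hypothesis k_le : (k <= \sum_(b < r) ((nth 0%N ns b - 2) %/ 2))%N.

Lemma PPSN_dim_ge : PPSN k ns e V -> affdim_eq (conv V) D' -> (2 * k + r + 1 <= D')%N.
Proof.
move=> [[pV skel_iso] [m [W [A [pW [face_iso proj]]]]]] [[s [ss [Vs ind_s]]] dimV].
rewrite leqNgt; apply/negP => small.
have cI : #|'I_r| = r by rewrite card_ord.
have ns1 (b : 'I_r) : (0 < nth 0%N ns b)%N by apply: leq_trans (ns2 b).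
have conv_lin x : conv W x -> conv V (linmap e m A x) by move=> Wx; apply/proj; exists x.
have [Fs [Fs_face Fs_sub Fs_inv]] : exists Fs : {set 'I_N} -> pset,
  [/\ forall S : {set 'I_N}, meets_all blk S -> is_face m (conv W) (Fs S) /\ exists x, Fs S x,
      forall S T : {set 'I_N}, meets_all blk S -> meets_all blk T ->
        (Defs.subset (Fs S) (Fs T) <-> S \subset T) &
      forall G, is_face m (conv W) G -> (exists x, G x) ->
        exists2 S, meets_all blk S & forall x, G x <-> Fs S x].
  apply: (poset_transfer (pr := meets_all blk) _ _ _ _ _ face_iso) => //.
  - exact: face_empty.
  - exact: face_empty.
  - by move=> S _; apply: dface_face.
  - by move=> G; apply: Delta_faces.
have skel_empty d X : skeleton d X k (fun=> False).
  split; first exact: face_empty.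
  by move=> [|x l]; [rewrite -[Nat.add _ _]/(k + 2)%N addn2 | move=> _ hl; inversion hl].
have [Gs [Gs_face Gs_sub Gs_inv]] : exists Gs : {set 'I_N} -> pset,
  [/\ forall S : {set 'I_N}, low blk k S -> skeleton e (conv V) k (Gs S) /\ exists x, Gs S x,
      forall S T : {set 'I_N}, low blk k S -> low blk k T ->
        (Defs.subset (Gs S) (Gs T) <-> S \subset T) &
      forall G, skeleton e (conv V) k G -> (exists x, G x) ->
        exists2 S, low blk k S & forall x, G x <-> Gs S x].
  apply: (poset_transfer (pr := low blk k) _ _ _ _ _ skel_iso) => //.
  - by move=> S /andP[].
  - move=> S /andP[gS cS]; split; first exact: dface_face.
    exact: dface_dim_le.
  - move=> G [fG dG]; have [|[S gS hS]] := Delta_faces fG; first by left.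
    right; exists S => //; rewrite /low gS leqNgt; apply/negP => cS.
    by apply: (dface_dim_gt gS cS); apply: affdim_le_sub dG => x /hS.
(* The preimage of a face of the image is a face of [conv W]; [J S] indexes the preimage of
   [Gs S]. *)
have exJ S : exists T : {set 'I_N}, low blk k S -> meets_all blk T /\
    forall x, Fs T x <-> conv W x /\ Gs S (linmap e m A x).
  have [lS|] := boolP (low blk k S); last by exists S.
  have [[fG _] [y Gy]] := Gs_face _ lS.
  have /proj[x [Wx yx]] := face_sub fG Gy.
  have fX := face_preimage conv_lin fG.
  have [|T gT hT] := Fs_inv _ fX.
    by exists x; split=> //; apply: face_pointwise fG yx _ Gy; apply: conv_lin.
  by exists T => _; split=> // z; rewrite hT.
have [J hJ] := choice exJ.
have onto : forall S, low blk k S -> exists2 T, low blk k T & J T = S.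
  apply: J_onto => [S /hJ[]//|S T lS lT|S T lS lT gST].
  - have [gS eS] := hJ _ lS; have [gT eT] := hJ _ lT.
    apply/idP/idP => [/(Fs_sub _ _ gS gT) H|/(Gs_sub _ _ lS lT) H].
      apply/(Gs_sub _ _ lS lT) => y Gy; have [[fG _] _] := Gs_face _ lS.
      have [[fT _] _] := Gs_face _ lT.
      have /proj[x [Wx yx]] := face_sub fG Gy.
      have Gx : Gs S (linmap e m A x) by apply: face_pointwise fG yx _ Gy; apply: conv_lin.
      have /eT[_ Tx] := H x ((eS x).2 (conj Wx Gx)).
      by apply: face_pointwise fT _ (face_sub fG Gy) Tx.
    by apply/(Fs_sub _ _ gS gT) => x /eS[Wx Gx]; apply/eT; split=> //; apply: H.
  - have [gS eS] := hJ _ lS; have [gT eT] := hJ _ lT.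
    have [_ [x Fx]] := Fs_face _ gST.
    have /eS[Wx Sx] : Fs (J S) x by apply: (Fs_sub _ _ gST gS).2 Fx; apply: subsetIl.
    have /eT[_ Tx] : Fs (J T) x by apply: (Fs_sub _ _ gST gT).2 Fx; apply: subsetIr.
    have [[fS dS] _] := Gs_face _ lS; have [[fT _] _] := Gs_face _ lT.
    have [||U lU hU] := Gs_inv (fun y => Gs S y /\ Gs T y).
    + split; first exact: face_inter.
      by apply: affdim_le_sub dS => y [].
    + by exists (linmap e m A x).
    have /andP[gU _] := lU; apply: meets_all_sub gU; rewrite subsetI.
    apply/andP; split; first by apply/(Gs_sub _ _ lU lS) => y /hU[].
    by apply/(Gs_sub _ _ lU lT) => y /hU[].
have preserved (S : {set 'I_N}) : meets_all blk S -> (#|S| <= k + r)%N ->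
    exists G : pset, forall x, Fs S x <-> conv W x /\ G (linmap e m A x).
  move=> gS cS; have lS : low blk k S by rewrite /low gS cI.
  by have [T lT <-] := onto S lS; exists (Gs T); apply: (hJ _ lT).2.
have [xi hxi] := facet_exists ns1 Fs_face.
have xi_ge0 c x : conv W x -> 0 <= ap (xi c) x by move=> Wx; apply: (hxi c).1.
have xi_facet c x := (hxi c).2 x.
have rel (S : {set 'I_N}) : meets_all blk S ->
    exists x, Fs S x /\ forall c, c \in S -> 0 < ap (xi c) x.
  exact (@relint m W ns Fs ns1 Fs_face Fs_sub xi xi_ge0 xi_facet S).
have [T0 _ tT] := sub_transversal (meets_all_setT ns).
have gT := transversal_meets tT.
(* One point at the vertex [T0] and one inside each of the [n] edges at it. For [c] outside [T0],
   [xi c] vanishes at all these points except the one on its own edge, so a nonzero coefficient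
   vector of sum zero moves some facet functional. *)
pose n := #|~: T0|.
pose face_of (i : 'I_n.+1) : {set 'I_N} := if unlift ord0 i is Some j then enum_val j |: T0 else T0.
have gface i : meets_all blk (face_of i).
  by rewrite /face_of; case: unliftP => // j _; apply: meets_all_sub gT; apply: subsetU1.
have [q hq] := choice (fun i => rel _ (gface i)).
have Pq i : conv W (q i) by apply: (Fs_P Fs_face (gface i)); have [] := hq i.
(* Affine coordinates of the images with respect to the [D' + 1] points of [s]. Orthogonality to
   them puts a direction in the kernel of the projection and also makes its coefficients sum to
   zero. *)
have exb i := affine_span dimV ss Vs ind_s (conv_lin _ (Pq i)).
have [beta hbeta] := choice exb.
have [kk [kkcap kks]] := bounded_decomposition k_le.
have cT : #|T0| = r by case/andP: tT => _ /eqP ->.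
have cN : (n + r = N)%N by rewrite /n -cT addnC cardsC card_ord.
have sum_kk : (\sum_(b < r) (2 * kk b + 3) = 2 * k + 3 * r)%N.
  by rewrite big_split /= -big_distrr /= kks sum_nat_const card_ord [(r * 3)%N]mulnC.
have block_ge b : (2 * kk b + 3 <= #|[set c | blk c == b]|)%N.
  by rewrite block_card; have := kkcap b; have := ns2 b; lia.
have N_ge : (2 * k + 3 * r <= n + r)%N.
  rewrite -sum_kk cN -[N]card_ord -sum1_card (partition_big blk predT) //=.
  apply: leq_sum => b _; apply: leq_trans (block_ge b) _.
  by rewrite -sum1_card; apply: eq_leq; apply: eq_bigl => c; rewrite inE.
have [|||v [v0 vbeta vneg]] := @few_negatives R n _ _ blk
   (fun c i => ap (xi c) (q i)) _ (fun l i => beta i l) kk.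
- exact: block_ge.
- by rewrite card_ord.
(* The count that fixes the constant: here [D' <= 2k + r] enters. *)
- rewrite !card_ord sum_kk (ss : size s = D'.+1) -cN; move: small N_ge ns_pos; lia.
pose w i := v 0 i.
have w1 : \sum_i w i = 0.
  transitivity (\sum_i w i * \sum_l beta i l).
    by apply: eq_bigr => i _; rewrite (hbeta i).1 mulr1.
  under eq_bigr do rewrite mulr_sumr.
  by rewrite exchange_big /= big1 // => l _; apply: vbeta.
have wA d : cmb w (fun i => linmap e m A (q i)) d = 0.
  rewrite /cmb; under eq_bigr do rewrite (hbeta _).2 /cmb mulr_sumr.
  rewrite exchange_big /= big1 // => l _.
  under eq_bigr do rewrite mulrA.
  by rewrite -mulr_suml [\sum_i _](vbeta l) mul0r.
have gw c : form (fun i => ap (xi c) (q i)) v = \sum_i w i * ap (xi c) (q i) by [].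
pose neg b := [set c : 'I_N | (blk c == b) && (form (fun i => ap (xi c) (q i)) v < 0)].
(* A block without decreasing functionals must still contribute an element, so that [S] indexes a
   face; the bound [kk b + 1] leaves room for it. *)
have exS b : exists Sb : {set 'I_N},
    [/\ neg b \subset Sb, (#|Sb| <= (kk b).+1)%N & exists2 c, c \in Sb & blk c = b].
  have [ne|[c hc]] := set_0Vmem (neg b); last first.
    exists (neg b); split=> //; first exact: vneg.
    by exists c => //; move: hc; rewrite inE => /andP[/eqP].
  have /meets_allP/(_ b)[c _ bc] := gT.
  by exists [set c]; rewrite ne sub0set cards1; split=> //; exists c; rewrite ?inE.
have [Sb hSb] := choice exS.
pose S := \bigcup_b Sb b.
have gS : meets_all blk S.
  apply/meets_allP => b; have [_ _ [c cS bc]] := hSb b.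
  by exists c => //; apply/bigcupP; exists b.
have cS : (#|S| <= k + r)%N.
  apply: leq_trans (leq_card_bigcup _ _) _.
  apply: leq_trans (_ : (\sum_(b < r) (kk b + 1) <= _)%N).
    by apply: leq_sum => b _; have [_ + _] := hSb b; rewrite addn1.
  by rewrite big_split /= kks sum_nat_const card_ord muln1.
apply: (no_short_direction pW ns_pos ns1 Fs_face Fs_sub Fs_inv xi_ge0 xi_facet
  preserved Pq w1 wA gS cS).
  move=> c gc; apply/bigcupP; exists (blk c) => //; have [/subsetP s1 _ _] := hSb (blk c).
  by apply: s1; rewrite inE eqxx.
(* If no facet functional changed, the coefficients at the edge points would vanish one by one, and
   then, by the zero sum, the one at the vertex. *)
apply: contrapT => no; case/eqP: v0; apply/rowP => i; rewrite mxE.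
have wS (j : 'I_n) : w (lift ord0 j) = 0.
  have cT0 : enum_val j \notin T0 by have := enum_valP j; rewrite inE.
  have g0 : \sum_i w i * ap (xi (enum_val j)) (q i) = 0.
    by apply/eqP/negPn/negP => g0; apply: no; exists (enum_val j).
  move: g0; rewrite (bigD1 (lift ord0 j)) //= big1 ?addr0 => [/eqP|i' ij].
    rewrite mulf_eq0 => /orP[/eqP //|].
    have [_ h] := hq (lift ord0 j).
    by rewrite gt_eqF // h // /face_of liftK !inE eqxx.
  have [h _] := hq i'; rewrite (Fs_zero ns1 Fs_sub xi_facet (gface i') _ h) ?mulr0 //.
  rewrite /face_of; case: unliftP ij => [j' ->|_ _] //.
  rewrite (inj_eq lift_inj) => jj; rewrite !inE negb_or cT0 andbT.
  by rewrite (inj_eq enum_val_inj) eq_sym.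
case: (unliftP ord0 i) => [j ->|->]; first exact: wS.
by have := w1; rewrite big_ord_recl big1 ?addr0 // => j _; apply: wS.
Qed.

End LowerBound.

Lemma fold_rightE ns : List.fold_right (fun n acc =>
    Nat.add (Nat.div (Nat.sub n 2) 2) acc) 0%N ns =
  (\sum_(b < size ns) ((nth 0%N ns b - 2) %/ 2))%N.
Proof.
elim: ns => [|n ns IH]; first by rewrite big_ord0.
rewrite big_ord_recl -IH; congr addn; rewrite [nth _ _ _]/=.
have e := PeanoNat.Nat.div_mod_eq (n - 2)%N 2.
have h := PeanoNat.Nat.mod_upper_bound (n - 2)%N 2 (PeanoNat.Nat.neq_succ_0 1).
by rewrite -[LHS]/(Nat.div (n - 2)%N 2); lia.
Qed.

Theorem delta_pr_formula (ns : seq nat) (k : nat) : le 1 (length ns) ->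
  List.Forall (fun n => le 2 n) ns ->
  le k (List.fold_right (fun n acc => Nat.add (Nat.div (Nat.sub n 2) 2) acc) 0%N ns) ->
  delta_pr_is k ns (2 * k + size ns + 1)%N.
Proof.
move=> /ssrnat.leP ns0 /(ForallP _ 0%N) ns2 /ssrnat.leP; rewrite fold_rightE => k_le.
have ge e V D' (h : PPSN k ns e V) (h' : affdim_eq (conv V) D') :
    (2 * k + size ns + 1 <= D')%N.
  by apply: PPSN_dim_ge h h' => // b; apply/ssrnat.leP/ns2.
split; last by move=> e V D' h h'; apply/ssrnat.leP; apply: ge h h'.
have C := construction_PPSN k ns0.
exists (2 * k + size ns + 1)%N, (proj_verts ns k); split=> //.
have [[pV _] _] := C.
(* The ambient space bounds the dimension of the example from above, and the lower bound, applied to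
   the example itself, does so from below. *)
have [||D hD dD] := @affdim_exists (2 * k + size ns + 1) (conv (proj_verts ns k)).
- exists (proj ns k (centroid [set: 'I_(prod_dim ns)])); apply: conv_proj.
  by have [] := centroid_dface (meets_all_setT ns).
- by move=> x hx i /ssrnat.leP; apply: conv_in_Rd pV hx.
suff -> : (2 * k + size ns + 1)%N = D by [].
by apply/eqP; rewrite eqn_leq hD (ge _ _ _ C dD).
Qed.

End Polytopes.

Theorem theorem1p1 (ns : list nat) (k : nat) :
  (1 <= length ns)%nat ->
  Forall (fun n => (2 <= n)%nat) ns ->
  (k <= fold_right (fun n acc => ((n - 2) / 2 + acc)%nat) 0%nat ns)%nat ->
  delta_pr_is k ns (2 * k + length ns + 1)%nat.
Proof. exact (@Polytopes.delta_pr_formula ns k). Qed.
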